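(* Let $(G,\Sigma)$ be a nonempty twisted locally compact étale groupoid, not necessarily Hausdorff, with locally compact Hausdorff unit space. Let $H$ be an infinite-dimensional Hilbert space and let $J\subsetneq B(H)$ be a norm-closed two-sided ideal. Then $$B(H)/J\not\cong C^*(G,\Sigma).$$ In particular, neither $B(H)$ nor $\mathcal Q(H)=B(H)/\mathcal K(H)$ is $*$-isomorphic to $C^*(G,\Sigma)$. More precisely, every $*$-homomorphism $\varphi\colon B(H)/J\to C^*(G,\Sigma)$ satisfies $$\varphi(B(H)/J)\subseteq\ker\lambda_{\mathrm{red}},$$ where $\lambda_{\mathrm{red}}\colon C^*(G,\Sigma)\to C_r^*(G,\Sigma)$ is the canonical surjection. Consequently, if $C^*(G,\Sigma)$ is unital, there is no unital $*$-homomorphism from $B(H)/J$ into $C^*(G,\Sigma)$.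
   Context: $\mathcal K(H)$ denotes the compact operators; $*$-homomorphisms are not assumed unital unless stated. Groupoids. A topological groupoid $G$ is a small category in which every arrow is invertible, with a topology making multiplication and inversion continuous. Its unit space is $G^{(0)}$; $s,r$ are source and range; $\alpha\beta$ is defined iff $s(\alpha)=r(\beta)$. $G$ is étale if $s\colon G\to G^{(0)}$ is a local homeomorphism. Twists. A twist over $G$ is a central extension of topological groupoids $G^{(0)}\times\mathbb T\xrightarrow{\iota}\Sigma\xrightarrow{p}G$ such that $p$ is the identity on unit spaces and makes $\Sigma$ a locally trivial principal $\mathbb T$-bundle over $G$; $p^{-1}(G^{(0)})=\iota(G^{(0)}\times\mathbb T)$; and $\iota(r(\sigma),z)\sigma=\sigma\,\iota(s(\sigma),z)$. Write $z\sigma=\iota(r(\sigma),z)\sigma$. The Fell line bundle is $L=(\Sigma\times\mathbb C)/\mathbb T$ for $z\cdot(\sigma,a)=(z\sigma,\overline z a)$, with class $[\sigma,a]\in L_{p(\sigma)}$, norm $|a|$, product $[\sigma,a][\tau,b]=[\sigma\tau,ab]$ and involution $[\sigma,a]^*=[\sigma^{-1},\overline a]$. Algebras. If $G$ is Hausdorff, $C_c(G,L)$ is the space of compactly supported continuous sections of $L$; in general it is the linear span of continuous sections on open Hausdorff subsets whose supports are compact in those subsets, extended by zero. It is a $*$-algebra under $(f*g)(\gamma)=\sum_{\alpha\beta=\gamma}f(\alpha)g(\beta)$, $f^*(\gamma)=f(\gamma^{-1})^*$ (finite sums). For $u\in G^{(0)}$ put $G_u=s^{-1}(u)$, $\mathcal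 H_u=\bigoplus_{\gamma\in G_u}L_\gamma$ ($\ell^2$-sum) and $(\lambda_u(f)\xi)_\gamma=\sum_{\eta\in G_u}f(\gamma\eta^{-1})\xi_\eta$. $C_r^*(G,\Sigma)$ is the completion of $C_c(G,L)$ in $\|f\|_r=\sup_u\|\lambda_u(f)\|$. $C^*(G,\Sigma)$ is the completion of $C_c(G,L)$ in the universal norm (the supremum of $\|\pi(f)\|$ over all $*$-representations $\pi$ of $C_c(G,L)$ on Hilbert spaces). The identity on $C_c(G,L)$ induces the surjection $\lambda_{\mathrm{red}}$. *)

(* Defs.v *)
From HB Require Import structures.
From mathcomp Require Import all_boot all_order all_algebra.
From mathcomp Require Import all_classical all_reals all_analysis.
From mathcomp Require Import complex.

Set Implicit Arguments.
Unset Strict Implicit.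
Unset Printing Implicit Defensive.

Import Order.TTheory GRing.Theory Num.Theory numFieldNormedType.Exports.

Local Open Scope classical_set_scope.
Local Open Scope ring_scope.

Record lin_subspace (K : fieldType) (V : lmodType K) := LinSubspace {
  lin_subspace_pred :> V -> bool;
  lin_subspaceP : submod_closed lin_subspace_pred }.

HB.instance Definition _ (K : fieldType) (V : lmodType K) (W : lin_subspace V) :=
  GRing.isSubmodClosed.Build K V (lin_subspace_pred W)
    (GRing.submod_closed_semi (lin_subspaceP W)).

Section QuotientSpace.
Variables (K : fieldType) (V : lmodType K) (W : lin_subspace V).
Local Open Scope quotient_scope.

Definition quot_space : Type :=
  {ideal_quot GRing.ZmodClosed.clone V (lin_subspace_pred W) _}.

HB.instance Definition _ := ZmodQuotient.on quot_space.
HB.instance Definition _ := Choice.on quot_space.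

Definition quot_scale (a : K) (x : quot_space) : quot_space :=
  \pi_quot_space (a *: repr x).

Lemma pi_quot_scale (a : K) (x : V) :
  quot_scale a (\pi_quot_space x) = \pi_quot_space (a *: x).
Proof.
apply/eqP; rewrite -Quotient.idealrBE -scalerBr rpredZ//.
by rewrite Quotient.idealrBE reprK.
Qed.

Lemma pi_quot_add (x y : V) :
  \pi_quot_space x + \pi_quot_space y = \pi_quot_space (x + y).
Proof. by rewrite !piE. Qed.

Fact quot_scaleA a b x :
  quot_scale a (quot_scale b x) = quot_scale (a * b) x.
Proof. by rewrite -[x]reprK (pi_quot_scale b) !pi_quot_scale scalerA. Qed.

Fact quot_scale1 : left_id 1 quot_scale.
Proof. by move=> x; rewrite -[x]reprK pi_quot_scale scale1r. Qed.

Fact quot_scaleDr : right_distributive quot_scale +%R.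
Proof.
move=> a x y; rewrite -[x]reprK -[y]reprK.
by rewrite pi_quot_add !pi_quot_scale pi_quot_add scalerDr.
Qed.

Fact quot_scaleDl x : {morph quot_scale^~ x : a b / a + b}.
Proof.
move=> a b; rewrite -[x]reprK !pi_quot_scale.
by rewrite pi_quot_add scalerDl.
Qed.

HB.instance Definition _ := GRing.Zmodule_isLmodule.Build K quot_space
  quot_scaleA quot_scale1 quot_scaleDr quot_scaleDl.

Definition quot_class (x : V) : quot_space := \pi_quot_space x.

End QuotientSpace.

Section BoundedOperators.
Variables (R : realType) (V : normedModType R[i]).

Definition is_bounded_op (T : V -> V) : bool :=
  `[< linear T /\ continuous T >].

Record bounded_op := BoundedOp {
  bounded_op_fun :> V -> V;
  bounded_opP : is_bounded_op bounded_op_fun }.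

HB.instance Definition _ := [isSub for bounded_op_fun].
HB.instance Definition _ := [Choice of bounded_op by <:].

Fact is_bounded_op_submod : submod_closed is_bounded_op.
Proof.
split=> [|a S T]; rewrite ?unfold_in.
  apply/asboolP; split; last exact: cst_continuous.
  by move=> a u v; rewrite [RHS](_ : _ = a *: 0 + 0)// scaler0 addr0.
move=> /asboolP[lS cS] /asboolP[lT cT]; apply/asboolP; split.
  move=> b u v; rewrite !fctE.
  by rewrite lS lT !scalerDr !scalerA (mulrC a) addrACA.
move=> x; apply: (@cvgD _ _ _ _ _ (fun y => a *: S y)); last exact: cT.
by apply: cvgZr; exact: cS.
Qed.

HB.instance Definition _ := GRing.isSubmodClosed.Build R[i] (V -> V)
  is_bounded_op (GRing.submod_closed_semi is_bounded_op_submod).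
HB.instance Definition _ := [SubChoice_isSubLmodule of bounded_op by <:].

Fact bounded_op_is_linear (T : bounded_op) : linear T.
Proof. by have /asboolP[] := bounded_opP T. Qed.

HB.instance Definition _ (T : bounded_op) :=
  GRing.isLinear.Build R[i] V V _ (bounded_op_fun T) (bounded_op_is_linear T).

Lemma bounded_op_continuous (T : bounded_op) : continuous T.
Proof. by have /asboolP[] := bounded_opP T. Qed.

Lemma bounded_op_inj (S T : bounded_op) : S =1 T -> S = T.
Proof. by move=> ST; apply: val_inj; apply/funext. Qed.

Definition op_norm (T : bounded_op) : R :=
  sup [set complex.Re `|T x| | x in [set x : V | `|x| <= 1]].

Let normE (W : normedModType R[i]) (x : W) : (complex.Re `|x|)%:C%C = `|x|.
Proof. by rewrite RRe_real// normr_real. Qed.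

Let le_norm (W : normedModType R[i]) (x y : W) :
  (`|x| <= `|y|) = (complex.Re `|x| <= complex.Re `|y|).
Proof. by rewrite -(normE x) -(normE y) lecR. Qed.

Let has_ubound_op_norm T :
  has_ubound [set complex.Re `|bounded_op_fun T x| | x in [set x : V | `|x| <= 1]].
Proof.
have /bounded_funP/(_ 1)[M TM] : bounded_near T (nbhs (0 : V)).
  exact/linear_bounded_continuous/bounded_op_continuous.
exists (complex.Re M) => _ [x x1 <-]; have := TM _ x1.
by rewrite lecE => /andP[].
Qed.

Let op_norm_ub T x : `|x| <= 1 -> complex.Re `|bounded_op_fun T x| <= op_norm T.
Proof.
by move=> x1; apply: ub_le_sup; [exact: has_ubound_op_norm|exists x].
Qed.

Let op_norm_le T M :
  (forall x, `|x| <= 1 -> complex.Re `|bounded_op_fun T x| <= M) -> op_norm T <= M.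
Proof.
move=> TM; apply: ge_sup; last by move=> _ [x x1 <-]; exact: TM.
by exists (complex.Re `|T 0|), 0 => //=; rewrite normr0.
Qed.

Fact op_norm_triangle (S T : bounded_op) :
  (op_norm (S + T))%:C%C <= (op_norm S)%:C%C + (op_norm T)%:C%C.
Proof.
rewrite -rmorphD lecR; apply: op_norm_le => x x1 /=.
apply: le_trans (lerD (op_norm_ub S x1) (op_norm_ub T x1)).
by have := ler_normD (S x) (T x); rewrite lecE => /andP[_]; rewrite raddfD.
Qed.

Let op_normZ_le a T : op_norm (a *: T) <= complex.Re `|a| * op_norm T.
Proof.
apply: op_norm_le => x x1 /=.
have -> : complex.Re `|(a *: T) x| = complex.Re `|a| * complex.Re `|T x|.
  rewrite [(a *: T) x]/(a *: T x) normrZ -(normE (T x)).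
  by rewrite -(@RRe_real _ `|a|) ?normr_real// -rmorphM.
rewrite ler_wpM2l ?op_norm_ub//.
by have := normr_ge0 a; rewrite lecE => /andP[].
Qed.

Fact op_normZ (a : R[i]) (T : bounded_op) :
  (op_norm (a *: T))%:C%C = `|a| * (op_norm T)%:C%C.
Proof.
rewrite -(@RRe_real _ `|a|) ?normr_real// -rmorphM; congr (_%:C%C).
apply/eqP; rewrite eq_le op_normZ_le andTb.
have [->|a0] := eqVneq a 0.
  have n0 : `|0 : V| <= 1 by rewrite normr0 ler01.
  rewrite normr0 mul0r scale0r; apply: le_trans (op_norm_ub 0 n0).
  by have := normr_ge0 ((0 : bounded_op) 0); rewrite lecE => /andP[].
rewrite -[leLHS]mulr1.
have a1 : complex.Re `|a| * complex.Re `|a^-1| = 1.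
  have : `|a| * `|a^-1| = 1 by rewrite -normrM divff// normr1.
  rewrite -(@RRe_real _ `|a|) ?normr_real//.
  by rewrite -(@RRe_real _ `|a^-1|) ?normr_real// -rmorphM => -[].
have := op_normZ_le a^-1 (a *: T); rewrite scalerA mulVf// scale1r.
move/(ler_wpM2l (x := complex.Re `|a|)); rewrite mulrA a1 mul1r mulr1; apply.
by have := normr_ge0 a; rewrite lecE => /andP[].
Qed.

Fact op_norm0_eq0 (T : bounded_op) : (op_norm T)%:C%C = 0 -> T = 0.
Proof.
move=> [T0]; apply: bounded_op_inj => x.
have [->|x0] := eqVneq x 0; first by rewrite linear0.
have nx0 : `|x| != 0 by rewrite normr_eq0.
have y1 : `| `|x|^-1 *: x| <= 1.
  by rewrite normrZ ger0_norm ?invr_ge0// mulVf.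
have := op_norm_ub T y1; rewrite T0 -lecR normE normr_le0.
by rewrite linearZ scaler_eq0 invr_eq0 (negPf nx0) => /eqP.
Qed.

HB.instance Definition _ := Lmodule_isNormed.Build R[i] bounded_op
  op_norm_triangle op_normZ op_norm0_eq0.

Fact bounded_op_comp_subproof (S T : bounded_op) : is_bounded_op (S \o T).
Proof.
apply/asboolP; split; first by move=> a u v; rewrite /= !linearP.
by move=> x; apply: continuous_comp; exact: bounded_op_continuous.
Qed.

Definition comp_op (S T : bounded_op) : bounded_op :=
  BoundedOp (bounded_op_comp_subproof S T).

Fact bounded_op_id_subproof : is_bounded_op (@id V).
Proof. by apply/asboolP; split => // x; exact: cvg_id. Qed.

Definition id_op : bounded_op := BoundedOp bounded_op_id_subproof.

Definition is_compact_op (T : bounded_op) : bool :=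
  `[< precompact (T @` [set x : V | `|x| <= 1]) >].

Fact is_compact_op_submod : submod_closed is_compact_op.
Proof.
split=> [|a S T]; rewrite ?unfold_in.
  apply/asboolP; exists [set 0]; first by move=> _ [x _ <-].
  split; first exact: compact_set1.
  by apply: compact_closed; [exact: norm_hausdorff|exact: compact_set1].
move=> /asboolP[A SA [cA _]] /asboolP[B TB [cB _]]; apply/asboolP.
have cAB : compact ((fun u : V * V => a *: u.1 + u.2) @` (A `*` B)).
  apply: continuous_compact; last exact: compact_setX.
  apply: continuous_subspaceT => u.
  by apply: cvgD; [apply: cvgZr; exact: cvg_fst|exact: cvg_snd].
exists ((fun u : V * V => a *: u.1 + u.2) @` (A `*` B)).
  move=> _ [x x1 <-]; exists (S x, T x) => //=.
  by split; [apply: SA|apply: TB]; exists x.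
by split=> //; apply: compact_closed => //; exact: norm_hausdorff.
Qed.

Definition compact_ops : lin_subspace bounded_op := LinSubspace is_compact_op_submod.

End BoundedOperators.

(* [inner] is linear in its first argument. *)
Record hilbert (R : realType) := Hilbert {
  hilbert_space :> completeNormedModType R[i];
  inner : hilbert_space -> hilbert_space -> R[i];
  inner_linear : forall (a : R[i]) (x y z : hilbert_space),
    inner (a *: x + y) z = a * inner x z + inner y z;
  inner_conj : forall x y : hilbert_space, inner y x = (inner x y)^*;
  inner_norm : forall x : hilbert_space, inner x x = `|x| ^+ 2 }.

Definition infinite_dimensional (R : realType) (H : hilbert R) : Prop :=
  forall (n : nat) (v : 'I_n -> H),
    exists x : H, forall c : 'I_n -> R[i], x <> \sum_(i < n) c i *: v i.

(* The operations of a *-algebra, which suffice to speak of *-homomorphisms.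
   The laws are not part of the structure, so that the operations of B(H) and
   of B(H)/J can be given before the laws that they satisfy are proved. *)
Record star_algebra (R : realType) := StarAlgebra {
  star_module :> lmodType R[i];
  star_mul : star_module -> star_module -> star_module;
  star_inv : star_module -> star_module }.

Record star_morphism (R : realType) (A B : star_algebra R) (phi : A -> B) :
    Prop := StarMorphism {
  star_morphism_linear : linear phi;
  star_morphism_mul : forall x y : A,
    phi (star_mul x y) = star_mul (phi x) (phi y);
  star_morphism_inv : forall x : A, phi (star_inv x) = star_inv (phi x) }.

Definition star_isomorphic (R : realType) (A B : star_algebra R) : Prop :=
  exists2 phi : A -> B, star_morphism phi & bijective phi.

Record cstar_algebra (R : realType) := CstarAlgebra {
  cstar_module :> completeNormedModType R[i];
  cmul : cstar_module -> cstar_module -> cstar_module;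
  cstar : cstar_module -> cstar_module;
  cmulA : associative cmul;
  cmul_linearl : forall (a : R[i]) (x y z : cstar_module),
    cmul (a *: x + y) z = a *: cmul x z + cmul y z;
  cmul_linearr : forall (a : R[i]) (x y z : cstar_module),
    cmul z (a *: x + y) = a *: cmul z x + cmul z y;
  cstar_antilinear : forall (a : R[i]) (x y : cstar_module),
    cstar (a *: x + y) = a^* *: cstar x + cstar y;
  cstarM : forall x y : cstar_module, cstar (cmul x y) = cmul (cstar y) (cstar x);
  cstarK : involutive cstar;
  cnorm_mul : forall x y : cstar_module, `|cmul x y| <= `|x| * `|y|;
  cnorm_cstar : forall x : cstar_module, `|cmul (cstar x) x| = `|x| ^+ 2 }.

Definition cstar_star_algebra (R : realType) (A : cstar_algebra R) :
    star_algebra R :=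
  @StarAlgebra R (cstar_module A) (@cmul R A) (@cstar R A).

Coercion cstar_star_algebra : cstar_algebra >-> star_algebra.

Definition is_identity (R : realType) (A : star_algebra R) (e : A) : Prop :=
  forall x : A, star_mul e x = x /\ star_mul x e = x.

Section OperatorAlgebras.
Variables (R : realType) (H : hilbert R).

Definition is_adjoint (T S : bounded_op H) : Prop :=
  forall x y : H, inner (S x) y = inner x (T y).

(* The adjoint exists by the Riesz representation theorem and is unique, so
   the default value 0 is never used. *)
Definition adjoint (T : bounded_op H) : bounded_op H :=
  xget 0 [set S | is_adjoint T S].

Definition BH : star_algebra R :=
  @StarAlgebra R (bounded_op H) (@comp_op R H) adjoint.

Definition two_sided_ideal (J : lin_subspace (bounded_op H)) : Prop :=
  forall S T : bounded_op H, J T -> J (comp_op S T) /\ J (comp_op T S).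

(* Operations on representatives; they are the quotient operations as soon as
   [J] is a norm-closed two-sided ideal, such a [J] being self-adjoint. *)
Definition BH_quotient (J : lin_subspace (bounded_op H)) : star_algebra R :=
  @StarAlgebra R (quot_space J)
    (fun x y => quot_class J (comp_op (repr x) (repr y)))
    (fun x => quot_class J (adjoint (repr x))).

Definition calkin : star_algebra R := BH_quotient (compact_ops H).

End OperatorAlgebras.

(* A groupoid is given by its set of arrows, a unit being identified with its
   identity arrow; [mul a b] is meaningful only when [src a = rng b].
   Continuity of [src] and [rng] follows from that of [inv] and [mul]. *)
Record topGroupoid := TopGroupoid {
  arrows :> topologicalType;
  src : arrows -> arrows;
  rng : arrows -> arrows;
  inv : arrows -> arrows;
  mul : arrows -> arrows -> arrows;
  src_src : forall a, src (src a) = src a;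
  rng_src : forall a, rng (src a) = src a;
  src_rng : forall a, src (rng a) = rng a;
  rng_rng : forall a, rng (rng a) = rng a;
  src_mul : forall a b, src a = rng b -> src (mul a b) = src b;
  rng_mul : forall a b, src a = rng b -> rng (mul a b) = rng a;
  mul_assoc : forall a b c, src a = rng b -> src b = rng c ->
    mul a (mul b c) = mul (mul a b) c;
  mul_rng : forall a, mul (rng a) a = a;
  mul_src : forall a, mul a (src a) = a;
  src_inv : forall a, src (inv a) = rng a;
  rng_inv : forall a, rng (inv a) = src a;
  mul_inv : forall a, mul a (inv a) = rng a;
  inv_mul : forall a, mul (inv a) a = src a;
  inv_continuous : continuous inv;
  mul_continuous : {within [set ab : arrows * arrows | src ab.1 = rng ab.2],
    continuous (fun ab : arrows * arrows => mul ab.1 ab.2)} }.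

Definition units (G : topGroupoid) : set G := [set u | src u = u].
Arguments units : clear implicits.

(* [B] carries the subspace topology, and [f] takes its values in [B]. *)
Definition local_homeomorphism (X Y : topologicalType) (f : X -> Y)
    (B : set Y) : Prop :=
  forall x : X, exists U : set X, [/\ open U, U x,
    {within U, continuous f}, set_inj U f &
    forall W : set X, open W -> W `<=` U ->
      exists2 O : set Y, open O & f @` W = O `&` B].

Definition etale (G : topGroupoid) : Prop :=
  local_homeomorphism (@src G) (units G).

(* Unlike the library's [locally_compact], the compact neighbourhoods are not
   asked to be closed, which would be too strong for a non-Hausdorff space. *)
Definition locally_compact_subspace (X : topologicalType) (A : set X) : Prop :=
  forall x, A x -> forall U, nbhs x U ->
    exists K : set X, [/\ K `<=` A `&` U, compact K & within A (nbhs x) K].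

Definition hausdorff_subspace (X : topologicalType) (A : set X) : Prop :=
  hausdorff_space (subspace A).

Definition circle (R : realType) : set R[i]^o := [set z | `|z| = 1].
Arguments circle R : clear implicits.

(* The unit space of [Sigma] is identified with that of [G] through
   [u |-> twist_iota u 1]; [twist_iota u z] is meaningful for [u] a unit and [z] in the
   circle. *)
Record twist (R : realType) (G : topGroupoid) := Twist {
  Sigma :> topGroupoid;
  twist_iota : G -> R[i]^o -> Sigma;
  twist_proj : Sigma -> G;
  iota_continuous : {within units G `*` circle R,
    continuous (fun uz : G * R[i]^o => twist_iota uz.1 uz.2)};
  iota_src : forall u z, units G u -> circle R z -> src (twist_iota u z) = twist_iota u 1;
  iota_rng : forall u z, units G u -> circle R z -> rng (twist_iota u z) = twist_iota u 1;
  iota_mul : forall u z w, units G u -> circle R z -> circle R w ->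
    mul (twist_iota u z) (twist_iota u w) = twist_iota u (z * w);
  iota_inj : set_inj (units G `*` circle R)
    (fun uz : G * R[i]^o => twist_iota uz.1 uz.2);
  proj_continuous : continuous twist_proj;
  proj_src : forall a, twist_proj (src a) = src (twist_proj a);
  proj_rng : forall a, twist_proj (rng a) = rng (twist_proj a);
  proj_mul : forall a b, src a = rng b ->
    twist_proj (mul a b) = mul (twist_proj a) (twist_proj b);
  proj_unit : forall u, units G u -> twist_proj (twist_iota u 1) = u;
  unit_proj : forall a, units Sigma a -> twist_iota (twist_proj a) 1 = a;
  proj_kernel : twist_proj @^-1` (units G) =
    (fun uz : G * R[i]^o => twist_iota uz.1 uz.2) @` (units G `*` circle R);
  iota_central : forall a z, circle R z ->
    mul (twist_iota (rng (twist_proj a)) z) a = mul a (twist_iota (src (twist_proj a)) z);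
  twist_locally_trivial : forall g : G,
    exists (U : set G) (h : G * R[i]^o -> Sigma) (k : Sigma -> R[i]^o),
      [/\ open U /\ U g,
          {within U `*` circle R, continuous h},
          {within twist_proj @^-1` U, continuous k},
          forall x z, U x -> circle R z ->
            [/\ twist_proj (h (x, z)) = x, k (h (x, z)) = z &
              forall w, circle R w ->
                h (x, w * z) = mul (twist_iota (rng x) w) (h (x, z))] &
          forall a, U (twist_proj a) -> circle R (k a) /\ h (twist_proj a, k a) = a] }.

Section FellBundle.
Variables (R : realType) (G : topGroupoid) (S : twist R G).
Local Open Scope quotient_scope.

Definition act (z : R[i]) (a : S) : S := mul (twist_iota S (rng (twist_proj a)) z) a.

Definition fell_rel (x y : S * R[i]^o) : bool :=
  `[< exists2 z : R[i], circle R z & y = (act z x.1, z^* * x.2) >].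

Lemma act1 (a : S) : act 1 a = a.
Proof.
rewrite /act -proj_rng unit_proj; first exact: mul_rng.
exact: src_rng.
Qed.

Lemma rng_units (X : topGroupoid) (a : X) : units X (rng a).
Proof. exact: src_rng. Qed.

Lemma circleM (z w : R[i]) : circle R z -> circle R w -> circle R (z * w).
Proof. by rewrite /circle /= => z1 w1; rewrite normrM z1 w1 mulr1. Qed.

Lemma src_iota (a : S) z : circle R z -> src (twist_iota S (rng (twist_proj a)) z) = rng a.
Proof.
move=> z1; rewrite iota_src//; last exact: rng_units.
by rewrite -proj_rng unit_proj//; exact: rng_units.
Qed.

Lemma rng_act (a : S) z : circle R z -> rng (act z a) = rng a.
Proof.
move=> z1; rewrite /act rng_mul ?src_iota// iota_rng//; last exact: rng_units.
by rewrite -proj_rng unit_proj//; exact: rng_units.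
Qed.

Lemma proj_act (a : S) z : circle R z -> twist_proj (act z a) = twist_proj a.
Proof.
move=> z1; rewrite /act proj_mul ?src_iota//.
suff -> : twist_proj (twist_iota S (rng (twist_proj a)) z) = rng (twist_proj a) by rewrite mul_rng.
set u := rng (twist_proj a); have uu : units G u by exact: rng_units.
have : (@twist_proj R G S @^-1` units G) (twist_iota S u z).
  by rewrite proj_kernel; exists (u, z).
rewrite /= /units /= => <-.
by rewrite -proj_src iota_src// proj_unit.
Qed.

Lemma actM (a : S) z w : circle R z -> circle R w ->
  act w (act z a) = act (w * z) a.
Proof.
move=> z1 w1; rewrite {1}/act proj_act// {1}/act mul_assoc.
- by rewrite iota_mul//; exact: rng_units.
- rewrite iota_src//; last exact: rng_units.
  by rewrite iota_rng//; exact: rng_units.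
- by rewrite src_iota.
Qed.

Lemma circle_conj (z : R[i]) : circle R z -> circle R z^* /\ z^* * z = 1.
Proof.
rewrite /circle /= => z1; split; first by rewrite norm_conjC.
by rewrite mulrC -normCK z1 expr1n.
Qed.

Fact fell_rel_equiv : equiv_class_of fell_rel.
Proof.
have sym x y : fell_rel x y -> fell_rel y x.
  move=> /asboolP[z z1 ->]; apply/asboolP.
  have [zz zz1] := circle_conj z1; exists z^* => //.
  by case: x => a c /=; rewrite actM// zz1 act1 conjCK mulrA (mulrC z) zz1 mul1r.
split=> [x|x y|y x z].
- apply/asboolP; exists 1; first by rewrite /circle /= normr1.
  by case: x => a c /=; rewrite act1 rmorph1 mul1r.
- by apply/idP/idP; exact: sym.
- move=> /asboolP[v v1 ->] /asboolP[w w1 ->]; apply/asboolP.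
  exists (w * v); first exact: circleM.
  by rewrite /= actM// rmorphM mulrA.
Qed.

Canonical fell_equiv := EquivRelPack fell_rel_equiv.
Canonical fell_encModRel := defaultEncModRel fell_rel.

Definition fell_bundle := quotient_topology {eq_quot fell_rel}.

Definition fell_class (a : S) (c : R[i]) : fell_bundle :=
  \pi_fell_bundle (a, c : R[i]^o).

Definition fell_base (l : fell_bundle) : G := twist_proj (repr l).1.

Definition fell_norm (l : fell_bundle) : R := complex.Re `|(repr l).2|.

Definition fell_mul (l m : fell_bundle) : fell_bundle :=
  fell_class (mul (repr l).1 (repr m).1) ((repr l).2 * (repr m).2).

Definition fell_star (l : fell_bundle) : fell_bundle :=
  fell_class (inv (repr l).1) ((repr l).2)^*.

Lemma twist_proj_surj (g : G) : exists a : S, twist_proj a = g.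
Proof.
have [U [h [k [[_ Ug] _ _ hU _]]]] := twist_locally_trivial S g.
have c1 : circle R 1 by rewrite /circle /= normr1.
by have [hg _ _] := hU g 1 Ug c1; exists (h (g, 1)).
Qed.

Definition twist_lift (g : G) : S := projT1 (cid (twist_proj_surj g)).

(* The linear structure of the fibre over [g] is transported from the complex
   numbers along the bijection [fell_class (twist_lift g)]; another choice of
   the lift changes this bijection by a scalar of modulus 1. *)
Definition fell_coord (g : G) (l : fell_bundle) : R[i] :=
  xget 0 [set c | l = fell_class (twist_lift g) c].

Definition fell_zero (g : G) : fell_bundle := fell_class (twist_lift g) 0.

Definition fell_add (g : G) (l m : fell_bundle) : fell_bundle :=
  fell_class (twist_lift g) (fell_coord g l + fell_coord g m).

Definition fell_scale (g : G) (c : R[i]) (l : fell_bundle) : fell_bundle :=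
  fell_class (twist_lift g) (c * fell_coord g l).

(* Sum in the fibre over [g] of a family of which finitely many terms are
   nonzero. *)
Definition fell_sum (g : G) (I : choiceType) (A : set I)
    (F : I -> fell_bundle) : fell_bundle :=
  fell_class (twist_lift g) (\sum_(i \in A) fell_coord g (F i)).

Definition is_section (f : G -> fell_bundle) : Prop :=
  forall g, fell_base (f g) = g.

Definition section_add (f1 f2 : G -> fell_bundle) : G -> fell_bundle :=
  fun g => fell_add g (f1 g) (f2 g).

Definition section_scale (c : R[i]) (f : G -> fell_bundle) :
    G -> fell_bundle :=
  fun g => fell_scale g c (f g).

Definition convolution (f1 f2 : G -> fell_bundle) : G -> fell_bundle :=
  fun g => fell_sum g
    [set ab : G * G | src ab.1 = rng ab.2 /\ mul ab.1 ab.2 = g]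
    (fun ab => fell_mul (f1 ab.1) (f2 ab.2)).

Definition section_star (f : G -> fell_bundle) : G -> fell_bundle :=
  fun g => fell_star (f (inv g)).

(* The support of a section on [U] is the closure, relative to [U], of the set
   where it does not vanish. *)
Definition elementary_section (f : G -> fell_bundle) : Prop :=
  is_section f /\
  exists U : set G, [/\ open U, hausdorff_subspace U,
    {within U, continuous f},
    compact (closure [set g | U g /\ f g <> fell_zero g] `&` U) &
    forall g, ~ U g -> f g = fell_zero g].

(* For a Hausdorff [G] this span is the space of all compactly supported
   continuous sections: extending an elementary section by zero then yields a
   continuous section, and [U] can be taken to be [setT]. *)
Inductive Cc : (G -> fell_bundle) -> Prop :=
| Cc_zero : Cc fell_zero
| Cc_elementary f : elementary_section f -> Cc f
| Cc_add f1 f2 : Cc f1 -> Cc f2 -> Cc (section_add f1 f2)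
| Cc_scale c f : Cc f -> Cc (section_scale c f).

Record Cc_star_morphism (A : star_algebra R)
    (phi : (G -> fell_bundle) -> A) : Prop := CcStarMorphism {
  Cc_morphism_add : forall f1 f2, Cc f1 -> Cc f2 ->
    phi (section_add f1 f2) = phi f1 + phi f2;
  Cc_morphism_scale : forall c f, Cc f -> phi (section_scale c f) = c *: phi f;
  Cc_morphism_mul : forall f1 f2, Cc f1 -> Cc f2 ->
    phi (convolution f1 f2) = star_mul (phi f1) (phi f2);
  Cc_morphism_star : forall f, Cc f ->
    phi (section_star f) = star_inv (phi f) }.

Definition source_fibre (u : G) : set G := [set g | src g = u].

(* The values of [xi] outside [source_fibre u] are irrelevant. *)
Definition l2_norm (u : G) (xi : G -> fell_bundle) : \bar R :=
  sqrte (\esum_(g in source_fibre u) ((fell_norm (xi g)) ^+ 2)%:E).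

Definition l2_section (u : G) (xi : G -> fell_bundle) : Prop :=
  (forall g, source_fibre u g -> fell_base (xi g) = g) /\
  (l2_norm u xi < +oo)%E.

Definition regular_rep (u : G) (f xi : G -> fell_bundle) : G -> fell_bundle :=
  fun g => fell_sum g (source_fibre u)
    (fun h => fell_mul (f (mul g (inv h))) (xi h)).

Definition regular_rep_norm (u : G) (f : G -> fell_bundle) : \bar R :=
  ereal_sup [set l2_norm u (regular_rep u f xi) |
    xi in [set xi | l2_section u xi /\ (l2_norm u xi <= 1)%E]].

Definition reduced_norm (f : G -> fell_bundle) : \bar R :=
  ereal_sup [set regular_rep_norm u f | u in units G].

Definition universal_norm (f : G -> fell_bundle) : \bar R :=
  ereal_sup [set x | exists (K : hilbert R)
    (rep : (G -> fell_bundle) -> bounded_op K),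
    @Cc_star_morphism (BH K) rep /\ x = (op_norm (rep f))%:E].

(* A completion is determined by this up to a unique isomorphism; values of [j]
   outside [Cc] are irrelevant. [completion_norm] includes the finiteness of
   [nrm] on [Cc]. *)
Record is_completion (nrm : (G -> fell_bundle) -> \bar R)
    (A : cstar_algebra R) (j : (G -> fell_bundle) -> A) : Prop :=
  IsCompletion {
  completion_morphism : @Cc_star_morphism A j;
  completion_norm : forall f, Cc f -> (complex.Re `|j f|)%:E = nrm f;
  completion_dense : closure (j @` Cc) = setT }.

Definition is_full_Cstar := is_completion universal_norm.
Definition is_reduced_Cstar := is_completion reduced_norm.

(* These clauses determine [lambda]: a *-homomorphism between C*-algebras is
   continuous, and [j @` Cc] is dense in [A]. *)
Definition is_lambda_red (A Ar : cstar_algebra R)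
    (j : (G -> fell_bundle) -> A) (jr : (G -> fell_bundle) -> Ar)
    (lambda : A -> Ar) : Prop :=
  @star_morphism R A Ar lambda /\ forall f, Cc f -> lambda (j f) = jr f.

End FellBundle.

(* Main.v *)
(* Let a representation of B(H) on an l2 space take its values in the norm limits
   of column-sparse operators, those with at most k nonzero entries in each column
   for some k. It vanishes, by a gliding hump. Suppose that the image of 1 does
   not kill xi. As H is infinite-dimensional, B(H) contains isometries w_i with
   pairwise orthogonal ranges spanning H. By Bessel's inequality each coordinate
   of the image of w_i xi tends to 0 with i, so that normalised sums v_n of
   suitable w_i have images of xi whose coordinates are as small as desired, while
   their norms stay away from 0. The isometry x with x w_n = v_n for all n cannot
   be approximated by k-sparse operators: these map the finitely supported
   approximation of the image of w_n xi to a vector of controlled support.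

   As G is etale, an element of C_c(G, L) is a finite sum of sections supported on
   open bisections, so that it acts on H_u by a matrix with a bounded number of
   nonzero entries in each row and column. Hence every regular representation of
   C^*(G, Sigma) or of C_r^*(G, Sigma) vanishes on the image of B(H). The regular
   representations separate the points of C_r^*(G, Sigma), and they are
   nondegenerate enough to exclude an identity in that image. *)
From HB Require Import structures.
Require Import Defs.
From mathcomp Require Import all_boot all_order all_algebra.
From mathcomp Require Import all_classical all_reals all_analysis.
From mathcomp Require Import complex finmap.
From mathcomp Require Import ring lra.

Set Implicit Arguments.
Unset Strict Implicit.
Unset Printing Implicit Defensive.

Import Order.TTheory GRing.Theory Num.Theory numFieldNormedType.Exports.

Local Open Scope classical_set_scope.
Local Open Scope ring_scope.

(** Composition with the quotient map turns a homomorphism on [B(H)/J] into one on [B(H)]; it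
    respects adjoints because closed ideals are self-adjoint. Automatic continuity is not invoked:
    the C*-identity bounds the images of isometries and of their adjoints by 1, and the gliding hump
    uses no other norm bound on the homomorphism. The obstacle is the order of choices: the sparsity
    [k] of an operator near the image of the isometry [x] is known only once [x], hence every [v_n],
    is fixed. So [v_n] is built against [n]-sparse operators, for all [n] at once, and the
    contradiction is read off at [n = k]. [H] may be nonseparable: its orthonormal basis is arranged
    in sequences, and the isometries act on the position within each sequence. The arrows of [G] may
    be uncountable, so sums over them are unordered. Where [G] fails to be Hausdorff, topological
    arguments take place inside Hausdorff open sets; bisections are such sets, the source being
    injective on them with values in a Hausdorff space. *)

Local Notation inv := Defs.inv.
Local Notation mul := Defs.mul.

(** * Operators on Hilbert spaces *)

Section RealNorm.
Variable R : realType.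
Implicit Types V : normedZmodType R[i].

(** Norms over [R[i]] are themselves elements of [R[i]]; their real part lies in [R], where suprema
    and linear arithmetic are available. *)
Definition rnorm (V : normedZmodType R[i]) (x : V) : R := complex.Re `|x|.

Lemma rnormE V (x : V) : (rnorm x)%:C%C = `|x|.
Proof. by rewrite RRe_real// normr_real. Qed.

Lemma rnorm_ge0 V (x : V) : 0 <= rnorm x.
Proof. by have := normr_ge0 x; rewrite lecE => /andP[]. Qed.

Lemma rnorm0 V : rnorm (0 : V) = 0.
Proof. by rewrite /rnorm normr0. Qed.

Lemma rnorm_eq0 V (x : V) : rnorm x = 0 -> x = 0.
Proof. by move=> x0; apply/eqP; rewrite -normr_eq0 -rnormE x0. Qed.

Lemma rnorm_le V (x : V) (e : R) : (`|x| <= e%:C%C) = (rnorm x <= e).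
Proof. by rewrite -rnormE lecR. Qed.

Lemma rnorm_lt V (x : V) (e : R) : (`|x| < e%:C%C) = (rnorm x < e).
Proof. by rewrite -rnormE ltcR. Qed.

Lemma rnormN V (x : V) : rnorm (- x) = rnorm x.
Proof. by rewrite /rnorm normrN. Qed.

Lemma rnormD V (x y : V) : rnorm (x + y) <= rnorm x + rnorm y.
Proof. by rewrite -lecR rmorphD/= !rnormE ler_normD. Qed.

Lemma rnormB V (x y : V) : rnorm (x - y) = rnorm (y - x).
Proof. by rewrite -rnormN opprB. Qed.

Lemma rnorm_dist V (y x z : V) : rnorm (x - z) <= rnorm (x - y) + rnorm (y - z).
Proof. by rewrite (le_trans _ (rnormD _ _))// addrA subrK. Qed.

Lemma rnorm_leD V (x y : V) : rnorm x <= rnorm (x - y) + rnorm y.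
Proof. by have := rnormD (x - y) y; rewrite subrK. Qed.

Lemma rnorm_small V (x : V) : (forall e : R, 0 < e -> rnorm x <= e) -> x = 0.
Proof.
move=> h; apply: rnorm_eq0; apply/eqP; rewrite eq_le rnorm_ge0 andbT.
by apply/ler_addgt0Pl => e e0; rewrite addr0 h.
Qed.

Lemma rnorm_sum V (I : Type) (r : seq I) (P : pred I) (F : I -> V) :
  rnorm (\sum_(i <- r | P i) F i) <= \sum_(i <- r | P i) rnorm (F i).
Proof.
elim/big_ind2 : _ => [|x a y b xa yb|//]; first by rewrite rnorm0.
by rewrite (le_trans (rnormD _ _))// lerD.
Qed.

Lemma rnormZ (V : normedModType R[i]) (a : R[i]) (x : V) :
  rnorm (a *: x) = rnorm a * rnorm x.
Proof. by apply: complexI; rewrite rmorphM/= !rnormE normrZ. Qed.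

Lemma rnormM (a b : R[i]) : rnorm (a * b) = rnorm a * rnorm b.
Proof. by apply: complexI; rewrite rmorphM/= !rnormE normrM. Qed.

Lemma rnorm1 : rnorm (1 : R[i]) = 1.
Proof. by rewrite /rnorm normr1. Qed.

Lemma rnormJ (a : R[i]) : rnorm a^* = rnorm a.
Proof. by rewrite /rnorm norm_conjC. Qed.

Lemma rnorm_real (a : R) : rnorm a%:C%C = `|a|.
Proof.
apply: complexI; rewrite rnormE.
have [a0|a0] := leP 0 a; first by rewrite !ger0_norm// lecR.
by rewrite !ler0_norm// ?lecR ?ltW// rmorphN.
Qed.

Lemma mulJ_rnorm (a : R[i]) : a * a^* = (rnorm a ^+ 2)%:C%C.
Proof. by rewrite -normCK -rnormE -rmorphXn. Qed.

Lemma Re_le_rnorm (a : R[i]) : complex.Re a <= rnorm a.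
Proof.
apply: le_trans (ler_norm _) _.
by rewrite -lecR rnormE; exact: normc_ge_Re.
Qed.

Lemma nbhs_rnorm (V : normedModType R[i]) (x : V) (A : set V) :
  nbhs x A <-> exists2 e : R, 0 < e & forall y, rnorm (x - y) < e -> A y.
Proof.
split=> [/nbhs_normP[e /= e0 eA]|[e e0 eA]].
  have ee : e = (complex.Re e)%:C%C by rewrite RRe_real// gtr0_real.
  exists (complex.Re e); first by rewrite -ltcR -ee.
  by move=> y xy; apply: eA => /=; rewrite ee rnorm_lt.
apply/nbhs_normP; exists e%:C%C; first by rewrite /= ltcR.
by move=> y /=; rewrite rnorm_lt; exact: eA.
Qed.

Lemma closure_rnorm (V : normedModType R[i]) (A : set V) (x : V) :
  closure A x <-> forall e : R, 0 < e -> exists2 y, A y & rnorm (x - y) < e.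
Proof.
split=> [clA e e0|h B /nbhs_rnorm[e e0 eB]].
  have /clA[y [Ay xy]] : nbhs x [set y | rnorm (x - y) < e].
    by apply/nbhs_rnorm; exists e.
  by exists y.
by have [y Ay /eB By] := h _ e0; exists y.
Qed.

(** Only a normed abelian group is asked for, so that the same notion serves for vectors and for
    scalar sequences such as inner products and coordinates. *)
Definition rcvg (V : normedZmodType R[i]) (u : nat -> V) (l : V) : Prop :=
  forall e : R, 0 < e -> exists N, forall n, (N <= n)%N -> rnorm (u n - l) <= e.

Definition rcauchy (V : normedZmodType R[i]) (u : nat -> V) : Prop :=
  forall e : R, 0 < e -> exists N, forall m n, (N <= m)%N -> (N <= n)%N ->
    rnorm (u m - u n) <= e.

Lemma rcauchy_cvg (V : completeNormedModType R[i]) (u : nat -> V) :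
  rcauchy u -> exists l, rcvg u l.
Proof.
move=> cu; have /cauchy_cvgP/cvg_ex[l ul] : cauchy (u @ \oo).
  (* A radius [e] is a complex number; its positivity forces a zero imaginary part. *)
  apply/cauchy_ballP => e; rewrite ltcE => /andP[/eqP /= ie e0].
  have [N uN] := cu (complex.Re e / 2) (divr_gt0 e0 (ltr0n _ 2)).
  exists ([set x | exists2 n, (N <= n)%N & x = u n],
          [set x | exists2 n, (N <= n)%N & x = u n]).
    by split; exists N => // n /= Nn; exists n.
  move=> [x y] /= [[m Nm ->] [n Nn ->]].
    rewrite -ball_normE /=.
    have -> : e = (complex.Re e)%:C%C by apply/eqP; rewrite eq_complex /= -ie !eqxx.
    rewrite rnorm_lt (le_lt_trans (uN _ _ Nm Nn))//.
    by rewrite ltr_pdivrMr// ltr_pMr// ltr1n.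
exists l => e e0; have /ul : nbhs l [set y | rnorm (l - y) < e].
  by apply/nbhs_rnorm; exists e.
move=> [N _ h]; exists N => n /h /=; rewrite rnormB => /ltW.
exact.
Qed.

Lemma rcvg_unique V (u : nat -> V) l m : rcvg u l -> rcvg u m -> l = m.
Proof.
move=> ul um; apply/eqP; rewrite -subr_eq0; apply/eqP; apply: rnorm_small => e e0.
have e20 : 0 < e / 2 by rewrite divr_gt0.
have [N1 h1] := ul _ e20; have [N2 h2] := um _ e20.
have := h1 (maxn N1 N2) (leq_maxl _ _); have := h2 (maxn N1 N2) (leq_maxr _ _).
move: (u _) => w wm wl; apply: le_trans (rnorm_dist w _ _) _.
by rewrite (rnormB l) (splitr e) lerD.
Qed.

Lemma rcvg_cauchy V (u : nat -> V) l : rcvg u l -> rcauchy u.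
Proof.
move=> ul e e0; have e20 : 0 < e / 2 by rewrite divr_gt0.
have [N h] := ul _ e20; exists N => m n /h um /h un.
apply: le_trans (rnorm_dist l _ _) _.
by rewrite (rnormB l) (splitr e) lerD.
Qed.

Lemma invS_small (e : R) : 0 < e -> exists N, forall n, (N <= n)%N -> n.+1%:R^-1 <= e.
Proof.
move=> e0; exists (Num.truncn e^-1).+1 => n Nn.
rewrite -[leRHS]invrK lef_pV2 ?posrE ?invr_gt0 ?ltr0n//.
apply: le_trans (ltW (truncnS_gt _)) _.
by rewrite ler_nat (leq_trans Nn).
Qed.

Lemma rcvg_invS V (u : nat -> V) l :
  (forall n, rnorm (u n - l) <= n.+1%:R^-1) -> rcvg u l.
Proof.
move=> h e e0; have [N hN] := invS_small e0; exists N => n /hN.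
exact: le_trans (h n).
Qed.

End RealNorm.

Section BoundedOperatorNorm.
Variables (R : realType) (V : normedModType R[i]).
Implicit Types T S : bounded_op V.

Lemma linear_is_bounded_op (f : V -> V) (C : R) : linear f ->
  (forall x, rnorm (f x) <= C * rnorm x) -> is_bounded_op f.
Proof.
move=> lf Cf; apply/asboolP; split => // x A /nbhs_rnorm[e e0 eA].
(* The constant [C] may be zero or negative, so its absolute value plus one serves as divisor. *)
have C1 : 0 < `|C| + 1 by rewrite ltr_pwDr.
apply/nbhs_rnorm; exists (e / (`|C| + 1)); first by rewrite divr_gt0.
move=> y; rewrite ltr_pdivlMr// mulrC => xy; apply: eA.
have -> : f x - f y = f (x - y).
  by rewrite -[x - y]addrC -[- y]scaleN1r lf scaleN1r addrC.
apply: le_lt_trans xy; apply: le_trans (Cf _) _.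
rewrite ler_wpM2r ?rnorm_ge0//; apply: le_trans (ler_norm _) _.
by rewrite lerDl.
Qed.

Definition mk_op (f : V -> V) (C : R) (lf : linear f)
    (Cf : forall x, rnorm (f x) <= C * rnorm x) : bounded_op V :=
  BoundedOp (linear_is_bounded_op lf Cf).

Lemma le_op_norm T x : rnorm (T x) <= rnorm T * rnorm x.
Proof.
have [->|x0] := eqVneq x 0; first by rewrite linear0 !rnorm0 mulr0.
have nx0 : 0 < rnorm x.
  rewrite lt_neqAle rnorm_ge0 andbT eq_sym; apply: contra x0 => /eqP.
  by move/rnorm_eq0 => ->.
have bT : has_ubound [set complex.Re `|T y| | y in [set y : V | `|y| <= 1]].
  have /bounded_funP/(_ 1)[M TM] : bounded_near T (nbhs (0 : V)).
    exact/linear_bounded_continuous/bounded_op_continuous.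
  exists (complex.Re M) => _ [y y1 <-]; have := TM _ y1.
  by rewrite lecE => /andP[].
have : rnorm (T ((rnorm x)^-1%:C%C *: x)) <= rnorm T.
  apply: ub_le_sup => //; exists ((rnorm x)^-1%:C%C *: x) => //=.
  rewrite -[leRHS](rmorph1 (real_complex R)) rnorm_le rnormZ rnorm_real.
  by rewrite ger0_norm ?invr_ge0 ?rnorm_ge0// mulVf// gt_eqF.
rewrite linearZ/= rnormZ rnorm_real ger0_norm ?invr_ge0 ?rnorm_ge0//.
by rewrite mulrC ler_pdivrMr.
Qed.

Lemma op_norm_le T M : 0 <= M -> (forall x, rnorm (T x) <= M * rnorm x) ->
  rnorm T <= M.
Proof.
move=> M0 TM; apply: ge_sup; first by exists (complex.Re `|T 0|), 0 => //=; rewrite normr0.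
move=> _ [x /= x1 <-]; apply: le_trans (TM x) _.
rewrite -[leRHS]mulr1 ler_wpM2l//.
by rewrite -rnorm_le rmorph1.
Qed.

Lemma bounded_opDE T S x : (T + S) x = T x + S x. Proof. by []. Qed.
Lemma bounded_opBE T S x : (T - S) x = T x - S x. Proof. by []. Qed.
Lemma bounded_opZE a T x : (a *: T) x = a *: T x. Proof. by []. Qed.
Lemma bounded_op0E x : (0 : bounded_op V) x = 0. Proof. by []. Qed.

End BoundedOperatorNorm.

(** * Projections, the Riesz representation and adjoints *)

Section Hilbert.
Variables (R : realType) (H : hilbert R).
Implicit Types x y z : H.

Lemma innerDl x y z : inner (x + y) z = inner x z + inner y z.
Proof. by have := inner_linear 1 x y z; rewrite scale1r mul1r. Qed.

Lemma inner0l z : inner 0 z = 0 :> R[i].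
Proof. by apply: (addrI (inner 0 z)); rewrite -innerDl !addr0. Qed.

Lemma innerZl a x z : inner (a *: x) z = a * inner x z.
Proof. by have := inner_linear a x 0 z; rewrite !addr0 inner0l addr0. Qed.

Lemma innerNl x z : inner (- x) z = - inner x z.
Proof. by rewrite -scaleN1r innerZl mulN1r. Qed.

Lemma innerBl x y z : inner (x - y) z = inner x z - inner y z.
Proof. by rewrite innerDl innerNl. Qed.

Lemma innerDr x y z : inner z (x + y) = inner z x + inner z y.
Proof. by rewrite inner_conj innerDl rmorphD/= -!inner_conj. Qed.

Lemma inner0r z : inner z 0 = 0 :> R[i].
Proof. by rewrite inner_conj inner0l rmorph0. Qed.

Lemma innerZr a x z : inner z (a *: x) = a^* * inner z x.
Proof. by rewrite inner_conj innerZl rmorphM/= -inner_conj. Qed.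

Lemma innerNr x z : inner z (- x) = - inner z x.
Proof. by rewrite inner_conj innerNl rmorphN/= -inner_conj. Qed.

Lemma innerBr x y z : inner z (x - y) = inner z x - inner z y.
Proof. by rewrite innerDr innerNr. Qed.

Lemma inner_suml (I : Type) (r : seq I) (F : I -> H) z :
  inner (\sum_(i <- r) F i) z = \sum_(i <- r) inner (F i) z.
Proof.
elim: r => [|i r ih]; first by rewrite !big_nil inner0l.
by rewrite !big_cons innerDl ih.
Qed.

Lemma inner_rnorm x : inner x x = (rnorm x ^+ 2)%:C%C.
Proof. by rewrite inner_norm -rnormE rmorphXn. Qed.

Lemma rnorm_sqr x : rnorm x ^+ 2 = complex.Re (inner x x).
Proof. by rewrite inner_rnorm. Qed.

Lemma Re_innerC x y : complex.Re (inner y x) = complex.Re (inner x y).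
Proof. by rewrite inner_conj; case: (inner x y). Qed.

Lemma rnorm_sqrD x y :
  rnorm (x + y) ^+ 2 = rnorm x ^+ 2 + rnorm y ^+ 2 + 2 * complex.Re (inner x y).
Proof.
by rewrite !rnorm_sqr innerDl !innerDr !raddfD/= (Re_innerC x y); ring.
Qed.

Lemma parallelogram x y :
  rnorm (x + y) ^+ 2 + rnorm (x - y) ^+ 2 = 2 * (rnorm x ^+ 2 + rnorm y ^+ 2).
Proof. by rewrite !rnorm_sqrD rnormN innerNr raddfN/=; ring. Qed.

Lemma inner_eq0 x : (forall y, inner x y = 0) -> x = 0.
Proof.
move=> /(_ x); rewrite inner_rnorm => -[] /eqP.
by rewrite sqrf_eq0 => /eqP/rnorm_eq0.
Qed.

Lemma inner_ext x y : (forall z, inner x z = inner y z) -> x = y.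
Proof.
by move=> h; apply/subr0_eq/inner_eq0 => z; rewrite innerBl h subrr.
Qed.

(** Pythagoras for the component of [x] orthogonal to [y], with the denominator cleared. It yields
    the Cauchy-Schwarz inequality and the orthogonality of a nearest-point residue. *)
Lemma rnorm_sqrB_proj x y : y != 0 ->
  rnorm (x - (inner x y / inner y y) *: y) ^+ 2 * rnorm y ^+ 2 =
  rnorm x ^+ 2 * rnorm y ^+ 2 - rnorm (inner x y) ^+ 2.
Proof.
move=> y0; have yy : inner y y != 0.
  rewrite inner_norm expf_eq0/= normr_eq0//.
apply: complexI; rewrite rmorphB (rmorphM _ (rnorm (_ - _) ^+ 2)).
rewrite (rmorphM _ (rnorm x ^+ 2)) /= -mulJ_rnorm -!inner_rnorm.
rewrite !innerBl !innerBr !innerZl !innerZr.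
have yyJ : (inner y y)^* = inner y y by rewrite -inner_conj.
rewrite (inner_conj x y) rmorphM/= fmorphV/= yyJ.
set a := inner x y; set b := a^*; set c := inner y y in yy *.
by field.
Qed.

Lemma cauchy_schwarz x y : rnorm (inner x y) <= rnorm x * rnorm y.
Proof.
have [->|y0] := eqVneq y 0; first by rewrite inner0r !rnorm0 mulr0.
rewrite -(@ler_pXn2r _ 2)// ?nnegrE ?mulr_ge0 ?rnorm_ge0// exprMn -subr_ge0.
by rewrite -rnorm_sqrB_proj// mulr_ge0// sqr_ge0.
Qed.

Lemma rcvg_innerl (u : nat -> H) x z : rcvg u x ->
  rcvg (fun n => inner (u n) z) (inner x z).
Proof.
move=> ux e e0; have z1 : 0 < rnorm z + 1 by rewrite ltr_wpDl ?rnorm_ge0.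
have [N h] := ux _ (divr_gt0 e0 z1); exists N => n /h {}h.
rewrite -innerBl; apply: le_trans (cauchy_schwarz _ _) _.
apply: le_trans (ler_wpM2r (rnorm_ge0 _) h) _.
by rewrite mulrAC ler_pdivrMr// ler_wpM2l ?(ltW e0)// lerDl.
Qed.

(** By the parallelogram law a minimising sequence for the distance from [x] to [D] is Cauchy. The
    subspace [D] may fail to be closed, so the limit [d] may lie outside it and the sequence is
    returned as well. *)
Lemma orthogonal_projection (D : set H) x : D 0 ->
  (forall a y z, D y -> D z -> D (a *: y + z)) ->
  exists (u : nat -> H) (d : H), [/\ forall n, D (u n), rcvg u d &
    forall y, D y -> inner (x - d) y = 0].
Proof.
move=> D0 DL.
pose A := [set rnorm (x - y) | y in D].
have A0 : has_inf A.
  split; first by exists (rnorm (x - 0)), 0.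
  by exists 0 => _ [y _ <-]; exact: rnorm_ge0.
pose r := inf A.
have r0 : 0 <= r.
  by apply: le_inf_nonempty || (apply: lb_le_inf; [by case: A0|move=> _ [y _ <-]; exact: rnorm_ge0]).
have rD y : D y -> r <= rnorm (x - y).
  by move=> Dy; apply: ge_inf; [case: A0|exists y].
have uex n : exists y, D y /\ rnorm (x - y) < r + n.+1%:R^-1.
  have [_ [y Dy <-] h] := @inf_adherent _ A n.+1%:R^-1 (ltac:(by rewrite invr_gt0)) A0.
  by exists y.
have [u uD] := choice uex.
have uC : rcauchy u.
  (* Two points of [D] at distance at most [r + t] from [x] are at squared distance at most
     [4 ((r + t)^2 - r^2)], which is at most [4 (2 r + 1) t] for [t <= 1]. *)
  move=> e e0; have c0 : 0 < 4 * (2 * r + 1) by lra.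
  have [N hN] := invS_small (divr_gt0 (exprn_gt0 2 e0) c0).
  exists N => p q Np Nq.
  rewrite -(@ler_pXn2r _ 2)// ?nnegrE ?rnorm_ge0// ?(ltW e0)//.
  set t : R := N.+1%:R^-1.
  have t0 : 0 < t by rewrite invr_gt0.
  have t1 : t <= 1 by rewrite invf_le1// ler1n.
  have tS n : (N <= n)%N -> rnorm (x - u n) <= r + t.
    move=> Nn; apply: le_trans (ltW (uD n).2) _; rewrite lerD2l.
    by rewrite lef_pV2 ?posrE// ler_nat ltnS.
  have := tS p Np; have := tS q Nq.
  have := hN N (leqnn _); rewrite -/t ler_pdivlMr// => ht.
  have := parallelogram (x - u p) (x - u q).
  have -> : x - u p - (x - u q) = u q - u p by rewrite opprB addrCA addrAC subrr sub0r addrC.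
  have -> : x - u p + (x - u q) = 2 *: (x - 2^-1 *: (u p + u q)).
    rewrite scalerBr scalerA divff ?pnatr_eq0// scale1r scaler_nat mulr2n.
    by rewrite addrACA opprD.
  have h2 : r <= rnorm (x - 2^-1 *: (u p + u q)).
    apply: rD; rewrite scalerDr -[X in D (_ + X)]addr0.
    by apply: (DL _ _ _ (uD p).1); apply: (DL _ _ _ (uD q).1).
  rewrite rnormZ (_ : rnorm (2 : R[i]) = 2); last first.
    by rewrite -(rmorph_nat (real_complex R) 2) rnorm_real ger0_norm.
  rewrite (rnormB (u p)); move: h2 (rnorm_ge0 (x - u p)) (rnorm_ge0 (x - u q)).
  move: (rnorm (x - u p)) (rnorm (x - u q)) (rnorm (x - _)) (rnorm (u q - u p)).
  move=> a b c d rc a0 b0 E bt at_.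
  have c2 : r ^+ 2 <= c ^+ 2 by rewrite ler_pXn2r// nnegrE (le_trans r0).
  have a2 : a ^+ 2 <= (r + t) ^+ 2 by rewrite ler_pXn2r// nnegrE; lra.
  have b2 : b ^+ 2 <= (r + t) ^+ 2 by rewrite ler_pXn2r// nnegrE; lra.
  have tt : t ^+ 2 <= t by rewrite expr2 ger_pMr.
  have -> : d ^+ 2 = 2 * (a ^+ 2 + b ^+ 2) - 4 * c ^+ 2 by rewrite -E; ring.
  apply: le_trans ht; have := r0; nra.
have [d ud] := rcauchy_cvg uC.
exists u, d; split => // [n|y Dy]; first exact: (uD n).1.
have rd z : D z -> r <= rnorm (x - d - z).
  move=> Dz; apply/ler_addgt0Pl => e e0; have [N h] := ud _ e0.
  have := rD (u N + z); rewrite -[u N]scale1r => /(_ (DL _ _ _ (uD N).1 Dz)).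
  rewrite scale1r => /le_trans; apply.
  have -> : x - (u N + z) = - (u N - d) + (x - d - z).
    by rewrite opprB [RHS]addrC [x - d - z]addrAC addrA subrK opprD addrA addrAC.
  by apply: le_trans (rnormD _ _) _; rewrite rnormN lerD2r h.
have dr : rnorm (x - d) <= r.
  apply/ler_addgt0Pl => e e0; have e20 : 0 < e / 2 by rewrite divr_gt0.
  have [N1 h1] := ud _ e20; have [N2 h2] := invS_small e20.
  pose n := maxn N1 N2.
  have := h1 n (leq_maxl _ _); have := h2 n (leq_maxr _ _); have [_] := uD n.
  have := rnorm_dist (u n) x d; move: (n.+1%:R^-1) (rnorm _) (rnorm _) (rnorm _).
  by move=> a b c f; lra.
have [->|y0] := eqVneq y 0; first by rewrite inner0r.
apply: rnorm_eq0; apply/eqP; rewrite -sqrf_eq0 eq_le sqr_ge0 andbT.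
set w := x - d in rd dr *.
have := rnorm_sqrB_proj w y0.
have ny0 : 0 < rnorm y ^+ 2.
  by rewrite exprn_gt0// lt_neqAle rnorm_ge0 andbT eq_sym; apply: contra y0 => /eqP/rnorm_eq0 ->.
(* Without its component along [y] the residue still has norm at least [r >= |w|]; the Pythagorean
   identity then forces [inner w y = 0]. *)
have : r <= rnorm (w - (inner w y / inner y y) *: y).
  by apply: rd; rewrite -[_ *: _]addr0; exact: DL.
move=> /(le_trans dr); rewrite -(@ler_pXn2r _ 2)// ?nnegrE ?rnorm_ge0//.
rewrite -(ler_pM2r ny0) => + E; rewrite E.
by rewrite lerBrDl gerDr.
Qed.

Lemma riesz (f : H -> R[i]) (C : R) :
  (forall a x y, f (a *: x + y) = a * f x + f y) ->
  (forall x, rnorm (f x) <= C * rnorm x) ->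
  exists z, forall y, f y = inner y z.
Proof.
move=> lf Cf.
have f0 : f 0 = 0.
  by have := lf (- 1) 0 0; rewrite scaler0 addr0 mulN1r addNr.
have fB x y : f (x - y) = f x - f y.
  by rewrite addrC -scaleN1r lf mulN1r addrC.
have [[x fx]|/forallNP f00] := pselect (exists x, f x <> 0); last first.
  by exists 0 => y; rewrite inner0r; apply: contrapT (f00 y).
have [||u [d [uD ud dD]]] := @orthogonal_projection [set y | f y = 0] x.
- by [].
- by move=> a y z /= fy fz; rewrite lf fy fz mulr0 addr0.
have fd : f d = 0.
  apply: rnorm_small => e e0.
  have C1 : 0 < `|C| + 1 by rewrite ltr_pwDr.
  have [N /(_ N (leqnn _)) h] := ud _ (divr_gt0 e0 C1).
  have <- : f (d - u N) = f d by rewrite fB (uD N) subr0.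
  apply: le_trans (Cf _) _.
  apply: (@le_trans _ _ ((`|C| + 1) * rnorm (d - u N))).
    by rewrite ler_wpM2r ?rnorm_ge0// (le_trans (ler_norm _))// lerDl.
  by move: h; rewrite rnormB ler_pdivlMr// mulrC.
set w := x - d in dD *.
have fw : f w != 0 by rewrite fB fd subr0; apply/eqP.
have w0 : inner w w != 0.
  by rewrite inner_norm expf_eq0/= normr_eq0; apply: contraNneq fw => ->; rewrite f0.
have wwJ : (inner w w)^* = inner w w by rewrite -inner_conj.
exists ((f w / inner w w)^* *: w) => y.
(* The vector [y - (f y / f w) w] lies in the kernel of [f], hence is orthogonal to [w]. *)
have := dD (y - (f y / f w) *: w) _; rewrite /= fB.
have -> : f ((f y / f w) *: w) = f y by rewrite -[_ *: w]addr0 lf f0 addr0 divfK.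
rewrite subrr => /(_ erefl)/eqP; rewrite innerBr subr_eq0 => /eqP E.
rewrite innerZr conjCK (inner_conj w y) E innerZr rmorphM/= conjCK wwJ.
by field; apply/andP.
Qed.

Lemma adjoint_exists (T : bounded_op H) : exists S, is_adjoint T S.
Proof.
have zex x : exists z, forall y, inner (T y) x = inner y z.
  apply: (@riesz _ (rnorm T * rnorm x)) => [a y z|y].
    by rewrite linearP inner_linear.
  apply: le_trans (cauchy_schwarz _ _) _.
  by rewrite mulrAC ler_wpM2r ?rnorm_ge0// le_op_norm.
have [S SP] := choice zex.
have SE x y : inner (S x) y = inner x (T y).
  by rewrite inner_conj -SP -inner_conj.
have lS : linear S.
  by move=> a x y; apply: inner_ext => z; rewrite inner_linear !SE inner_linear.
have CS x : rnorm (S x) <= rnorm T * rnorm x.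
  have [->|S0] := eqVneq (S x) 0; first by rewrite rnorm0 mulr_ge0 ?rnorm_ge0.
  have nS0 : 0 < rnorm (S x).
    rewrite lt_neqAle rnorm_ge0 andbT eq_sym.
    by apply: contra S0 => /eqP/rnorm_eq0 ->.
  rewrite -(ler_pM2r nS0) -expr2 rnorm_sqr SE.
  apply: le_trans (Re_le_rnorm _) _; apply: le_trans (cauchy_schwarz _ _) _.
  rewrite mulrC mulrAC ler_wpM2r ?rnorm_ge0// le_op_norm//.
by exists (mk_op lS CS).
Qed.

Lemma adjointP (T : bounded_op H) x y :
  inner (adjoint T x) y = inner x (T y).
Proof. by have [S TS] := adjoint_exists T; apply: (xgetI 0 TS). Qed.

Lemma adjointPr (T : bounded_op H) x y :
  inner x (adjoint T y) = inner (T x) y.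
Proof. by rewrite inner_conj adjointP -inner_conj. Qed.

Lemma adjoint_unique (T S : bounded_op H) :
  (forall x y, inner (S x) y = inner x (T y)) -> adjoint T = S.
Proof.
by move=> h; apply: bounded_op_inj => x; apply: inner_ext => y; rewrite adjointP h.
Qed.

Lemma adjoint_linear a (T S : bounded_op H) :
  adjoint (a *: T + S) = a^* *: adjoint T + adjoint S.
Proof.
apply: adjoint_unique => x y.
by rewrite bounded_opDE bounded_opZE inner_linear !adjointP innerDr innerZr.
Qed.

End Hilbert.

(** * Self-adjointness of closed ideals, and isometries with prescribed values *)

Section HilbertOperators.
Variables (R : realType) (H : hilbert R).
Implicit Types (x y z : H) (T S V W : bounded_op H).

(* The numbers [|T^* D^k x|^2] decrease with [k], and each is at most
   [|D^k x|^2 - |D^(k+1) x|^2], which telescopes. *)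
Lemma adjoint_damping T D (n : nat) x : rnorm T <= 1 ->
  D = id_op H - comp_op T (adjoint T) ->
  rnorm (adjoint T (iter n D x)) ^+ 2 *+ n <= rnorm x ^+ 2.
Proof.
move=> T1 defD.
have Tle y : rnorm (T y) <= rnorm y.
  by apply: le_trans (le_op_norm _ _) _; rewrite ler_piMl ?rnorm_ge0.
have DE y : D y = y - T (adjoint T y) by rewrite defD.
have TT y : complex.Re (inner (T (adjoint T y)) y) = rnorm (adjoint T y) ^+ 2.
  by rewrite -adjointPr inner_rnorm.
have TT' y : complex.Re (inner (adjoint T (T y)) y) = rnorm (T y) ^+ 2.
  by rewrite adjointP inner_rnorm.
have drop y : rnorm (adjoint T y) ^+ 2 <= rnorm y ^+ 2 - rnorm (D y) ^+ 2.
  rewrite DE -[y - _]addrC rnorm_sqrD innerNl rnormN raddfN/= TT.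
  have : rnorm (T (adjoint T y)) ^+ 2 <= rnorm (adjoint T y) ^+ 2.
    by rewrite ler_pXn2r ?nnegrE ?rnorm_ge0// Tle.
  by lra.
have decr y : rnorm (adjoint T (D y)) ^+ 2 <= rnorm (adjoint T y) ^+ 2.
  rewrite DE linearB/= -[_ - _]addrC rnorm_sqrD innerNl rnormN raddfN/= TT'.
  set z := adjoint T y.
  have : rnorm (adjoint T (T z)) ^+ 2 <= rnorm (T z) ^+ 2.
    rewrite -(TT (T z)); apply: le_trans (Re_le_rnorm _) _.
    apply: le_trans (cauchy_schwarz _ _) _.
    apply: le_trans (ler_wpM2r (rnorm_ge0 _) (Tle _)) _.
    have := drop (T z); have := sqr_ge0 (rnorm (D (T z))).
    have := rnorm_ge0 (adjoint T (T z)); have := rnorm_ge0 (T z).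
    move: (rnorm (adjoint T (T z))) (rnorm (T z)) => a b b0 a0 d0 h.
    have ab : a <= b by rewrite -(@ler_pXn2r _ 2)//; lra.
    by nra.
  by have := sqr_ge0 (rnorm (T z)); lra.
suff : rnorm (adjoint T (iter n D x)) ^+ 2 *+ n <=
       rnorm x ^+ 2 - rnorm (iter n D x) ^+ 2.
  by move/le_trans; apply; rewrite gerBl sqr_ge0.
elim: n => [|n ih]; first by rewrite mulr0n subrr.
rewrite iterS mulrSr; apply: le_trans (lerD (ler_wMn2r n (decr _)) (decr _)) _.
by have := lerD ih (drop (iter n D x)); lra.
Qed.

(* For [|T| <= 1] the operators [T^* - T^* (1 - T T^* )^n] lie in [J] and tend
   to [T^*]. *)
Lemma closed_ideal_adjoint (J : lin_subspace (bounded_op H)) T :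
  two_sided_ideal J -> closed [set T | J T] -> J T -> J (adjoint T).
Proof.
move=> idJ clJ JT.
pose c := rnorm T + 1; have c0 : 0 < c by rewrite ltr_wpDl ?rnorm_ge0.
have [J0 JL] := lin_subspaceP J.
have JZ a S : J S -> J (a *: S) by move=> JS; rewrite -[_ *: _]addr0; exact: JL.
have JD S S' : J S -> J S' -> J (S + S').
  by move=> JS JS'; rewrite -[S]scale1r; exact: JL.
pose T1 : bounded_op H := (c^-1)%:C%C *: T.
have TT1 : adjoint T = c%:C%C *: adjoint T1.
  apply: adjoint_unique => x y; rewrite bounded_opZE innerZl adjointP innerZr.
  rewrite mulrA (_ : ((c^-1)%:C%C)^* = (c^-1)%:C%C); last exact: conjc_real.
  rewrite -rmorphM/=.
  by rewrite divff ?gt_eqF// mul1r.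
have JT1 : J T1 by exact: JZ.
rewrite TT1; apply: JZ.
have T1le : rnorm T1 <= 1.
  rewrite rnormZ rnorm_real ger0_norm ?invr_ge0 ?(ltW c0)// mulrC ler_pdivrMr// mul1r.
  by rewrite lerDl.
pose D : bounded_op H := id_op H - comp_op T1 (adjoint T1).
pose P n := iter n (fun S => comp_op S D) (adjoint T1).
have PE n x : P n x = adjoint T1 (iter n D x).
  by elim: n x => // n ih x; rewrite [LHS]ih -iterSr.
have JP n : J (adjoint T1 - P n).
  elim: n => [|n ih]; first by rewrite subrr.
  have -> : adjoint T1 - P n.+1 =
      adjoint T1 - P n + comp_op (P n) (comp_op T1 (adjoint T1)).
    apply: bounded_op_inj => x; set y := T1 (adjoint T1 x).
    rewrite -[LHS]/(adjoint T1 x - P n (x - y)).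
    rewrite -[RHS]/(adjoint T1 x - P n x + P n y).
    by rewrite linearB opprB addrA addrAC.
  apply: JD => //; apply: (idJ _ _ _).1; exact: (idJ _ _ _).2.
suff : closure [set S | J S] (adjoint T1) by move/clJ.
apply/closure_rnorm => e e0; have [N hN] := invS_small (exprn_gt0 2 (divr_gt0 e0 (ltr0n _ 2))).
exists (adjoint T1 - P N.+1); first exact: JP.
rewrite opprB addrC subrK; apply: (@le_lt_trans _ _ (e / 2)); last first.
  by rewrite ltr_pdivrMr// ltr_pMr// ltr1n.
apply: op_norm_le => [|x]; first by rewrite divr_ge0// ltW.
rewrite -(@ler_pXn2r _ 2)// ?nnegrE ?rnorm_ge0 ?mulr_ge0 ?invr_ge0 ?rnorm_ge0 ?(ltW e0)//.
have := @adjoint_damping T1 D N.+1 x T1le erefl; rewrite -PE exprMn -mulr_natr.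
have n0 : 0 < N.+1%:R :> R by [].
rewrite -ler_pdivlMr// => /le_trans; apply.
by rewrite mulrC ler_wpM2r ?sqr_ge0// hN.
Qed.

Definition isometry V := forall x y, inner (V x) (V y) = inner x y.

Lemma isometry_adjoint V : isometry V -> comp_op (adjoint V) V = id_op H.
Proof.
by move=> VV; apply: bounded_op_inj => x; apply: inner_ext => y; rewrite adjointP VV.
Qed.

(** The linear span of a set of pairs in [H * H]: the graph of the sought extension, before it is
    known to be single-valued. *)
Inductive graph_span (g : H -> H -> Prop) : H -> H -> Prop :=
| graph_span0 : graph_span g 0 0
| graph_spanD c a b x y : g a b -> graph_span g x y ->
    graph_span g (c *: a + x) (c *: b + y).

Lemma graph_span_linear g c x y x' y' : graph_span g x y ->
  graph_span g x' y' -> graph_span g (c *: x + x') (c *: y + y').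
Proof.
move=> gxy gxy'; elim: gxy => [|d a b z t gab _ ih]; first by rewrite !scaler0 !add0r.
by rewrite !scalerDr !scalerA -!addrA; exact: graph_spanD.
Qed.

(** Inner products agree on the spans of both sides, so the span of the pairs is the graph of an
    isometry. It extends by limits to the closure of its domain, which is all of [H] because no
    nonzero vector is orthogonal to every first component. *)
Lemma isometry_extension (g : H -> H -> Prop) :
  (forall a b a' b', g a b -> g a' b' -> inner b b' = inner a a') ->
  (forall x, (forall a b, g a b -> inner x a = 0) -> x = 0) ->
  exists2 V, isometry V & forall a b, g a b -> V a = b.
Proof.
move=> gg gtot.
have gs1 a b x y : g a b -> graph_span g x y -> inner b y = inner a x.
  move=> gab; elim=> [|c a' b' x' y' gab' _ ih]; first by rewrite !inner0r.
  by rewrite !innerDr !innerZr ih (gg a b a' b').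
have gs x y x' y' : graph_span g x y -> graph_span g x' y' -> inner y y' = inner x x'.
  move=> gxy gxy'; elim: gxy => [|c a b z t gab _ ih]; first by rewrite !inner0l.
  by rewrite !innerDl !innerZl ih (gs1 a b x' y').
have ghom x y x' y' : graph_span g x y -> graph_span g x' y' ->
    rnorm (y - y') = rnorm (x - x').
  move=> gx gx'; apply/eqP; rewrite -(@eqrXn2 _ 2)// ?rnorm_ge0//.
  rewrite !rnorm_sqr !innerBl !innerBr.
  by rewrite (gs _ _ _ _ gx gx') (gs _ _ _ _ gx gx) (gs _ _ _ _ gx' gx) (gs _ _ _ _ gx' gx').
have Vex x : exists y, exists u v : nat -> H, [/\ forall n, graph_span g (u n) (v n),
    rcvg u x & rcvg v y].
  have [||u [d [uD ud dD]]] :=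
      @orthogonal_projection _ _ [set x | exists y, graph_span g x y] x.
  - by exists 0; exact: graph_span0.
  - by move=> a y z [y' gy] [z' gz]; exists (a *: y' + z'); exact: graph_span_linear.
  (* The residue [x - d] is orthogonal to every first component, so it vanishes. *)
  have xd : x = d.
    apply/subr0_eq/gtot => a b gab; apply: dD; exists (1 *: b + 0).
    by rewrite -[a]scale1r -[_ *: a]addr0; apply: graph_spanD => //; exact: graph_span0.
  have [v uv] := choice uD.
  have [y vy] : exists l, rcvg v l.
    apply: rcauchy_cvg => e /(rcvg_cauchy ud)[N h]; exists N => m n Nm Nn.
    by rewrite (ghom _ _ _ _ (uv m) (uv n)) h.
  by exists y, u, v; rewrite xd.
have [f fP] := choice Vex.
have ff x y : inner (f x) (f y) = inner x y.
  have [u [v [uv ux vf]]] := fP x; have [u' [v' [uv' uy' vf']]] := fP y.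
  have E n : inner (v n) (f y) = inner (u n) y.
    rewrite inner_conj [RHS]inner_conj; congr (_ ^*).
    apply: (rcvg_unique (rcvg_innerl (v n) vf')).
    rewrite (_ : (fun m => _) = (fun m => inner (u' m) (u n))).
      exact: rcvg_innerl.
    by apply/funext => m; apply: gs.
  apply: (rcvg_unique (rcvg_innerl (f y) vf)).
  by rewrite (_ : (fun m => _) = (fun m => inner (u m) y)); [exact: rcvg_innerl|exact/funext].
(* Values of [f] are limits along unrelated sequences, so linearity is deduced from the preservation
   of inner products: the squared norm of the defect expands to 0. *)
have lf : linear f.
  move=> a x y; apply/subr0_eq/rnorm_eq0/eqP; rewrite -sqrf_eq0 rnorm_sqr; apply/eqP.
  rewrite (_ : inner _ _ = 0)//.
  rewrite !(innerBl, innerBr, innerDl, innerDr, innerZl, innerZr) !ff.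
  by rewrite !(innerBl, innerBr, innerDl, innerDr, innerZl, innerZr); ring.
have Cf x : rnorm (f x) <= 1 * rnorm x.
  by rewrite mul1r -(@ler_pXn2r _ 2)// ?nnegrE ?rnorm_ge0// !rnorm_sqr ff.
exists (mk_op lf Cf) => // a b gab.
apply/subr0_eq/rnorm_eq0/eqP; rewrite -sqrf_eq0 rnorm_sqr; apply/eqP.
(* The sequence defining [f a] need not involve the pair [(a, b)]; again the squared norm of
   [f a - b] expands to 0. *)
have fb x : inner (f x) b = inner x a.
  have [u [v [uv ux vf]]] := fP x.
  apply: (rcvg_unique (rcvg_innerl b vf)).
  rewrite (_ : (fun m => _) = (fun m => inner (u m) a)); first exact: rcvg_innerl.
  by apply/funext => m; rewrite inner_conj (gs1 a b _ _ gab (uv m)) -inner_conj.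
rewrite (_ : inner _ _ = 0)// innerBl !innerBr /= ff fb (inner_conj (f a) b) fb.
by rewrite -inner_conj (gg _ _ _ _ gab gab) !subrr.
Qed.

End HilbertOperators.

(** * Orthonormal sequences and isometries with orthogonal ranges *)

Section CuntzFamily.
Variables (R : realType) (H : hilbert R).
Implicit Types (x y z : H) (V W : bounded_op H).

Definition orthonormal_seq (s : nat -> H) : Prop :=
  forall n m, inner (s n) (s m) = (n == m)%:R :> R[i].

(** Basis vectors are indexed by an element of [A] and a position; the isometries will act on the
    position alone. *)
Definition orthonormal_family (T : Type) (A : set T) (e : T -> nat -> H) : Prop :=
  forall s t n m, A s -> A t ->
    inner (e s n) (e t m) = (`[< s = t >] && (n == m))%:R :> R[i].

Lemma normalize x : x != 0 -> exists2 c : R[i], c != 0 & inner (c *: x) (c *: x) = 1.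
Proof.
move=> x0; have nx : rnorm x != 0 by apply: contra x0 => /eqP/rnorm_eq0 ->.
exists (rnorm x)^-1%:C%C; first by rewrite (inj_eq (@complexI R) _ 0) invr_eq0.
rewrite inner_rnorm rnormZ rnorm_real ger0_norm ?invr_ge0 ?rnorm_ge0//.
by rewrite mulVf// expr1n.
Qed.

(* Extending a finite orthonormal list inside D one vector at a time either
   never stops or exhibits a finite orthonormal basis of D. *)
Lemma orthonormal_seq_or_finite_basis (D : set H) :
  (forall a x, D x -> D (a *: x)) ->
  (exists2 s, orthonormal_seq s & forall n, D (s n)) \/
  exists (l : seq H), [/\ forall i, (i < size l)%N -> D (nth 0 l i),
    forall i j, (i < size l)%N -> (j < size l)%N ->
      inner (nth 0 l i) (nth 0 l j) = (i == j)%:R :> R[i] &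
    forall x, D x -> (forall i, (i < size l)%N -> inner x (nth 0 l i) = 0) ->
      x = 0].
Proof.
move=> DZ; pose P (l : seq H) := (forall i, (i < size l)%N -> D (nth 0 l i)) /\
  forall i j, (i < size l)%N -> (j < size l)%N ->
      inner (nth 0 l i) (nth 0 l j) = (i == j)%:R :> R[i].
have [h|h] := pselect (exists l, P l /\ forall x, D x ->
    (forall i, (i < size l)%N -> inner x (nth 0 l i) = 0) -> x = 0).
  by right; have [l [[? ?] ?]] := h; exists l.
left; have nx l : exists x, P l -> [/\ D x, inner x x = 1 &
    forall i, (i < size l)%N -> inner x (nth 0 l i) = 0].
  have [Pl|] := pselect (P l); last by exists 0.
  have : ~ forall x, D x ->
    (forall i, (i < size l)%N -> inner x (nth 0 l i) = 0) -> x = 0.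
    by move=> q; apply: h; exists l.
  move=> /existsNP[x /not_implyP[Dx /not_implyP[xl /eqP x0]]].
  have [c c0 cx] := normalize x0; exists (c *: x) => _; split => //; first exact: DZ.
  by move=> i il; rewrite innerZl xl// mulr0.
have [g gP] := choice nx.
pose L n := iter n (fun l => rcons l (g l)) [::].
have sL n : size (L n) = n by elim: n => //= n ih; rewrite size_rcons ih.
have PL n : P (L n).
  elim: n => [//|n ih]; have [Dg g1 gl] := gP _ ih; case: (ih) => i1 i2.
  rewrite /= -/(L n); split=> [i|i j]; rewrite size_rcons sL !nth_rcons sL.
    rewrite ltnS leq_eqVlt => /orP[/eqP ->|il]; first by rewrite ltnn eqxx.
    by rewrite il; apply: i1; rewrite sL.
  rewrite !ltnS (leq_eqVlt i) (leq_eqVlt j) => /orP[/eqP ->|il] /orP[/eqP ->|jl].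
  - by rewrite ltnn eqxx g1.
  - by rewrite ltnn eqxx jl gl ?sL// gtn_eqF.
  - by rewrite ltnn eqxx il inner_conj gl ?sL// rmorph0 ltn_eqF.
  - by rewrite il jl i2// sL.
have nL n k : (k < n)%N -> nth 0 (L n) k = g (L k).
  elim: n => // n ih; rewrite /= -/(L n) nth_rcons sL ltnS leq_eqVlt.
  by move=> /orP[/eqP ->|kn]; [rewrite ltnn eqxx|rewrite kn ih].
exists (fun n => g (L n)); last by move=> n; have [] := gP _ (PL n).
have lt n k : (k < n)%N -> inner (g (L n)) (g (L k)) = 0.
  by move=> kn; have [_ _] := gP _ (PL n); move/(_ k); rewrite sL nL//; exact.
move=> n m; case: ltngtP => [nm|mn|->]; first by rewrite inner_conj lt// rmorph0.
  by rewrite lt.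
by have [] := gP _ (PL m).
Qed.

(* Zorn's lemma yields a maximal family of orthonormal sequences; what it misses
   is finite-dimensional and is prepended to one of the sequences. *)
Lemma orthonormal_basis_seq : infinite_dimensional H ->
  exists (A : set (nat -> H)) (e : (nat -> H) -> nat -> H),
    orthonormal_family A e /\
    forall x, (forall s n, A s -> inner x (e s n) = 0) -> x = 0.
Proof.
move=> Hinf.
have [A [onA maxA]] := @Zorn_bigcup _ [set A | orthonormal_family A id]
  (ltac:(
    move=> F FP Ftot s t n m [X FX Xs] [Y FY Yt];
    have [XY|YX] := Ftot _ _ FX FY;
      [exact: (FP _ FY _ _ _ _ (XY _ Xs) Yt)|exact: (FP _ FX _ _ _ _ Xs (YX _ Yt))])).
pose D := [set x | forall s n, A s -> inner x (s n) = 0].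
have [|[s ons Ds]|[l [Dl onl ltot]]] := @orthonormal_seq_or_finite_basis D.
- by move=> a x Dx s n As; rewrite innerZl Dx ?mulr0.
(* An orthonormal sequence orthogonal to all of [A] would enlarge [A] properly, as none of its
   vectors is orthogonal to itself. *)
- exfalso; apply: (maxA (A `|` [set s])).
    split; first by move=> ?; left.
    move=> /(_ s (or_intror erefl)) As; have := Ds 0%N _ 0%N As.
    by rewrite ons eqxx => /eqP; rewrite oner_eq0.
  move=> t u n m [At|->] [Au|->]; first exact: onA.
  + rewrite inner_conj Ds// rmorph0; case: asboolP => // ts.
    by have := Ds 0%N t 0%N At; rewrite {1}ts ons eqxx => /eqP; rewrite oner_eq0.
  + rewrite Ds//; case: asboolP => // su.
    by have := Ds 0%N u 0%N Au; rewrite -{1}su ons eqxx => /eqP; rewrite oner_eq0.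
  + by rewrite ons; case: asboolP.
(* If [A] were empty, the finite list [l] would be total and every vector the sum of its components
   along [l], against infinite dimension. *)
have [s0 As0] : exists s, A s.
  apply: contrapT => nA; have [x] := Hinf (size l) (fun i => nth 0 l i).
  move=> /(_ (fun i => inner x (nth 0 l i))); apply; apply/subr0_eq/ltot.
    by move=> s n As; case: nA; exists s.
  move=> i il; rewrite innerBl inner_suml (bigD1 (Ordinal il))//= big1 => [|j ji].
    by rewrite innerZl onl// eqxx mulr1 addr0 subrr.
  rewrite innerZl onl//; case: eqVneq => [E|_]; last by rewrite mulr0.
  by move: ji; rewrite -val_eqE/= E eqxx.
pose e s n := if `[< s = s0 >] then
  (if (n < size l)%N then nth 0 l n else s0 (n - size l)%N) else s n.
exists A, e; split=> [s t n m As At|x xe]; last first.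
  apply: ltot => [s n As|i il].
    (* Positions in [s0] are shifted by the length of the prepended list. *)
    have := xe s (if `[< s = s0 >] then (n + size l)%N else n) As; rewrite /e.
    by case: asboolP => [->|//]; rewrite ltnNge leq_addl/= addnK.
  by have := xe s0 i As0; rewrite /e; case: asboolP => //; rewrite il.
have ls t' k i : A t' -> (i < size l)%N -> inner (t' k) (nth 0 l i) = 0.
  by move=> At' il; rewrite inner_conj (Dl i il t' k At') rmorph0.
rewrite /e; case: (asboolP (s = s0)) => [->|ss0]; case: (asboolP (t = s0)) => [->|ts0].
- rewrite (_ : `[< s0 = s0 >] = true)/=; last exact/asboolP.
  case: ifPn => [nl|]; case: ifPn => [ml|].
  + exact: onl.
  + rewrite -leqNgt => ml; rewrite Dl// (_ : n == m = false)//.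
    by apply/negbTE; rewrite neq_ltn (leq_trans nl).
  + rewrite -leqNgt => nl; rewrite ls// (_ : n == m = false)//.
    by apply/negbTE; rewrite neq_ltn (leq_trans ml) ?orbT.
  + rewrite -!leqNgt => ml nl; rewrite onA// (_ : `[< s0 = s0 >] = true)/=; last exact/asboolP.
    by rewrite -(eqn_add2r (size l)) !subnK.
- rewrite (_ : `[< s0 = t >] = false); last by apply/asboolP => E; exact: ts0.
  case: ifPn => [nl|_]; first by rewrite Dl.
  by rewrite onA//; case: asboolP => // E; case: ts0.
- rewrite (_ : `[< s = s0 >] = false); last by apply/asboolP.
  case: ifPn => [nl|_]; first by rewrite ls.
  by rewrite onA//; case: asboolP => // E; case: ss0.
- exact: onA.
Qed.

(** Totality is used twice, once for each argument, after moving each operator across the inner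
    product by its adjoint. *)
Lemma orthonormal_orthogonal_ranges (T : Type) (A : set T) (e : T -> nat -> H)
    (V W : bounded_op H) :
  (forall x, (forall s n, A s -> inner x (e s n) = 0) -> x = 0) ->
  (forall s t n m, A s -> A t -> inner (V (e s n)) (W (e t m)) = 0) ->
  forall x y, inner (V x) (W y) = 0.
Proof.
move=> etot VW x y; rewrite -adjointP.
rewrite [X in inner X _](_ : _ = 0) ?inner0l//.
apply: (etot) => t m At; rewrite adjointP inner_conj -adjointP.
rewrite [X in inner X _](_ : _ = 0) ?inner0l ?rmorph0//.
by apply: etot => s n As; rewrite adjointP inner_conj VW// rmorph0.
Qed.

(** A bijection [c] from pairs of integers to integers cuts every basis sequence into infinitely
    many infinite subsequences, and [w n] carries each sequence onto its [n]-th part. *)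
Lemma cuntz_family : infinite_dimensional H ->
  exists w : nat -> bounded_op H, [/\ forall n, isometry (w n),
    forall n m x y, n != m -> inner (w n x) (w m y) = 0 &
    forall z, (forall n x, inner z (w n x) = 0) -> z = 0].
Proof.
move=> /orthonormal_basis_seq[A [e [one etot]]].
have [c [_ cinj csurj]] : exists c, set_bij [set: nat * nat] [set: nat] c.
  by apply/card_set_bijP; exact: card_nat2.
have wex n : exists V, isometry V /\ forall s m, A s -> V (e s m) = e s (c (n, m)).
  have [||V iV VP] := @isometry_extension _ _
    (fun a b => exists s m, [/\ A s, a = e s m & b = e s (c (n, m))]).
  - move=> _ _ _ _ [s [k [As -> ->]]] [t [m [At -> ->]]]; rewrite !one//.
    congr ((_ && _)%:R); apply/eqP/eqP => [|->//].
    by move/(cinj _ _ (mem_set I) (mem_set I)) => [].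
  - by move=> x h; apply: etot => s k As; apply: (h _ (e s (c (n, k)))); exists s, k.
  - by exists V; split => // s m As; apply: VP; exists s, m.
have [w wP] := choice wex; exists w; split=> [n|n m x y nm|z zw].
- by have [] := wP n.
- apply: (orthonormal_orthogonal_ranges etot) => s t k l As At.
  rewrite (wP n).2// (wP m).2// one//; case: eqP => [|_]; last by rewrite andbF.
  by move/(cinj _ _ (mem_set I) (mem_set I)) => [nm']; rewrite nm' eqxx in nm.
- apply: etot => s k As; have [[n m] _ <-] := csurj k I.
  by rewrite -(wP n).2.
Qed.

End CuntzFamily.

(** * Square-summable families *)

Section SequentialCompleteness.
Variable R : realType.

Lemma real_cauchy_cvg (u : nat -> R) :
  (forall e, 0 < e -> exists N, forall m n, (N <= m)%N -> (N <= n)%N ->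
    `|u m - u n| <= e) ->
  exists l, forall e, 0 < e -> exists N, forall n, (N <= n)%N -> `|u n - l| <= e.
Proof.
move=> cu; have /cauchy_cvgP/cvg_ex[l ul] : cauchy (u @ \oo).
  apply/cauchy_ballP => e e0.
  have [N uN] := cu (e / 2) (divr_gt0 e0 (ltr0n _ 2)).
  exists ([set x | exists2 n, (N <= n)%N & x = u n],
          [set x | exists2 n, (N <= n)%N & x = u n]).
    by split; exists N => // n /= Nn; exists n.
  move=> [x y] /= [[m Nm ->] [n Nn ->]]; rewrite -ball_normE /=.
  rewrite (le_lt_trans (uN _ _ Nm Nn))//.
  by rewrite ltr_pdivrMr// ltr_pMr// ltr1n.
exists l => e e0; have /ul : nbhs l (ball l e) by exact: nbhsx_ballx.
move=> [N _ h]; exists N => n /h /=; rewrite -ball_normE/= distrC => /ltW.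
exact.
Qed.

Lemma rnorm_le_ReIm (a : R[i]) : rnorm a <= `|complex.Re a| + `|complex.Im a|.
Proof.
rewrite -rnorm_le {1}[a]complexE.
apply: le_trans (ler_normD _ _) _; rewrite normrM rmorphD/=.
rewrite -(rnormE (complex.Re a)%:C%C) -(rnormE (complex.Im a)%:C%C) !rnorm_real lerD2l.
by rewrite (_ : `|'i%C| = 1) ?mul1r// normc_def /= expr0n/= add0r expr1n sqrtr1.
Qed.

Lemma ReIm_le_rnorm (a : R[i]) :
  `|complex.Re a| <= rnorm a /\ `|complex.Im a| <= rnorm a.
Proof.
have h (b : R[i]) : `|complex.Re b| <= rnorm b.
  by rewrite -lecR rnormE; exact: normc_ge_Re.
split=> //; have := h (a * 'i%C); rewrite ReiNIm normrN rnormM.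
by rewrite (_ : rnorm 'i%C = 1) ?mulr1// /rnorm normc_def /= expr0n/= add0r expr1n sqrtr1.
Qed.

Lemma complex_rcauchy_cvg (u : nat -> R[i]) : rcauchy u -> exists l, rcvg u l.
Proof.
move=> uC.
have [|a ua] := @real_cauchy_cvg (fun n => complex.Re (u n)).
  move=> e /uC[N h]; exists N => m n Nm Nn; rewrite -raddfB.
  exact: le_trans (ReIm_le_rnorm _).1 (h _ _ Nm Nn).
have [|b ub] := @real_cauchy_cvg (fun n => complex.Im (u n)).
  move=> e /uC[N h]; exists N => m n Nm Nn; rewrite -raddfB.
  exact: le_trans (ReIm_le_rnorm _).2 (h _ _ Nm Nn).
exists (Complex a b) => e e0; have e20 : 0 < e / 2 by rewrite divr_gt0.
have [N1 h1] := ua _ e20; have [N2 h2] := ub _ e20.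
exists (maxn N1 N2) => n; rewrite geq_max => /andP[/h1 {}h1 /h2 {}h2].
apply: le_trans (rnorm_le_ReIm _) _; rewrite (splitr e) lerD// raddfB//.
Qed.

(** Members [A n] of the filter are chosen with diameter controlled by [1/(n+1)]; points of the
    nested intersections form a Cauchy sequence, whose limit is also that of the filter. *)
Lemma rcauchy_complete (V : normedModType R[i]) :
  (forall u : nat -> V, rcauchy u -> exists l, rcvg u l) ->
  forall F : set_system V, ProperFilter F -> cauchy F -> cvg F.
Proof.
move=> VC F FF /cauchy_ballP cF.
have cF' n : exists A, F A /\ forall x y, A x -> A y -> rnorm (x - y) < n.+1%:R^-1.
  have e0 : (0 : R[i]) < n.+1%:R^-1%:C%C by rewrite ltcR invr_gt0.
  have [[B C] /= [FB FC] BC] := cF _ e0.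
  exists (B `&` C); split; first exact: filterI.
  move=> x y [Bx _] [_ Cy]; have := BC (x, y) (conj Bx Cy).
  by rewrite -ball_normE /= rnorm_lt.
have [A AP] := choice cF'.
pose B n := \bigcap_(k < n.+1) A k.
have FB n : F (B n).
  elim: n => [|n ih].
    by apply: filterS (AP 0%N).1 => x Ax k /=; rewrite ltnS leqn0 => /eqP ->.
  apply: filterS (filterI ih (AP n.+1).1) => x [Bx Ax] k /=.
  by rewrite ltnS leq_eqVlt => /orP[/eqP ->//|kn]; exact: Bx.
have [u uP] := choice (fun n => filter_ex (FB n)).
have AuN N n : (N <= n)%N -> A N (u n) by move=> Nn; apply: (uP n); rewrite /= ltnS.
have [|l ul] := VC u.
  move=> e /invS_small[N hN]; exists N => m n Nm Nn.
  apply: le_trans (hN N (leqnn _)); apply: ltW; apply: (AP N).2; exact: AuN.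
apply/cvg_ex; exists l => C /nbhs_rnorm[e e0 eC].
have e20 : 0 < e / 2 by rewrite divr_gt0.
have [N1 h1] := ul _ e20; have [N2 h2] := invS_small e20.
apply: filterS (AP (maxn N1 N2)).1 => x Ax; apply: eC.
set n := maxn N1 N2 in Ax; apply: le_lt_trans (rnorm_dist (u n) _ _) _.
rewrite (splitr e); apply: ler_ltD; first by rewrite rnormB h1// leq_maxl.
apply: lt_le_trans (h2 n (leq_maxr _ _)).
by apply: (AP n).2 => //; exact: AuN.
Qed.

End SequentialCompleteness.

(** * The complete normed space of square-summable families *)

Section SquareSummable.
Variables (R : realType) (I : choiceType).
Implicit Types (F : {fset I}).

Definition ssq (x : I -> R[i]) F : R := \sum_(i <- F) rnorm (x i) ^+ 2.

Lemma ssq_ge0 x F : 0 <= ssq x F.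
Proof. by apply: sumr_ge0 => i _; exact: sqr_ge0. Qed.

Lemma ssq_sub x F F' : (F `<=` F')%fset -> ssq x F <= ssq x F'.
Proof.
move=> FF'; rewrite /ssq [leRHS](bigID (mem F))/=.
rewrite (_ : \sum_(i <- F' | i \in F) _ = \sum_(i <- F) rnorm (x i) ^+ 2).
  by rewrite lerDl sumr_ge0// => i _; exact: sqr_ge0.
rewrite -big_filter; apply: perm_big; apply: uniq_perm => [||i].
- exact: filter_uniq.
- exact: fset_uniq.
- by rewrite mem_filter; case: (boolP (i \in F)) => //= /(fsubsetP FF').
Qed.

(** The free weight [t] replaces the cross term of the square. The value 1 suffices for boundedness,
    while [t = |y| / |x|] turns the summed bound into [(|x| + |y|)^2], the triangle inequality. *)
Lemma sqr_rnormD_le (t : R) (a b : R[i]) : 0 < t ->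
  rnorm (a + b) ^+ 2 <= (1 + t) * rnorm a ^+ 2 + (1 + t^-1) * rnorm b ^+ 2.
Proof.
move=> t0; apply: (@le_trans _ _ ((rnorm a + rnorm b) ^+ 2)).
  by rewrite ler_pXn2r ?nnegrE ?addr_ge0 ?rnorm_ge0// rnormD.
rewrite -subr_ge0; have tt : t * t^-1 = 1 by rewrite divff// gt_eqF.
have t'0 : 0 < t^-1 by rewrite invr_gt0.
move: (rnorm a) (rnorm b) (t^-1) tt t'0 => x y s ts s0.
have -> : (1 + t) * x ^+ 2 + (1 + s) * y ^+ 2 - (x + y) ^+ 2 =
  s * (t * x - y) ^+ 2 + t * (1 - t * s) * x ^+ 2 + 2 * (t * s - 1) * (x * y) by ring.
by rewrite ts !subrr !(mulr0, mul0r, addr0) mulr_ge0 ?sqr_ge0// ltW.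
Qed.

Lemma ssqD_le (t : R) x y F : 0 < t ->
  ssq (x + y) F <= (1 + t) * ssq x F + (1 + t^-1) * ssq y F.
Proof.
move=> t0; rewrite /ssq !mulr_sumr -big_split/=; apply: ler_sum => i _.
exact: sqr_rnormD_le.
Qed.

Lemma ssqZ a x F : ssq (a *: x) F = rnorm a ^+ 2 * ssq x F.
Proof. by rewrite /ssq mulr_sumr; apply: eq_bigr => i _; rewrite rnormM exprMn. Qed.

Definition is_l2 (x : I -> R[i]) : bool := `[< exists M, forall F, ssq x F <= M >].

Fact is_l2_submod : submod_closed is_l2.
Proof.
split=> [|a x y]; rewrite ?unfold_in.
  by apply/asboolP; exists 0 => F; rewrite /ssq big1// => i _; rewrite rnorm0 expr0n.
move=> /asboolP[M xM] /asboolP[N yN]; apply/asboolP.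
exists ((1 + 1) * (rnorm a ^+ 2 * M) + (1 + 1^-1) * N) => F.
apply: le_trans (ssqD_le _ _ _ ltr01) _; rewrite ssqZ lerD//; last first.
  by rewrite ler_wpM2l// addr_ge0 ?invr_ge0.
by rewrite !ler_wpM2l ?sqr_ge0.
Qed.

HB.instance Definition _ := GRing.isSubmodClosed.Build R[i] (I -> R[i])
  is_l2 (GRing.submod_closed_semi is_l2_submod).

Record l2 := L2 { l2_fun :> I -> R[i]; l2P : is_l2 l2_fun }.

HB.instance Definition _ := [isSub for l2_fun].
HB.instance Definition _ := [Choice of l2 by <:].
HB.instance Definition _ := [SubChoice_isSubLmodule of l2 by <:].

Implicit Types x y : l2.

Lemma l2DE x y i : (x + y) i = x i + y i. Proof. by []. Qed.
Lemma l2ZE a x i : (a *: x) i = a * x i. Proof. by []. Qed.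
Lemma l2_inj x y : x =1 y -> x = y.
Proof. by move=> xy; apply: val_inj; apply/funext. Qed.

Definition l2norm x : R := Num.sqrt (sup [set ssq x F | F in [set: {fset I}]]).

Let has_sup_ssq x : has_sup [set ssq x F | F in [set: {fset I}]].
Proof.
split; first by exists (ssq x fset0), fset0.
by have /asboolP[M xM] := l2P x; exists M => _ [F _ <-].
Qed.

Lemma ssq_le_l2norm x F : ssq x F <= l2norm x ^+ 2.
Proof.
have h : ssq x F <= sup [set ssq x F | F in [set: {fset I}]].
  by apply: ub_le_sup; [exact: (has_sup_ssq x).2|exists F].
by rewrite sqr_sqrtr// (le_trans (ssq_ge0 x F)).
Qed.

Lemma l2norm_le x M : 0 <= M -> (forall F, ssq x F <= M ^+ 2) -> l2norm x <= M.
Proof.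
move=> M0 xM; rewrite -[M]ger0_norm// -sqrtr_sqr ler_wsqrtr//.
by apply: ge_sup; [exact: (has_sup_ssq x).1|move=> _ [F _ <-]].
Qed.

Lemma l2norm_ge0 x : 0 <= l2norm x. Proof. exact: sqrtr_ge0. Qed.

Lemma l2norm_adherent x e : 0 < e -> exists F, l2norm x ^+ 2 - e < ssq x F.
Proof.
move=> e0; have [_ [F _ <-] h] := sup_adherent e0 (has_sup_ssq x); exists F.
rewrite sqr_sqrtr//; apply: le_trans (ssq_ge0 x fset0) _.
by apply: ub_le_sup; [exact: (has_sup_ssq x).2|exists fset0].
Qed.

Lemma l2_coord_le_l2norm x i : rnorm (x i) <= l2norm x.
Proof.
rewrite -(@ler_pXn2r _ 2)// ?nnegrE ?rnorm_ge0 ?l2norm_ge0//.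
have := ssq_le_l2norm x [fset i]%fset.
by rewrite /ssq big_seq_fset1.
Qed.

Lemma l2norm_eq0 x : l2norm x = 0 -> x = 0.
Proof.
move=> x0; apply: l2_inj => i; apply: rnorm_eq0; apply/eqP.
by rewrite eq_le rnorm_ge0 -x0 l2_coord_le_l2norm.
Qed.

Lemma l2normD x y : l2norm (x + y) <= l2norm x + l2norm y.
Proof.
have [x0|x0] := eqVneq (l2norm x) 0.
  by rewrite x0 (l2norm_eq0 x0) !add0r.
have [y0|y0] := eqVneq (l2norm y) 0.
  by rewrite y0 (l2norm_eq0 y0) !addr0.
apply: l2norm_le => [|F]; first by rewrite addr_ge0 ?l2norm_ge0.
have xp : 0 < l2norm x by rewrite lt_neqAle eq_sym x0 l2norm_ge0.
have yp : 0 < l2norm y by rewrite lt_neqAle eq_sym y0 l2norm_ge0.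
apply: le_trans (ssqD_le x y F (divr_gt0 yp xp)) _.
rewrite (_ : _ ^+ 2 = (1 + l2norm y / l2norm x) * l2norm x ^+ 2 +
  (1 + (l2norm y / l2norm x)^-1) * l2norm y ^+ 2); last by field; apply/andP.
by rewrite lerD// ler_wpM2l ?ssq_le_l2norm// addr_ge0 ?invr_ge0 ?divr_ge0 ?ltW.
Qed.

Let l2normZ_le a x : l2norm (a *: x) <= rnorm a * l2norm x.
Proof.
apply: l2norm_le => [|F]; first by rewrite mulr_ge0 ?rnorm_ge0 ?l2norm_ge0.
by rewrite ssqZ exprMn ler_wpM2l ?sqr_ge0 ?ssq_le_l2norm.
Qed.

Lemma l2normZ a x : l2norm (a *: x) = rnorm a * l2norm x.
Proof.
apply/eqP; rewrite eq_le l2normZ_le/=.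
have [->|a0] := eqVneq a 0; first by rewrite rnorm0 mul0r l2norm_ge0.
have aV : rnorm a * rnorm a^-1 = 1 by rewrite -rnormM divff// rnorm1.
have := l2normZ_le a^-1 (a *: x); rewrite scalerA mulVf// scale1r.
by move/(ler_wpM2l (rnorm_ge0 a)); rewrite mulrA aV mul1r.
Qed.

Fact l2_triangle x y :
  (l2norm (x + y))%:C%C <= (l2norm x)%:C%C + (l2norm y)%:C%C.
Proof. by rewrite -rmorphD lecR l2normD. Qed.

Fact l2_homog (a : R[i]) x : (l2norm (a *: x))%:C%C = `|a| * (l2norm x)%:C%C.
Proof. by rewrite l2normZ rmorphM/= rnormE. Qed.

Fact l2_definite x : (l2norm x)%:C%C = 0 -> x = 0.
Proof. by move=> [/l2norm_eq0]. Qed.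

HB.instance Definition _ := Lmodule_isNormed.Build R[i] l2
  l2_triangle l2_homog l2_definite.

Lemma l2_rnormE x : rnorm x = l2norm x. Proof. by []. Qed.

(** The limit is taken coordinatewise. On a finite set [F] one compares [u m] with a later [u n]
    that is close to the limit at every point of [F]; the resulting bound does not depend on [F],
    whence convergence in norm. *)
Lemma l2_rcauchy_cvg (u : nat -> l2) : rcauchy u -> exists l, rcvg u l.
Proof.
move=> uC.
have xex i : exists l, rcvg (fun n => u n i) l.
  apply: complex_rcauchy_cvg => e /uC[N h].
  exists N => m n Nm Nn; apply: le_trans (h _ _ Nm Nn).
  exact: l2_coord_le_l2norm (u m - u n) i.
have [x xP] := choice xex.
have xF (F : seq I) d : 0 < d -> exists N, forall n, (N <= n)%N ->
    forall i, i \in F -> rnorm (u n i - x i) <= d.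
  move=> d0; elim: F => [|i F [N h]]; first by exists 0%N.
  have [N' h'] := xP i _ d0; exists (maxn N N') => n.
  rewrite geq_max => /andP[Nn N'n] k; rewrite inE => /orP[/eqP ->|]; first exact: h'.
  exact: h.
have key e : 0 < e -> exists N, forall n, (N <= n)%N -> forall F,
    ssq ((u n : I -> R[i]) - x) F <= (2 * e) ^+ 2.
  move=> e0; have [N h] := uC _ e0; exists N => m Nm F.
  (* With this precision at each coordinate the squares sum over [F] to at most [e^2]. *)
  have d0 : 0 < e / #|` F|.+1%:R by rewrite divr_gt0.
  have [N' h'] := xF F _ d0; pose n := maxn N N'.
  rewrite (_ : _ - x = ((u m - u n : l2) : I -> R[i]) + ((u n : I -> R[i]) - x)); last first.
    by apply/funext => i; rewrite !fctE /= addrA subrK.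
  apply: le_trans (ssqD_le _ _ _ ltr01) _.
  rewrite (_ : (2 * e) ^+ 2 = (1 + 1) * e ^+ 2 + (1 + 1^-1) * e ^+ 2); last first.
    by rewrite invr1; ring.
  rewrite lerD// ler_wpM2l ?addr_ge0 ?invr_ge0//.
    apply: le_trans (ssq_le_l2norm _ _) _.
    by rewrite ler_pXn2r ?nnegrE ?l2norm_ge0 ?(ltW e0)// h// leq_maxl.
  apply: (@le_trans _ _ (\sum_(i <- F) (e ^+ 2 / #|` F|.+1%:R))).
    rewrite /ssq big_seq [leRHS]big_seq; apply: ler_sum => i iF.
    apply: (@le_trans _ _ ((e / #|` F|.+1%:R) ^+ 2)).
      by rewrite ler_pXn2r ?nnegrE ?rnorm_ge0 ?(ltW d0)// h'// leq_maxr.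
    rewrite exprMn ler_wpM2l ?sqr_ge0// expr2 ger_pMr ?invr_gt0//.
    by rewrite invf_le1// ler1n.
  rewrite big_const_seq count_predT iter_addr_0 -mulrnAl -[_ *+ _]mulr_natr.
  rewrite -mulrA ger_pMr ?exprn_gt0// ler_pdivrMr// mul1r ler_nat.
  by rewrite ltnW.
have x2 : is_l2 x.
  (* The limit is the difference of two square-summable families, [u N] and [u N - x]. *)
  have [N /(_ N (leqnn _)) h] := key 1 ltr01.
  have : is_l2 ((u N : I -> R[i]) - ((u N : I -> R[i]) - x)).
    by apply: rpredB; [exact: l2P|apply/asboolP; exists ((2 * 1) ^+ 2)].
  by rewrite opprB addrC subrK.
exists (L2 x2) => e e0; have e20 : 0 < e / 2 by rewrite divr_gt0.
have [N h] := key _ e20; exists N => n /h {}h.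
apply: l2norm_le => [|F]; first exact: ltW.
by have := h F; rewrite mulrCA divff ?mulr1// pnatr_eq0.
Qed.

Fact l2_complete : forall F : set_system l2, ProperFilter F -> cauchy F -> cvg F.
Proof. exact: rcauchy_complete l2_rcauchy_cvg. Qed.

HB.instance Definition _ := Uniform_isComplete.Build l2 l2_complete.

End SquareSummable.

(** * The inner product of square-summable families, and finite truncations *)

Section L2Hilbert.
Variables (R : realType) (I : choiceType).
Local Notation l2 := (@l2 R I).
Implicit Types (F : {fset I}) (x y z : l2).

(** Unordered summation: the index set will be the set of arrows of a groupoid, possibly
    uncountable. *)
Definition fset_cvg (phi : {fset I} -> R[i]) (c : R[i]) : Prop :=
  forall e : R, 0 < e -> exists F0, forall F, (F0 `<=` F)%fset ->
    rnorm (phi F - c) <= e.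

Lemma fset_cvg_unique phi c d : fset_cvg phi c -> fset_cvg phi d -> c = d.
Proof.
move=> hc hd; apply/subr0_eq/rnorm_small => e e0.
have e20 : 0 < e / 2 by rewrite divr_gt0.
have [F1 h1] := hc _ e20; have [F2 h2] := hd _ e20.
have := h1 _ (fsubsetUl F1 F2); have := h2 _ (fsubsetUr F1 F2).
move: (phi _) => w wd wc; apply: le_trans (rnorm_dist w _ _) _.
by rewrite (rnormB c) (splitr e) lerD.
Qed.

Lemma fset_cvg_linear a phi psi c d : fset_cvg phi c -> fset_cvg psi d ->
  fset_cvg (fun F => a * phi F + psi F) (a * c + d).
Proof.
move=> hc hd e e0; have e20 : 0 < e / 2 by rewrite divr_gt0.
have a1 : 0 < rnorm a + 1 by rewrite ltr_wpDl ?rnorm_ge0.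
have [F1 h1] := hc _ (divr_gt0 e20 a1); have [F2 h2] := hd _ e20.
exists (F1 `|` F2)%fset => F; rewrite fsubUset => /andP[/h1 {}h1 /h2 {}h2].
have -> : a * phi F + psi F - (a * c + d) = a * (phi F - c) + (psi F - d) by ring.
apply: le_trans (rnormD _ _) _; rewrite rnormM (splitr e) lerD//.
move: h1; rewrite ler_pdivlMr//; apply: le_trans.
by rewrite mulrC ler_wpM2l ?rnorm_ge0// lerDl.
Qed.

Lemma fset_cvg_conj phi c : fset_cvg phi c -> fset_cvg (fun F => (phi F)^*) c^*.
Proof.
by move=> hc e /hc[F0 h]; exists F0 => F /h; rewrite -rmorphB/= rnormJ.
Qed.

Lemma fset_cvg_ssq x : fset_cvg (fun F => (ssq x F)%:C%C) (l2norm x ^+ 2)%:C%C.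
Proof.
move=> e e0; have [F0 h] := l2norm_adherent x e0; exists F0 => F F0F.
rewrite -rmorphB/= rnorm_real distrC ger0_norm ?subr_ge0 ?ssq_le_l2norm//.
by have := ssq_sub x F0F; lra.
Qed.

(** Polarisation of the norm defines the inner product without choosing a limit. The series formula
    is recovered in [l2_inner_cvg], and the algebraic laws then pass to the limit from finite
    sums. *)
Definition l2_inner x y : R[i] := 4^-1 *
  ((l2norm (x + y) ^+ 2)%:C%C - (l2norm (x - y) ^+ 2)%:C%C +
   ('i%C * (l2norm (x + 'i%C *: y) ^+ 2)%:C%C -
    'i%C * (l2norm (x - 'i%C *: y) ^+ 2)%:C%C)).

Lemma mulJ_polarization (a b : R[i]) : a * b^* = 4^-1 *
  ((rnorm (a + b) ^+ 2)%:C%C - (rnorm (a - b) ^+ 2)%:C%C +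
   ('i%C * (rnorm (a + 'i%C * b) ^+ 2)%:C%C -
    'i%C * (rnorm (a - 'i%C * b) ^+ 2)%:C%C)).
Proof.
rewrite -!mulJ_rnorm !(rmorphB, rmorphD, rmorphM)/=.
have iJ : ('i%C : R[i])^* = - 'i%C by apply/eqP; rewrite eq_complex /= !oppr0 !eqxx.
have ii : ('i%C : R[i]) * 'i%C = - 1 by rewrite -expr2 sqr_i.
rewrite iJ; move: ('i%C : R[i]) ii (a^*) (b^*) => i ii u v.
have -> : (a + b) * (u + v) - (a - b) * (u - v) +
  (i * ((a + i * b) * (u + - i * v)) - i * ((a - i * b) * (u - - i * v))) =
  2 * (a * v) * (1 - i * i) + 2 * (b * u) * (1 + i * i) by ring.
by rewrite ii; field.
Qed.

Lemma l2_inner_cvg x y :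
  fset_cvg (fun F => \sum_(i <- F) x i * (y i)^*) (l2_inner x y).
Proof.
(* Both sides are arranged in nested layers [a * _ + _] ending in 0, so that each layer is one use
   of [fset_cvg_linear]. *)
have -> : (fun F => \sum_(i <- F) x i * (y i)^*) = (fun F => 4^-1 *
  ((-1) * (ssq (l2_fun (x - y)) F)%:C%C + (1 * (ssq (l2_fun (x + y)) F)%:C%C +
   ('i%C * (ssq (l2_fun (x + 'i%C *: y)) F)%:C%C +
    ((- 'i%C) * (ssq (l2_fun (x - 'i%C *: y)) F)%:C%C + 0)))) + 0).
  apply/funext => F; rewrite !addr0 /ssq !rmorph_sum/= !mulr_sumr -!big_split/= mulr_sumr.
  apply: eq_bigr => i _; rewrite mulJ_polarization.
  transitivity (4^-1 * (-1 * (rnorm (x i - y i) ^+ 2)%:C%C +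
    (1 * (rnorm (x i + y i) ^+ 2)%:C%C +
    ('i%C * (rnorm (x i + 'i%C * y i) ^+ 2)%:C%C +
     - 'i%C * (rnorm (x i - 'i%C * y i) ^+ 2)%:C%C)))) => //.
  by congr (_ * _); ring.
have -> : l2_inner x y = 4^-1 *
  ((-1) * (l2norm (x - y) ^+ 2)%:C%C + (1 * (l2norm (x + y) ^+ 2)%:C%C +
   ('i%C * (l2norm (x + 'i%C *: y) ^+ 2)%:C%C +
    ((- 'i%C) * (l2norm (x - 'i%C *: y) ^+ 2)%:C%C + 0)))) + 0.
  by rewrite /l2_inner; ring.
have c0 : fset_cvg (fun=> 0) 0.
  by move=> e e0; exists fset0 => F _; rewrite subrr rnorm0 ltW.
by do ![apply: fset_cvg_linear => // | exact: fset_cvg_ssq].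
Qed.

Fact l2_inner_linear a x y z :
  l2_inner (a *: x + y) z = a * l2_inner x z + l2_inner y z.
Proof.
apply: (fset_cvg_unique (@l2_inner_cvg _ _)).
rewrite (_ : (fun F => _) = (fun F => a * (\sum_(i <- F) x i * (z i)^*) +
  \sum_(i <- F) y i * (z i)^*)); last first.
  apply/funext => F; rewrite mulr_sumr -big_split; apply: eq_bigr => i _.
  by rewrite l2DE l2ZE mulrDl mulrA.
by apply: fset_cvg_linear; exact: l2_inner_cvg.
Qed.

Fact l2_inner_conj x y : l2_inner y x = (l2_inner x y)^*.
Proof.
apply: (fset_cvg_unique (@l2_inner_cvg _ _)).
rewrite (_ : (fun F => _) = (fun F => (\sum_(i <- F) x i * (y i)^*)^*)); last first.
  apply/funext => F; rewrite rmorph_sum; apply: eq_bigr => i _.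
  by rewrite rmorphM/= conjCK mulrC.
by apply: fset_cvg_conj; exact: l2_inner_cvg.
Qed.

Fact l2_inner_norm x : l2_inner x x = `|x| ^+ 2.
Proof.
rewrite -rnormE -rmorphXn/= l2_rnormE.
apply: (fset_cvg_unique (@l2_inner_cvg _ _)).
rewrite (_ : (fun F => _) = (fun F => (ssq x F)%:C%C)); first exact: fset_cvg_ssq.
by apply/funext => F; rewrite rmorph_sum; apply: eq_bigr => i _; rewrite mulJ_rnorm.
Qed.

Definition l2_hilbert : hilbert R :=
  @Hilbert R l2 l2_inner l2_inner_linear l2_inner_conj l2_inner_norm.

Fact delta_is_l2 (i : I) : is_l2 (fun j => (j == i)%:R : R[i]).
Proof.
apply/asboolP; exists 1 => F; rewrite /ssq.
have [iF|iF] := boolP (i \in F).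
  rewrite (bigD1_seq i)//= eqxx rnorm1 expr1n big1 ?addr0// => j /negbTE ->.
  by rewrite rnorm0 expr0n.
rewrite big_seq big1// => j jF; case: eqP => [ji|_]; first by rewrite -ji jF in iF.
by rewrite rnorm0 expr0n.
Qed.

Definition delta i : l2 := L2 (delta_is_l2 i).

Lemma l2_inner_delta x i : l2_inner x (delta i) = x i.
Proof.
apply: (fset_cvg_unique (@l2_inner_cvg _ _)) => e e0.
exists [fset i]%fset => F; rewrite fsub1set => iF.
rewrite (bigD1_seq i)//= eqxx rmorph1 mulr1 big1 ?addr0.
  by rewrite subrr rnorm0 ltW.
by move=> j /negbTE ->; rewrite rmorph0 mulr0.
Qed.

Definition supported x F : Prop := forall i, i \notin F -> x i = 0.

Definition truncate x F : l2 := \sum_(i <- F) x i *: delta i.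

Lemma l2_sumE (J : Type) (r : seq J) (f : J -> l2) i :
  (\sum_(j <- r) f j) i = \sum_(j <- r) f j i.
Proof. by elim: r => [|j r ih]; rewrite ?big_nil// !big_cons l2DE ih. Qed.

Lemma truncateE x F i : truncate x F i = if i \in F then x i else 0.
Proof.
rewrite l2_sumE (eq_bigr (fun j => x j * (i == j)%:R))//.
case: ifPn => iF.
  rewrite (bigD1_seq i)//= eqxx mulr1 big1 ?addr0// => j /negbTE.
  by rewrite eq_sym => ->; rewrite mulr0.
rewrite big_seq big1// => j jF; case: eqP => [ij|]; last by rewrite mulr0.
by rewrite ij jF in iF.
Qed.

Lemma supported_truncate x F : supported (truncate x F) F.
Proof. by move=> i iF; rewrite truncateE (negbTE iF). Qed.

Lemma truncate_supported x F : supported x F -> truncate x F = x.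
Proof. by move=> xF; apply: l2_inj => i; rewrite truncateE; case: ifPn => // /xF. Qed.

Lemma truncate_approx x e : 0 < e -> exists F, rnorm (x - truncate x F) <= e.
Proof.
move=> e0; have [F h] := l2norm_adherent x (exprn_gt0 2 e0); exists F.
apply: l2norm_le => [|F']; first exact: ltW.
set t := truncate x F; apply: (@le_trans _ _ (l2norm x ^+ 2 - ssq x F)); last by lra.
rewrite lerBrDl; apply: le_trans (ssq_le_l2norm x (F `|` F')%fset).
have -> : ssq x F = ssq t F.
  by rewrite /ssq big_seq [RHS]big_seq; apply: eq_bigr => i iF; rewrite truncateE iF.
(* The families [t] and [x - t] live on disjoint sets of coordinates, so their squares add up
   termwise. *)
apply: le_trans (lerD (ssq_sub _ (fsubsetUl F F')) (ssq_sub _ (fsubsetUr F F'))) _.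
rewrite /ssq -big_split; apply: ler_sum => i _ /=.
suff : rnorm (t i) ^+ 2 + rnorm (x i - t i) ^+ 2 <= rnorm (x i) ^+ 2 by [].
rewrite truncateE; case: ifP => _.
  by rewrite subrr rnorm0 expr0n addr0.
by rewrite subr0 rnorm0 expr0n add0r.
Qed.

(** On [F] each coordinate is at most [b]; off [F] the vector [z] vanishes and [x] coincides with
    [x - z]. Hence small coordinates together with proximity to a vector of small support force a
    small norm. *)
Lemma l2_norm_near_supported x z F (b : R) : supported z F ->
  (forall i, rnorm (x i) <= b) ->
  rnorm x ^+ 2 <= #|` F|%:R * b ^+ 2 + rnorm (x - z) ^+ 2.
Proof.
move=> zF xb.
have rhs0 : 0 <= #|` F|%:R * b ^+ 2 + rnorm (x - z) ^+ 2.
  by apply: addr_ge0; [apply: mulr_ge0 => //; exact: sqr_ge0|exact: sqr_ge0].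
rewrite -[leRHS]sqr_sqrtr//.
rewrite ler_pXn2r// ?nnegrE ?rnorm_ge0 ?sqrtr_ge0//.
apply: l2norm_le => [|F']; first exact: sqrtr_ge0.
rewrite sqr_sqrtr//.
apply: le_trans (lerD (lexx _) (ssq_le_l2norm _ F')).
have -> : #|` F|%:R * b ^+ 2 = \sum_(i <- F) b ^+ 2.
  by rewrite big_const_seq count_predT iter_addr_0 mulr_natl.
apply: (@le_trans _ _ (\sum_(i <- F') (if i \in F then b ^+ 2 else 0) +
    ssq (l2_fun (x - z)) F')).
  rewrite /ssq -big_split; apply: ler_sum => i _.
  suff : rnorm (x i) ^+ 2 <= (if i \in F then b ^+ 2 else 0) +
    rnorm (x i - z i) ^+ 2 by [].
  case: ifPn => iF.
    rewrite ler_wpDr ?sqr_ge0// ler_pXn2r ?nnegrE ?rnorm_ge0//.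
    by rewrite (le_trans (rnorm_ge0 (x i))).
  by rewrite zF// subr0 add0r.
rewrite lerD2r -big_mkcond/= -big_filter.
have -> : \sum_(i <- [seq i <- F' | i \in F]) b ^+ 2 =
    \sum_(i <- F | i \in F') b ^+ 2.
  rewrite -[RHS]big_filter; apply: perm_big; apply: uniq_perm; rewrite ?filter_uniq//.
  by move=> i; rewrite !mem_filter andbC.
by rewrite [leRHS](bigID (mem F'))/= lerDl sumr_ge0// => i _; rewrite sqr_ge0.
Qed.

End L2Hilbert.

(** * Representations by sparse operators *)

Section SmallCoordinates.
Variables (R : realType) (I : choiceType).
Local Notation l2 := (@l2 R I).
Implicit Types (eta : nat -> l2).

(** The upper half of orthonormality. It survives maps that are linear and contractive on
    isometries, which may destroy orthogonality itself. *)
Definition bessel eta : Prop := forall (l : seq nat) (a : nat -> R[i]), uniq l ->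
  rnorm (\sum_(i <- l) a i *: eta i) ^+ 2 <= \sum_(i <- l) rnorm (a i) ^+ 2.

(** Testing the inequality with the coefficients [(eta i y)^*] over a finite list makes the
    coordinate at [y] equal to [s], the sum of the [|eta i y|^2], so that [s^2 <= s]. More than
    [d^-2] indices with [|eta i y| > d] would give [s > 1]. *)
Lemma bessel_coord_small eta y (d : R) : bessel eta -> 0 < d ->
  exists N, forall i, (N <= i)%N -> rnorm (eta i y) <= d.
Proof.
move=> be d0; apply: contrapT => /forallNP bad.
have bad' N : exists i, (N <= i)%N /\ d < rnorm (eta i y).
  have /existsNP[i /not_implyP[Ni /negP]] := bad N.
  by rewrite -ltNge => di; exists i.
have lex M : exists (l : seq nat) N, [/\ uniq l, size l = M,
    forall i, i \in l -> (i < N)%N & forall i, i \in l -> d < rnorm (eta i y)].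
  elim: M => [|M [l [N [ul sl lN ld]]]]; first by exists [::], 0%N.
  have [i [Ni di]] := bad' N; exists (i :: l), i.+1; split=> [||j|j] /=.
  - by rewrite ul andbT; apply/negP => /lN; rewrite ltnNge Ni.
  - by rewrite sl.
  - by rewrite inE => /orP[/eqP ->//|/lN jN]; rewrite ltnS ltnW// (leq_trans jN).
  - by rewrite inE => /orP[/eqP ->|/ld].
have [l [_ [ul sl _ ld]]] := lex (Num.truncn (d ^+ 2)^-1).+1.
pose s := \sum_(i <- l) rnorm (eta i y) ^+ 2.
have sd : 1 < s.
  apply: (@lt_le_trans _ _ ((size l)%:R * d ^+ 2)).
    by rewrite -ltr_pdivrMr ?exprn_gt0// div1r sl; exact: truncnS_gt.
  rewrite -sum1_size natr_sum mulr_suml /s big_seq [leRHS]big_seq.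
  by apply: ler_sum => i /ld di; rewrite mul1r ler_pXn2r ?nnegrE ?rnorm_ge0 ?(ltW d0) ?(ltW di).
have := be l (fun i => (eta i y)^*) ul.
under [leRHS]eq_bigr do rewrite rnormJ.
rewrite -/s; apply/negP; rewrite -ltNge; apply: (@lt_le_trans _ _ (s ^+ 2)).
  by rewrite expr2 ltr_pMr// (lt_trans ltr01).
have s0 : 0 <= s by rewrite ltW// (lt_trans ltr01).
rewrite ler_pXn2r ?nnegrE ?rnorm_ge0//.
set x := \sum_(i <- l) _; apply: le_trans (l2_coord_le_l2norm x y).
rewrite (_ : x y = s%:C%C); first by rewrite rnorm_real ler_norm.
rewrite /x l2_sumE /s rmorph_sum; apply: eq_bigr => i _ /=.
by rewrite -mulJ_rnorm mulrC.
Qed.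

Lemma bessel_coords_small eta (F : seq I) (d : R) : bessel eta -> 0 < d ->
  exists N, forall i y, (N <= i)%N -> y \in F -> rnorm (eta i y) <= d.
Proof.
move=> be d0; elim: F => [|y F [N h]]; first by exists 0%N.
have [N' h'] := bessel_coord_small y be d0; exists (maxn N N') => i z.
rewrite geq_max inE => /andP[Ni N'i] /orP[/eqP ->|]; first exact: h'.
exact: h.
Qed.

Lemma l2_coords_small (x : l2) (d : R) : 0 < d ->
  exists F : seq I, forall y, y \notin F -> rnorm (x y) <= d.
Proof.
move=> d0; have [F h] := truncate_approx x d0; exists F => y yF.
apply: le_trans h; apply: le_trans (l2_coord_le_l2norm _ y).
suff : rnorm (x y) <= rnorm (x y - truncate x F y) by [].
by rewrite truncateE (negbTE yF) subr0.
Qed.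

(* Gliding hump: finitely many vectors are small outside a finite set, on
   which all late enough vectors of the sequence are small. *)
Lemma bessel_gliding_hump eta m (d : R) : bessel eta -> 0 < d ->
  exists l : seq nat, [/\ uniq l, size l = m &
    forall y, exists j, forall i, i \in l -> i != j -> rnorm (eta i y) <= d].
Proof.
move=> be d0.
suff [l [N [F [ul sl lN lF lj]]]] : exists (l : seq nat) N (F : seq I),
    [/\ uniq l, size l = m, forall i, i \in l -> (i < N)%N,
     forall i y, i \in l -> y \notin F -> rnorm (eta i y) <= d &
     forall y, exists j, forall i, i \in l -> i != j -> rnorm (eta i y) <= d].
  by exists l.
elim: m => [|m [l [N [F [ul sl lN lF lj]]]]].
  by exists [::], 0%N, [::]; split=> // y; exists 0%N.
have [N' hN'] := bessel_coords_small F be d0.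
pose k := maxn N N'; have [F' hF'] := l2_coords_small (eta k) d0.
exists (k :: l), k.+1, (F ++ F'); split=> [||i|i y|y] /=.
- by rewrite ul andbT; apply/negP => /lN; rewrite ltnNge leq_maxl.
- by rewrite sl.
- by rewrite inE => /orP[/eqP ->//|/lN iN]; rewrite ltnS ltnW// (leq_trans iN)// leq_maxl.
- rewrite inE mem_cat negb_or => /orP[/eqP ->|il] /andP[yF yF']; first exact: hF'.
  exact: lF.
- have [yF|yF] := boolP (y \in F).
    have [j hj] := lj y; exists j => i; rewrite inE => /orP[/eqP -> _|]; last exact: hj.
    by apply: hN' => //; exact: leq_maxr.
  exists k => i; rewrite inE => /orP[/eqP ->|il _]; first by rewrite eqxx.
  exact: lF.
Qed.

End SmallCoordinates.

Section SparseRepresentation.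
Variables (R : realType) (H : hilbert R) (I : choiceType).
Local Notation K := (l2_hilbert R I).
Local Notation l2 := (@l2 R I).

(** Stated through supports of finitely supported vectors, which is the form in which bounded
    columns enter the contradiction. *)
Definition column_sparse (k : nat) (S : bounded_op K) : Prop :=
  forall (z : l2) F, supported z F ->
    exists2 F', supported (S z : l2) F' & (#|` F'| <= k * #|` F|)%N.

Lemma bounded_op_sumE (V : normedModType R[i]) (J : Type) (r : seq J)
    (f : J -> bounded_op V) x :
  (\sum_(j <- r) f j) x = \sum_(j <- r) f j x.
Proof. by elim: r => [|j r ih]; rewrite ?big_nil// !big_cons bounded_opDE ih. Qed.

Variable w : nat -> bounded_op H.
Hypothesis w_isometry : forall n, isometry (w n).
Hypothesis w_orthogonal : forall n m x y, n != m -> inner (w n x) (w m y) = 0.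

(** Cross terms vanish by orthogonality of the ranges, so the combination is a multiple of an
    isometry. The injection [s] selects the block of isometries in use. *)
Lemma inner_comb (l : seq nat) (s : nat -> nat) (a : nat -> R[i]) x y :
  uniq l -> injective s ->
  inner ((\sum_(i <- l) a i *: w (s i)) x) ((\sum_(i <- l) a i *: w (s i)) y) =
  (\sum_(i <- l) rnorm (a i) ^+ 2)%:C%C * inner x y.
Proof.
move=> ul sI; rewrite !bounded_op_sumE.
elim: l ul => [_|i l ih]; first by rewrite !big_nil inner0l mul0r.
rewrite /= => /andP[il ul]; rewrite !big_cons innerDl !innerDr ih//.
have o1 (z t : H) : inner (w (s i) z) (\sum_(j <- l) (a j *: w (s j)) t) = 0.
  rewrite inner_conj inner_suml big_seq big1 ?rmorph0// => j jl.
  rewrite innerZl w_orthogonal ?mulr0//; apply: contraNneq il => /sI <-//.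
have o2 (z t : H) : inner ((a i *: w (s i)) z) (\sum_(j <- l) (a j *: w (s j)) t) = 0.
  by rewrite innerZl o1 mulr0.
have o3 (z t : H) : inner (\sum_(j <- l) (a j *: w (s j)) t) ((a i *: w (s i)) z) = 0.
  by rewrite inner_conj o2 rmorph0.
rewrite o2 o3 addr0 add0r innerZl innerZr w_isometry.
by rewrite mulrA mulJ_rnorm -mulrDl -rmorphD.
Qed.

Variable Theta : bounded_op H -> bounded_op K.
Hypothesis Theta_linear : forall a S T, Theta (a *: S + T) = a *: Theta S + Theta T.
Hypothesis Theta_isometry : forall V, isometry V ->
  rnorm (Theta V) <= 1 /\ rnorm (Theta (adjoint V)) <= 1.

Let Theta_isometry_le V x : isometry V -> rnorm (Theta V x) <= rnorm x.
Proof.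
move=> /Theta_isometry[V1 _]; apply: le_trans (le_op_norm _ _) _.
by rewrite ler_piMl ?rnorm_ge0.
Qed.

Let Theta0 : Theta 0 = 0.
Proof.
by have := Theta_linear (-1) 0 0; rewrite scaler0 addr0 scaleN1r addNr.
Qed.

Let ThetaZ a T : Theta (a *: T) = a *: Theta T.
Proof. by rewrite -[a *: T]addr0 Theta_linear Theta0 addr0. Qed.

Lemma Theta_comb (l : seq nat) (s : nat -> nat) (a : nat -> R[i]) x :
  Theta (\sum_(i <- l) a i *: w (s i)) x = \sum_(i <- l) a i *: Theta (w (s i)) x.
Proof.
elim: l => [|i l ih]; first by rewrite !big_nil Theta0.
by rewrite !big_cons Theta_linear bounded_opDE ih.
Qed.

(* A normalised combination of the isometries [w (s i)] is again an isometry,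
   and [Theta] is contractive on those. *)
Lemma Theta_bessel (s : nat -> nat) (x : K) : injective s -> rnorm x <= 1 ->
  bessel (fun i => Theta (w (s i)) x : l2).
Proof.
move=> sI x1 l a ul; rewrite -Theta_comb.
set V := \sum_(i <- l) _; set t := \sum_(i <- l) _.
have t0 : 0 <= t by apply: sumr_ge0 => i _; exact: sqr_ge0.
have [tz|tz] := eqVneq t 0.
  suff -> : V = 0 by rewrite Theta0 rnorm0 expr0n.
  apply: bounded_op_inj => y; apply/rnorm_eq0/eqP; rewrite -sqrf_eq0 rnorm_sqr.
  by rewrite inner_comb// -/t tz mul0r.
have st : 0 < Num.sqrt t by rewrite sqrtr_gt0 lt_neqAle eq_sym tz.
have iV : isometry ((Num.sqrt t)^-1%:C%C *: V).
  move=> y z; rewrite !bounded_opZE innerZl innerZr inner_comb// -/t.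
  rewrite (_ : ((Num.sqrt t)^-1%:C%C)^* = (Num.sqrt t)^-1%:C%C); last exact: conjc_real.
  rewrite !mulrA -!rmorphM/= (_ : _ * _ * t = 1) ?mul1r//.
  rewrite -[X in _ * X = _](sqr_sqrtr t0); move: (Num.sqrt t) st => r r0.
  by field; rewrite gt_eqF.
have := Theta_isometry_le x iV; rewrite ThetaZ bounded_opZE rnormZ rnorm_real.
rewrite ger0_norm ?invr_ge0 ?(ltW st)// => /le_trans/(_ x1).
rewrite mulrC ler_pdivrMr// mul1r => h.
by rewrite -(sqr_sqrtr t0) ler_pXn2r ?nnegrE ?rnorm_ge0 ?(ltW st).
Qed.

(** At each coordinate at most one of the [m + 1] vectors exceeds [1/(m+1)], and that one is at most
    1; so the sum is at most 2 before the division by the square root. *)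
Lemma spread_comb (s : nat -> nat) (x : K) m : injective s -> rnorm x <= 1 ->
  exists l : seq nat, [/\ uniq l, size l = m.+1 &
    forall y, rnorm ((Theta (\sum_(i <- l) (Num.sqrt m.+1%:R)^-1%:C%C *: w (s i)) x : l2) y)
      <= 2 / Num.sqrt m.+1%:R].
Proof.
move=> sI x1; have m0 : 0 < m.+1%:R :> R by [].
have d0 : 0 < m.+1%:R^-1 :> R by rewrite invr_gt0.
have [l [ul sl lj]] := @bessel_gliding_hump _ _ _ m.+1 _ (Theta_bessel sI x1) d0.
exists l; split=> // y; have [j hj] := lj y.
rewrite (Theta_comb l s (fun=> _)) l2_sumE; apply: le_trans (rnorm_sum _ _ _) _.
have sm : 0 <= (Num.sqrt m.+1%:R)^-1 :> R by rewrite invr_ge0 sqrtr_ge0.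
apply: (@le_trans _ _ (\sum_(i <- l) (Num.sqrt m.+1%:R)^-1 * ((i == j)%:R + m.+1%:R^-1))).
  rewrite big_seq [leRHS]big_seq; apply: ler_sum => i il.
  rewrite l2ZE rnormM rnorm_real ger0_norm// ler_wpM2l//.
  have [->|ij] := eqVneq i j; last by rewrite add0r hj.
  rewrite ler_wpDr ?(ltW d0)//; apply: le_trans (l2_coord_le_l2norm _ _) _.
  exact: le_trans (Theta_isometry_le _ (w_isometry _)) x1.
rewrite -mulr_sumr mulrC ler_wpM2r// big_split/= lerD//.
  rewrite -natr_sum (_ : \sum_(i <- l) _ = count_mem j l)%N; last first.
    by rewrite -sumn_count sumnE big_map.
  by rewrite (count_uniq_mem _ ul); case: (j \in l); rewrite ?ler01.
by rewrite big_const_seq count_predT iter_addr_0 sl -[_ *+ _]mulr_natr mulVf// gt_eqF.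
Qed.

End SparseRepresentation.

(** * The gliding-hump contradiction *)

Section SparseObstruction.
Variables (R : realType) (H : hilbert R) (I : choiceType).
Local Notation K := (l2_hilbert R I).

Theorem sparse_representation_trivial (Theta : bounded_op H -> bounded_op K) :
  infinite_dimensional H ->
  (forall a S T, Theta (a *: S + T) = a *: Theta S + Theta T) ->
  (forall S T, Theta (comp_op S T) = comp_op (Theta S) (Theta T)) ->
  (forall V, isometry V -> rnorm (Theta V) <= 1 /\ rnorm (Theta (adjoint V)) <= 1) ->
  (forall T e, 0 < e -> exists k S, @column_sparse R I k S /\ rnorm (Theta T - S) <= e) ->
  Theta (id_op H) = 0.
Proof.
(* The final contradiction: [c^2] will be bounded by two contributions, each at most [c^2 / 4]. *)
have absurd (t : R) : 0 < t -> t ^+ 2 <= t ^+ 2 / 4 + (t / 2) ^+ 2 -> False.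
  by move=> /(exprn_gt0 2); lra.
move=> Hinf Tlin Tmul Tiso Tsparse; apply: bounded_op_inj => x0.
have [//|xi0] := eqVneq (Theta (id_op H) x0) 0.
have [c c0 [xi [xi1 cE]]] : exists2 c : R, 0 < c & exists xi : K,
    rnorm xi <= 1 /\ rnorm (Theta (id_op H) xi) = c.
  have x00 : 0 < rnorm x0.
    rewrite lt_neqAle rnorm_ge0 andbT eq_sym; apply: contra xi0 => /eqP/rnorm_eq0 ->.
    by rewrite linear0.
  exists (rnorm (Theta (id_op H) ((rnorm x0)^-1%:C%C *: x0))).
    rewrite linearZ rnormZ rnorm_real mulr_gt0 ?normr_gt0 ?invr_eq0 ?gt_eqF//.
    rewrite lt_neqAle rnorm_ge0 andbT eq_sym.
    by apply: contra xi0 => /eqP/rnorm_eq0 ->.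
  eexists; split; last by [].
  by rewrite rnormZ rnorm_real ger0_norm ?invr_ge0 ?(ltW x00)// mulVf ?gt_eqF.
have Tle V x : isometry V -> rnorm (Theta V x) <= rnorm x.
  move=> /Tiso[V1 _]; apply: le_trans (le_op_norm _ _) _.
  by rewrite ler_piMl ?rnorm_ge0.
have c1 : c <= 1 by rewrite -cE; apply: le_trans (Tle (id_op H) _ _) xi1.
(* As [adjoint V] composed with [V] is the identity, the contraction [Theta (adjoint V)] sends
   [Theta V xi] to a vector of norm [c]. *)
have Tge V : isometry V -> c <= rnorm (Theta V xi).
  move=> iV; rewrite -cE -(isometry_adjoint iV) Tmul.
  apply: le_trans (le_op_norm (Theta (adjoint V)) (Theta V xi)) _.
  by rewrite ler_piMl ?rnorm_ge0//; exact: (Tiso _ iV).2.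
have [w [iw ow tw]] := cuntz_family Hinf.
(* The errors will be [c/8] for replacing [Theta (w k) xi] by [zeta k], and [c/8] times
   [|zeta k| <= 2] for replacing [Theta X] by [S]; together they stay below [c/2]. *)
have c8 : 0 < c / 8 by rewrite divr_gt0.
(* Disjoint blocks of indices make the ranges of different [v n] orthogonal. *)
pose s (n i : nat) : nat := choice.pickle (n, i).
have sI n : injective (s n) by move=> i j /(pcan_inj (@choice.pickleK _))[].
have snm n m i j : n != m -> s n i != s m j.
  by apply: contraNneq => /(pcan_inj (@choice.pickleK _))[->].
(* The length [m + 1] is tuned to [n]-sparse operators: these send [zeta] to a vector with at most
   [n |F|] nonzero coordinates, on which squared coordinates of size at most [4 / (m+1)] contribute
   at most [c^2 / 4]. *)
have step n : exists (zeta : K) (F : {fset I}) (m : nat) (l : seq nat),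
  [/\ supported zeta F, rnorm (Theta (w n) xi - zeta) <= c / 8,
      16 * (n * #|` F|)%:R <= m.+1%:R * c ^+ 2, uniq l /\ size l = m.+1 &
      forall y, rnorm ((Theta (\sum_(i <- l) (Num.sqrt m.+1%:R)^-1%:C%C *: w (s n i)) xi
        : l2 R I) y) <= 2 / Num.sqrt m.+1%:R].
  have [F hF] := truncate_approx (Theta (w n) xi : l2 R I) c8.
  pose m := Num.truncn (16 * (n * #|` F|)%:R / c ^+ 2).
  have [l [ul sl lb]] := spread_comb iw ow Tlin Tiso m (@sI n) xi1.
  exists (truncate (Theta (w n) xi) F), F, m, l; split=> //.
    exact: supported_truncate.
  by rewrite -ler_pdivrMr ?exprn_gt0// ltW// truncnS_gt.
have [zeta /choice[F /choice[m /choice[l hl]]]] := choice step.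
pose v n := \sum_(i <- l n) (Num.sqrt (m n).+1%:R)^-1%:C%C *: w (s n i).
have iv n : isometry (v n).
  move=> x y; have [_ _ _ [ul sl] _] := hl n.
  rewrite (inner_comb iw ow (fun=> _))// big_const_seq count_predT iter_addr_0 sl.
  rewrite rnorm_real ger0_norm ?invr_ge0 ?sqrtr_ge0// exprVn sqr_sqrtr//.
  by rewrite -[_ *+ _]mulr_natr mulVf ?pnatr_eq0// mul1r.
have ov n n' x y : n != n' -> inner (v n x) (v n' y) = 0.
  move=> nn'; rewrite !bounded_op_sumE inner_suml big1// => i _.
  rewrite inner_conj inner_suml big1 ?rmorph0// => j _.
  by rewrite innerZl innerZr ow ?mulr0// snm// eq_sym.
have [||X iX XE] := @isometry_extension _ _
    (fun a b => exists n y, a = w n y /\ b = v n y).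
- move=> _ _ _ _ [n [y [-> ->]]] [n' [y' [-> ->]]].
  by have [<-|nn'] := eqVneq n n'; rewrite ?iw ?iv// ow// ov.
- by move=> x h; apply: tw => n y; apply: (h _ (v n y)); exists n, y.
(* The sparsity [k] becomes known only here; it is met by the block that was prepared for the index
   [k]. *)
have [k [S [kS XS]]] := Tsparse X _ c8.
have [zF wz mk _ lb] := hl k.
have vE : comp_op X (w k) = v k.
  by apply: bounded_op_inj => y; apply: XE; exists k, y.
have [F' SF' kF'] := kS _ _ zF.
have := l2_norm_near_supported SF' lb.
rewrite -/(v k); set x := Theta (v k) xi.
have xz : rnorm ((x : l2 R I) - S (zeta k)) <= c / 2.
  have -> : (x : l2 R I) - S (zeta k) = Theta X (Theta (w k) xi - zeta k) +
      (Theta X - S) (zeta k).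
    rewrite /x -vE Tmul linearB bounded_opBE /=.
    by rewrite addrA subrK.
  have z2 : rnorm (zeta k) <= 2.
    have := rnorm_leD (zeta k) (Theta (w k) xi); rewrite rnormB.
    have := Tle _ xi (iw k); lra.
  apply: le_trans (rnormD _ _) _.
  have h1 := le_trans (Tle X _ iX) wz.
  have h2 := le_trans (le_op_norm (Theta X - S) (zeta k))
    (ler_pM (rnorm_ge0 _) (rnorm_ge0 _) XS z2).
  by apply: le_trans (lerD h1 h2) _; lra.
have xc : c ^+ 2 <= rnorm (x : l2 R I) ^+ 2.
  by rewrite ler_pXn2r ?nnegrE ?rnorm_ge0 ?(ltW c0)//; exact: Tge.
have xz2 : rnorm ((x : l2 R I) - S (zeta k)) ^+ 2 <= (c / 2) ^+ 2.
  by rewrite ler_pXn2r ?nnegrE ?rnorm_ge0 ?divr_ge0 ?(ltW c0).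
have FF : #|` F'|%:R * (2 / Num.sqrt (m k).+1%:R) ^+ 2 <= c ^+ 2 / 4.
  have m0 : 0 < (m k).+1%:R :> R by [].
  rewrite exprMn exprVn sqr_sqrtr// mulrA ler_pdivrMr//.
  have : #|` F'|%:R <= (k * #|` F k|)%:R :> R by rewrite ler_nat.
  move: mk; move: (#|` F'|%:R) ((k * _)%:R) ((m k).+1%:R) => a b d; lra.
by move=> xle; case: (absurd c c0 (le_trans xc (le_trans xle (lerD FF xz2)))).
Qed.

End SparseObstruction.

(** * The Fell line bundle and the regular representations *)

Section GroupoidCalculus.
Variable G : topGroupoid.
Implicit Types a b c : G.

Lemma mulK_inv a b : src a = rng b -> mul (mul a b) (inv b) = a.
Proof. by move=> ab; rewrite -mul_assoc ?rng_inv// mul_inv -ab mul_src. Qed.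

Lemma mul_invK a b : src a = src b -> mul (mul a (inv b)) b = a.
Proof. by move=> ab; rewrite -mul_assoc ?src_inv ?rng_inv// inv_mul -ab mul_src. Qed.

Lemma mulI_inv a b : src a = rng b -> mul (inv a) (mul a b) = b.
Proof. by move=> ab; rewrite mul_assoc ?src_inv// inv_mul ab mul_rng. Qed.

Lemma inv_unique a b : src a = rng b -> mul a b = rng a -> b = inv a.
Proof.
move=> ab abE; rewrite -(mulI_inv ab) abE -[in LHS](src_inv a).
exact: mul_src.
Qed.

Lemma invK a : inv (inv a) = a.
Proof. by apply/esym/inv_unique; rewrite ?src_inv ?rng_inv// inv_mul. Qed.

Lemma inv_mulE a b : src a = rng b -> inv (mul a b) = mul (inv b) (inv a).
Proof.
move=> ab; apply/esym/inv_unique; first by rewrite src_mul// rng_mul ?rng_inv// src_inv.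
rewrite mul_assoc ?src_mul ?rng_inv ?src_inv//.
by rewrite mulK_inv// mul_inv rng_mul.
Qed.

Lemma src_div a b : src a = src b -> src (mul a (inv b)) = rng b.
Proof. by move=> ab; rewrite src_mul ?src_inv ?rng_inv. Qed.

Lemma rng_div a b : src a = src b -> rng (mul a (inv b)) = rng a.
Proof. by move=> ab; rewrite rng_mul ?rng_inv. Qed.

Lemma inv_div a b : src a = src b -> inv (mul a (inv b)) = mul b (inv a).
Proof. by move=> ab; rewrite inv_mulE ?rng_inv// invK. Qed.

Lemma div_mul_div a k b : src a = src k -> src k = src b ->
  mul (mul a (inv k)) (mul k (inv b)) = mul a (inv b).
Proof.
move=> ak kb; rewrite mul_assoc ?src_div ?rng_inv ?rng_mul ?rng_inv//.
by rewrite mul_invK.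
Qed.

End GroupoidCalculus.

(** * Fibre coordinates, the cocycle of the twist and the matrices of sections *)

Section FellCalculus.
Variables (R : realType) (G : topGroupoid) (S : twist R G).
Implicit Types (a b : S) (g h : G) (c d z w : R[i]).
Local Notation pr := (@twist_proj R G S).
Local Notation L := (@fell_bundle R G S).
Local Notation cls := (@fell_class R G S).

Lemma circle1 : circle R 1.
Proof. by rewrite /circle /= normr1. Qed.

Lemma circle_neq0 z : circle R z -> z != 0.
Proof. by rewrite /circle /= => z1; rewrite -normr_eq0 z1 oner_eq0. Qed.

Lemma circle_rnorm z : circle R z -> rnorm z = 1.
Proof. by move=> z1; apply: complexI; rewrite rnormE; exact: z1. Qed.

Lemma circle_mulJ z : circle R z -> z * z^* = 1.
Proof. by move=> z1; rewrite mulrC; have [] := circle_conj z1. Qed.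

Lemma src_projE a : src a = twist_iota S (src (pr a)) 1.
Proof. by rewrite -proj_src unit_proj//; exact: src_src. Qed.

Lemma rng_projE a : rng a = twist_iota S (rng (pr a)) 1.
Proof. by rewrite -proj_rng unit_proj//; exact: rng_units. Qed.

(** The unit spaces are identified, so composability in the twist can be tested in [G]. *)
Lemma composable_proj a b : src (pr a) = rng (pr b) -> src a = rng b.
Proof. by move=> ab; rewrite src_projE rng_projE ab. Qed.

Lemma src_eq_proj a b : src (pr a) = src (pr b) -> src a = src b.
Proof. by move=> ab; rewrite !src_projE ab. Qed.

Lemma proj_inv a : pr (inv a) = inv (pr a).
Proof.
apply: inv_unique; first by rewrite -proj_src -proj_rng rng_inv.
by rewrite -proj_mul ?rng_inv// mul_inv proj_rng.
Qed.

Lemma src_act a z : circle R z -> src (act z a) = src a.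
Proof. by move=> z1; rewrite /act src_mul// src_iota. Qed.

Lemma act_mull a b z : circle R z -> src a = rng b ->
  mul (act z a) b = act z (mul a b).
Proof.
move=> z1 ab; have pab : src (pr a) = rng (pr b) by rewrite -proj_src -proj_rng ab.
by rewrite /act proj_mul// rng_mul// mul_assoc// src_iota.
Qed.

Lemma act_mulr a b z : circle R z -> src a = rng b ->
  mul a (act z b) = act z (mul a b).
Proof.
move=> z1 ab; have pab : src (pr a) = rng (pr b) by rewrite -proj_src -proj_rng ab.
rewrite -act_mull// /act (iota_central a z1) -pab mul_assoc//.
- by rewrite iota_rng -?src_projE//; exact: src_src.
- by rewrite iota_src -?src_projE//; exact: src_src.
Qed.

Lemma act_inj a z w : circle R z -> circle R w -> act z a = act w a -> z = w.
Proof.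
move=> z1 w1 /(congr1 (fun b => mul b (inv a))); rewrite /act !mulK_inv ?src_iota//.
have ug : units G (rng (pr a)) by exact: rng_units.
move=> zw; suff : (rng (pr a), z : R[i]^o) = (rng (pr a), w : R[i]^o) by case.
by apply: (@iota_inj R G S) => //; apply: mem_set; split.
Qed.

(** Exactness of the extension: [b a^-1] projects to a unit and therefore comes from
    [twist_iota]. *)
Lemma same_proj_act a b : pr a = pr b -> exists2 z, circle R z & b = act z a.
Proof.
move=> ab; have sab : src b = src a by apply: src_eq_proj; rewrite ab.
have : (pr @^-1` units G) (mul b (inv a)).
  rewrite /= proj_mul ?rng_inv// proj_inv ab mul_inv; exact: rng_units.
rewrite proj_kernel => -[[u z] /= [uu z1]] E; exists z => //.
rewrite /act; have -> : rng (pr a) = u; last by rewrite E mul_invK.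
have := congr1 (@rng _) E; rewrite iota_rng// rng_div// rng_projE -ab.
move/(congr1 pr); rewrite !proj_unit//; exact: rng_units.
Qed.

Lemma fell_classP a b c d :
  cls a c = cls b d <-> exists2 z, circle R z & b = act z a /\ d = z^* * c.
Proof.
split=> [/eqmodP/asboolP[z z1 [-> ->]]|[z z1 [-> ->]]]; first by exists z.
by apply/eqmodP/asboolP; exists z.
Qed.

Lemma fell_class_act a c z : circle R z -> cls (act z a) c = cls a (z * c).
Proof.
move=> z1; apply/esym/fell_classP; exists z => //; split=> //.
by rewrite mulrA (mulrC z^*) circle_mulJ// mul1r.
Qed.

(** The canonical representative is unspecified, but it differs from [(a, c)] by a circle element
    only; operations defined through [repr] are computed by means of this. *)
Lemma repr_fell_class a c : exists2 z, circle R z &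
  repr (cls a c) = (act z a, (z^* * c : R[i]^o)).
Proof.
have : cls a c = cls (repr (cls a c)).1 (repr (cls a c)).2.
  by rewrite /fell_class -surjective_pairing reprK.
by move/fell_classP => [z z1 []]; case: (repr _) => b d /= -> ->; exists z.
Qed.

Lemma fell_classK (l : L) : cls (repr l).1 (repr l).2 = l.
Proof. by rewrite /fell_class -surjective_pairing reprK. Qed.

Lemma fell_classE (l : L) : exists a c, l = cls a c.
Proof. by exists (repr l).1, (repr l).2; rewrite fell_classK. Qed.

Lemma fell_base_class a c : fell_base (cls a c) = pr a.
Proof. by rewrite /fell_base; have [z z1 ->] := repr_fell_class a c; rewrite /= proj_act. Qed.

Lemma fell_norm_class a c : fell_norm (cls a c) = rnorm c.
Proof.
rewrite /fell_norm; have [z z1 ->] := repr_fell_class a c => /=.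
transitivity (rnorm (z^* * c)) => //.
by rewrite rnormM rnormJ circle_rnorm// mul1r.
Qed.

Lemma proj_lift g : pr (twist_lift S g) = g.
Proof. by rewrite /twist_lift; case: cid. Qed.

Lemma fell_class_lift a c g : pr a = g ->
  exists2 z, circle R z & cls a c = cls (twist_lift S g) (z * c).
Proof.
move=> ag; have [|z z1 ->] := @same_proj_act (twist_lift S g) a.
  by rewrite proj_lift ag.
by exists z => //; rewrite fell_class_act.
Qed.

Lemma fell_class_inj a c d : cls a c = cls a d -> c = d.
Proof.
move=> /fell_classP[z z1 [az ->]].
have /(act_inj circle1 z1) <- : act 1 a = act z a by rewrite act1.
by rewrite rmorph1 mul1r.
Qed.

Lemma fell_coord_class g c : fell_coord g (cls (twist_lift S g) c) = c.
Proof.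
rewrite /fell_coord; set A := [set _ | _].
have : A (xget 0 A) by apply: (xgetI 0 (erefl : A c)).
by move/fell_class_inj.
Qed.

Lemma fell_coordK g (l : L) : fell_base l = g ->
  cls (twist_lift S g) (fell_coord g l) = l.
Proof.
rewrite -{1 3}(fell_classK l) fell_base_class => lg.
have [z z1 E] := fell_class_lift (repr l).2 lg.
by rewrite E; rewrite -{1}(fell_classK l) E fell_coord_class.
Qed.

Lemma fell_coord_norm g (l : L) : fell_base l = g ->
  rnorm (fell_coord g l) = fell_norm l.
Proof. by move=> lg; rewrite -{2}(fell_coordK lg) fell_norm_class. Qed.

Lemma fell_coord_zero g : fell_coord g (fell_zero S g) = 0.
Proof. exact: fell_coord_class. Qed.

Lemma fell_coord_eq0 g (l : L) : fell_base l = g ->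
  fell_coord g l = 0 -> l = fell_zero S g.
Proof. by move=> lg l0; rewrite -(fell_coordK lg) l0. Qed.

Lemma fell_mul_class a b c d : src a = rng b ->
  fell_mul (cls a c) (cls b d) = cls (mul a b) (c * d).
Proof.
move=> ab; rewrite /fell_mul.
have [z z1 ->] := repr_fell_class a c; have [w w1 ->] := repr_fell_class b d => /=.
have zw1 := circleM z1 w1.
rewrite act_mull ?rng_act// act_mulr// actM// fell_class_act//.
congr (cls _ _); transitivity ((z * z^*) * (w * w^*) * (c * d)); first by ring.
by rewrite !circle_mulJ// !mul1r.
Qed.

Lemma inv_act a z : circle R z -> inv (act z a) = act z^* (inv a).
Proof.
move=> z1; have [zz1 zz] := circle_conj z1.
apply/esym/inv_unique; first by rewrite src_act// rng_act// rng_inv.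
rewrite act_mulr ?src_act ?rng_inv// act_mull ?rng_inv// actM// zz act1 mul_inv.
by rewrite rng_act.
Qed.

Lemma fell_star_class a c : fell_star (cls a c) = cls (inv a) c^*.
Proof.
rewrite /fell_star; have [z z1 ->] := repr_fell_class a c => /=.
have [zz1 zz] := circle_conj z1.
by rewrite inv_act// fell_class_act// rmorphM/= conjCK mulrA zz mul1r.
Qed.

Lemma fell_base_mul (l m : L) : src (fell_base l) = rng (fell_base m) ->
  fell_base (fell_mul l m) = mul (fell_base l) (fell_base m).
Proof.
have [a [c ->]] := fell_classE l; have [b [d ->]] := fell_classE m.
rewrite (fell_base_class a c) (fell_base_class b d) => /composable_proj lm.
by rewrite fell_mul_class// fell_base_class proj_mul.
Qed.

(** The lifts are chosen arbitrarily, so these coordinates carry the algebra of sections but not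
    their continuity. *)
Definition section_coord (f : G -> L) g : R[i] := fell_coord g (f g).

Lemma section_coordK f g : is_section f ->
  f g = cls (twist_lift S g) (section_coord f g).
Proof. by move=> fs; rewrite fell_coordK. Qed.

Lemma section_coord_norm f g : is_section f -> rnorm (section_coord f g) = fell_norm (f g).
Proof. by move=> fs; rewrite fell_coord_norm. Qed.

Lemma section_coord_add f1 f2 g :
  section_coord (section_add f1 f2) g = section_coord f1 g + section_coord f2 g.
Proof. exact: fell_coord_class. Qed.

Lemma section_coord_scale c f g :
  section_coord (section_scale c f) g = c * section_coord f g.
Proof. exact: fell_coord_class. Qed.

Implicit Types f : G -> L.

Lemma is_section_class (c : G -> R[i]) : is_section (fun g => cls (twist_lift S g) (c g)).
Proof. by move=> g; rewrite fell_base_class proj_lift. Qed.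

Lemma is_section_zero : is_section (fell_zero S).
Proof. exact: is_section_class. Qed.

Lemma is_section_add f1 f2 : is_section (section_add f1 f2).
Proof. exact: is_section_class. Qed.

Lemma is_section_scale c f : is_section (section_scale c f).
Proof. exact: is_section_class. Qed.

Lemma is_section_convolution f1 f2 : is_section (convolution f1 f2).
Proof. exact: is_section_class. Qed.

Lemma section_ext f1 f2 : is_section f1 -> is_section f2 ->
  (forall g, section_coord f1 g = section_coord f2 g) -> f1 = f2.
Proof.
by move=> s1 s2 f12; apply/funext => g; rewrite (section_coordK g s1) f12 -section_coordK.
Qed.

Lemma Cc_section f : Cc f -> is_section f.
Proof.
by case=> [|? []|? ? _ _|? ? _]//; [exact: is_section_zero|exact: is_section_add|exact: is_section_scale].
Qed.

(* The matrix of [regular_rep] in the orthonormal basis [cls (twist_lift S h) 1]. *)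
Definition rep_matrix (f : G -> L) g h : R[i] :=
  if src g == src h then
    fell_coord g (fell_mul (f (mul g (inv h))) (cls (twist_lift S h) 1))
  else 0.

(** The 2-cocycle of the twist with respect to the chosen lifts. *)
Definition lift_cocycle g h : R[i] :=
  fell_coord (mul g h) (cls (mul (twist_lift S g) (twist_lift S h)) 1).

Lemma src_lift g h : src g = rng h -> src (twist_lift S g) = rng (twist_lift S h).
Proof. by move=> gh; apply: composable_proj; rewrite !proj_lift. Qed.

Lemma lift_cocycle_act g h : src g = rng h -> circle R (lift_cocycle g h) /\
  mul (twist_lift S g) (twist_lift S h) =
  act (lift_cocycle g h) (twist_lift S (mul g h)).
Proof.
move=> gh; have [z z1 E] : exists2 z, circle R z &
    mul (twist_lift S g) (twist_lift S h) = act z (twist_lift S (mul g h)).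
  by apply: same_proj_act; rewrite proj_mul ?proj_lift//; exact: src_lift.
have -> : lift_cocycle g h = z; last by [].
by rewrite /lift_cocycle E fell_class_act// fell_coord_class mulr1.
Qed.

Lemma lift_cocycle_assoc (a b c : G) : src a = rng b -> src b = rng c ->
  lift_cocycle (mul a b) c * lift_cocycle a b =
  lift_cocycle a (mul b c) * lift_cocycle b c.
Proof.
move=> ab bc; have abc : src (mul a b) = rng c by rewrite src_mul.
have abc' : src a = rng (mul b c) by rewrite rng_mul.
have [u1 uE] := lift_cocycle_act ab; have [v1 vE] := lift_cocycle_act bc.
have [w1 wE] := lift_cocycle_act abc; have [t1 tE] := lift_cocycle_act abc'.
apply: (@act_inj (twist_lift S (mul (mul a b) c))); [exact: circleM|exact: circleM|].
rewrite [X in act X _]mulrC [X in _ = act X _]mulrC.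
rewrite -(actM _ w1 u1) -wE -(act_mull u1 (src_lift abc)) -uE.
rewrite -(mul_assoc (src_lift ab) (src_lift bc)) vE.
by rewrite (act_mulr v1 (src_lift abc')) tE actM// mul_assoc.
Qed.

Lemma lift_cocycleP g h c : src g = rng h ->
  cls (mul (twist_lift S g) (twist_lift S h)) c =
  cls (twist_lift S (mul g h)) (lift_cocycle g h * c) /\ circle R (lift_cocycle g h).
Proof.
by move=> /lift_cocycle_act[k1 ->]; rewrite fell_class_act.
Qed.

Lemma fell_coord_mul g h (l m : L) : fell_base l = g -> fell_base m = h ->
  src g = rng h -> fell_coord (mul g h) (fell_mul l m) =
  lift_cocycle g h * (fell_coord g l * fell_coord h m).
Proof.
move=> lg mh gh; rewrite -{1}(fell_coordK lg) -{1}(fell_coordK mh).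
rewrite fell_mul_class; last exact: src_lift.
rewrite (lift_cocycleP _ gh).1.
exact: fell_coord_class.
Qed.

Lemma rep_matrixE f g h : is_section f -> src g = src h ->
  rep_matrix f g h =
  lift_cocycle (mul g (inv h)) h * section_coord f (mul g (inv h)).
Proof.
move=> fs gh; rewrite /rep_matrix gh eqxx.
rewrite -{1}(mul_invK gh) fell_coord_mul ?src_div//; last first.
  by rewrite fell_base_class proj_lift.
by rewrite fell_coord_class mulr1.
Qed.

Lemma rep_matrix_neq f g h : src g <> src h -> rep_matrix f g h = 0.
Proof. by move=> /eqP/negbTE gh; rewrite /rep_matrix gh. Qed.

Lemma rep_matrix_norm f g h : is_section f -> src g = src h ->
  rnorm (rep_matrix f g h) = fell_norm (f (mul g (inv h))).
Proof.
move=> fs gh; rewrite rep_matrixE// rnormM circle_rnorm ?mul1r ?section_coord_norm//.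
exact: (lift_cocycleP 0 (src_div gh)).2.
Qed.

Lemma rep_matrix_add f1 f2 g h : is_section f1 -> is_section f2 ->
  rep_matrix (section_add f1 f2) g h = rep_matrix f1 g h + rep_matrix f2 g h.
Proof.
move=> s1 s2; have [gh|gh] := pselect (src g = src h); last first.
  by rewrite !rep_matrix_neq// addr0.
by rewrite !rep_matrixE ?section_coord_add ?mulrDr//; exact: is_section_add.
Qed.

Lemma rep_matrix_scale c f g h : is_section f ->
  rep_matrix (section_scale c f) g h = c * rep_matrix f g h.
Proof.
move=> fs; have [gh|gh] := pselect (src g = src h); last first.
  by rewrite !rep_matrix_neq// mulr0.
rewrite (rep_matrixE fs gh) rep_matrixE//; last exact: is_section_scale.
by rewrite section_coord_scale; ring.
Qed.

(** Computes an entry from an arbitrary lift [a] of [g h^-1]. For adjoints the inverse of a chosen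
    lift occurs, which may differ from the chosen lift of the inverse. *)
Lemma rep_matrix_class f g h a c : src g = src h ->
  f (mul g (inv h)) = cls a c -> pr a = mul g (inv h) ->
  exists2 z, mul a (twist_lift S h) = act z (twist_lift S g) &
    circle R z /\ rep_matrix f g h = z * c.
Proof.
move=> gh fE ag.
have al : src a = rng (twist_lift S h).
  by apply: composable_proj; rewrite ag proj_lift src_div.
have [z z1 zE] : exists2 z, circle R z & mul a (twist_lift S h) = act z (twist_lift S g).
  by apply: same_proj_act; rewrite proj_mul// ag !proj_lift mul_invK.
exists z => //; split=> //; rewrite /rep_matrix gh eqxx fE fell_mul_class//.
by rewrite zE fell_class_act// fell_coord_class mulr1.
Qed.

Lemma rep_matrix_star f g h : is_section f ->
  rep_matrix (section_star f) g h = (rep_matrix f h g)^*.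
Proof.
move=> fs; have [gh|gh] := pselect (src g = src h); last first.
  by rewrite !rep_matrix_neq ?rmorph0//; exact/nesym.
have [a [c [fE pa]]] : exists a c, f (mul h (inv g)) = cls a c /\ pr a = mul h (inv g).
  exists (twist_lift S (mul h (inv g))), (section_coord f (mul h (inv g))).
  by rewrite proj_lift -section_coordK.
have [z zE [z1 ->]] := rep_matrix_class (esym gh) fE pa.
have [zz1 zz] := circle_conj z1.
have sfE : section_star f (mul g (inv h)) = cls (inv a) c^*.
  by rewrite /section_star inv_div// fE fell_star_class.
have pia : pr (inv a) = mul g (inv h) by rewrite proj_inv pa inv_div.
have [w wE [w1 ->]] := rep_matrix_class gh sfE pia.
rewrite rmorphM; congr (_ * _); apply: (@act_inj (twist_lift S g)) => //.
rewrite -wE; have al : src a = rng (twist_lift S g).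
  by apply: composable_proj; rewrite pa proj_lift src_div.
rewrite -[in RHS](mulI_inv al) zE act_mulr; last 2 first.
- by [].
- by apply: composable_proj; rewrite proj_inv pa inv_div// proj_lift src_div.
by rewrite actM// zz act1.
Qed.

(** The pairs [(a, b)] with [a b = g h^-1] are the pairs [(g k^-1, k h^-1)] with [k] in the common
    source fibre, and the cocycle identity matches the scalars. *)
Lemma rep_matrix_convolution f1 f2 g h : is_section f1 -> is_section f2 ->
  rep_matrix (convolution f1 f2) g h =
  \sum_(k \in [set: G]) rep_matrix f1 g k * rep_matrix f2 k h.
Proof.
move=> s1 s2; have [gh|gh] := pselect (src g = src h); last first.
  rewrite rep_matrix_neq// fsbig1// => k _.
  have [gk|gk] := pselect (src g = src k); last by rewrite rep_matrix_neq// mul0r.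
  by rewrite [X in _ * X]rep_matrix_neq ?mulr0// -gk.
rewrite rep_matrixE ?is_section_convolution//; last exact: is_section_convolution.
rewrite /section_coord /convolution /fell_sum fell_coord_class.
set A := [set ab : G * G | _].
have kh k : src k = src h -> src (mul g (inv k)) = rng (mul k (inv h)).
  by move=> kh; rewrite src_div ?rng_div// kh.
rewrite (reindex_fsbig (fun k => (mul g (inv k), mul k (inv h))) [set k | src k = src h]); last first.
  split=> [k /= kh'|k k'|[a b] /= [ab abg]].
  - by split; [exact: kh|rewrite div_mul_div// kh'].
  - move=> /set_mem/= sk /set_mem/= sk' [_ /(congr1 (fun x => mul x h))].
    by rewrite !mul_invK.
  - have bh : src b = rng h by rewrite -(src_mul ab) abg src_div.
    exists (mul b h); rewrite /= ?src_mul// mulK_inv//; congr (_, _).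
    by rewrite inv_mulE// mul_assoc ?src_inv ?rng_inv// -abg mulK_inv.
rewrite mulr_fsumr -(fsbig_widen [set k | src k = src h] [set: G])//; last first.
  by move=> k [_ /= sk]; rewrite /= (rep_matrix_neq f2)// mulr0.
apply: eq_fsbigr => k /set_mem/= sk; have gk : src g = src k by rewrite sk.
rewrite (rep_matrixE s1 gk) (rep_matrixE s2 sk).
have kk := kh k sk.
rewrite -(div_mul_div gk sk) (fell_coord_mul (s1 _) (s2 _) kk).
rewrite -/(section_coord f1 _) -/(section_coord f2 _) !mulrA.
by rewrite (lift_cocycle_assoc kk (src_div sk)) (mul_invK sk); ring.
Qed.

End FellCalculus.

(** * Sections supported on bisections *)

Section PointwiseContinuity.
Variables X Y Z : topologicalType.

(** Continuity at a single point, where a function may be replaced by one that agrees with it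
    nearby. *)
Definition cts_at (f : X -> Y) (x : X) : Prop :=
  forall A, nbhs (f x) A -> nbhs x (f @^-1` A).

Lemma cts_at_near (f g : X -> Y) x :
  nbhs x [set y | f y = g y] -> cts_at g x -> cts_at f x.
Proof.
move=> fg cg A; rewrite (nbhs_singleton fg) => /cg gA.
by apply: filterS2 fg gA => y /= ->.
Qed.

Lemma continuous_cts_at (f : X -> Y) x : continuous f -> cts_at f x.
Proof. by move=> cf A; exact: cf. Qed.

Lemma cts_at_continuous (f : X -> Y) : (forall x, cts_at f x) -> continuous f.
Proof. by move=> cf x A; exact: cf. Qed.

Lemma within_cts_at (U : set X) (f : X -> Y) x : open U -> U x ->
  {within U, continuous f} -> cts_at f x.
Proof.
move=> oU Ux; rewrite continuous_open_subspace// => cf A.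
exact: cf (mem_set Ux) A.
Qed.

Lemma cts_at_within (U : set X) (f : X -> Y) : open U ->
  (forall x, U x -> cts_at f x) -> {within U, continuous f}.
Proof.
move=> oU cf; rewrite continuous_open_subspace// => x /set_mem Ux A.
exact: cf.
Qed.

End PointwiseContinuity.

Lemma cts_at_comp (X Y Z : topologicalType) (f : X -> Y) (g : Y -> Z) x :
  cts_at f x -> cts_at g (f x) -> cts_at (g \o f) x.
Proof. by move=> cf cg A /cg/cf. Qed.

Lemma cts_at_pair (X Y Z : topologicalType) (f : X -> Y) (g : X -> Z) x :
  cts_at f x -> cts_at g x -> cts_at (fun y => (f y, g y)) x.
Proof.
move=> cf cg A [[B C] /= [/cf Bf /cg Cg] BC].
by apply: filterS2 Bf Cg => y Bfy Cgy; apply: BC.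
Qed.

Lemma cts_at_cst (X Y : topologicalType) (y : Y) (x : X) : cts_at (fun=> y) x.
Proof. by move=> A /nbhs_singleton Ay; apply: filterS (filterT) => z _. Qed.

Lemma cts_at_id (X : topologicalType) (x : X) : cts_at id x.
Proof. by move=> A. Qed.

(** Meant for the multiplication of a groupoid, whose continuity is given on composable pairs. *)
Lemma cts_at_within_comp (X Y Z : topologicalType) (B : set Y) (f : X -> Y)
    (g : Y -> Z) x : cts_at f x -> {within B, continuous g} ->
  nbhs x [set y | B (f y)] -> cts_at (g \o f) x.
Proof.
move=> cf /subspace_continuousP cg Bf A /= /(cg _ (nbhs_singleton Bf)).
rewrite /nbhs/= /within/= => /cf fA.
by apply: filterS2 Bf fA => y /= By; exact.
Qed.

(** * Bisections of an étale groupoid *)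

Section Etale.
Variable G : topGroupoid.
Hypothesis G_etale : etale G.

Lemma src_continuous : continuous (@src G).
Proof.
apply: cts_at_continuous => x; have [U [oU Ux cU _ _]] := G_etale x.
exact: within_cts_at cU.
Qed.

Lemma rng_continuous : continuous (@rng G).
Proof.
apply: cts_at_continuous => x.
apply: (@cts_at_near _ _ _ (@src G \o @inv G)).
  by apply: nearW => y; rewrite /= src_inv.
by apply: cts_at_comp; apply: continuous_cts_at; [exact: Defs.inv_continuous|exact: src_continuous].
Qed.

(** Images of small open sets are relatively open by étaleness, and an open set is the union of its
    small pieces. *)
Lemma src_open (W : set G) : open W ->
  exists2 O : set G, open O & @src G @` W = O `&` units G.
Proof.
move=> oW.
have [U UP] := choice G_etale.
have OP x : exists O : set G, open O /\ @src G @` (W `&` U x) = O `&` units G.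
  have [oU Ux _ _ h] := UP x.
  by have [D oD DE] := h _ (openI oW oU) (@subIsetr _ _ _); exists D.
have [D DE] := choice OP.
exists (\bigcup_(x in W) D x); first by apply: bigcup_open => x _; exact: (DE x).1.
rewrite setI_bigcupl; apply/seteqP; split=> [_ [x Wx <-]|y [x Wx]].
  exists x => //; rewrite -(DE x).2; exists x => //.
  by split=> //; have [] := UP x.
by rewrite -(DE x).2 => -[z [Wz _] <-]; exists z.
Qed.

Definition bisection (U : set G) : Prop :=
  [/\ open U, set_inj U (@src G) & set_inj U (@rng G)].

(** A neighbourhood of [x] on which the source is injective is intersected with the inverse of such
    a neighbourhood of [x^-1], as the range is the source of the inverse. *)
Lemma bisection_exists (x : G) : exists2 U, bisection U & U x.
Proof.
have [U [oU Ux _ injU _]] := G_etale x.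
have [V [oV Vx _ injV _]] := G_etale (inv x).
exists (U `&` @inv G @^-1` V); last by split.
split.
- apply: openI => //; apply: open_comp => // y _; exact: Defs.inv_continuous.
- by move=> y z /set_mem[Uy _] /set_mem[Uz _]; apply: injU; exact: mem_set.
- move=> y z /set_mem[_ Vy] /set_mem[_ Vz]; rewrite -!src_inv.
  by move/(injV _ _ (mem_set Vy) (mem_set Vz))/(congr1 (@inv G)); rewrite !invK.
Qed.

(** The local inverse of the source on [V], evaluated at the source of [g]; the default [g] occurs
    when no arrow of [V] has that source. *)
Definition src_lift_in (V : set G) (g : G) : G :=
  xget g [set b | V b /\ src b = src g].

Lemma src_lift_inP (V : set G) g b : V b -> src b = src g ->
  V (src_lift_in V g) /\ src (src_lift_in V g) = src g.
Proof.
move=> Vb bg.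
exact: (xgetI g (conj Vb bg : [set b' | V b' /\ src b' = src g] b)).
Qed.

Lemma src_lift_in_eq (V : set G) g b : set_inj V (@src G) -> V b ->
  src b = src g -> src_lift_in V g = b.
Proof.
move=> injV Vb bg; have [Vl lg] := src_lift_inP Vb bg.
by apply: injV; rewrite ?lg//; exact: mem_set.
Qed.

Lemma src_lift_in_near (W : set G) (g b : G) : open W -> W b -> src b = src g ->
  nbhs g [set g' | exists2 b', W b' & src b' = src g'].
Proof.
move=> oW Wb bg; have [D oD DE] := src_open oW.
have Dg : (D `&` units G) (src g) by rewrite -DE; exists b.
have h : nbhs g (@src G @^-1` D).
  exact: src_continuous (open_nbhs_nbhs (conj oD Dg.1)).
apply: filterS h => g' /= Dg'; have : (D `&` units G) (src g').
  by split=> //; exact: src_src.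
by rewrite -DE => -[b' Wb' b'g]; exists b'.
Qed.

Lemma src_lift_in_cts (V : set G) g b : open V -> set_inj V (@src G) -> V b ->
  src b = src g -> cts_at (src_lift_in V) g.
Proof.
move=> oV injV Vb bg A; rewrite (src_lift_in_eq injV Vb bg) nbhsE => -[W [oW Wb] WA].
have h := @src_lift_in_near (W `&` V) g b (openI oW oV) (conj Wb Vb) bg.
apply: filterS h => g' /= [b' [Wb' Vb'] b'g]; apply: WA.
by rewrite (src_lift_in_eq injV Vb' b'g).
Qed.

Lemma mul_cts_at (X : topologicalType) (a b : X -> G) x :
  cts_at a x -> cts_at b x -> nbhs x [set y | src (a y) = rng (b y)] ->
  cts_at (fun y => mul (a y) (b y)) x.
Proof.
move=> ca cb ab.
by apply: (cts_at_within_comp (cts_at_pair ca cb) (@Defs.mul_continuous G)).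
Qed.

(* [gamma = (gamma b^-1) b] where [b] is the arrow of [V] with source [s gamma]. *)
Lemma factor_cts (V : set G) g b : open V -> set_inj V (@src G) -> V b ->
  src b = src g -> cts_at (fun g' => mul g' (inv (src_lift_in V g'))) g.
Proof.
move=> oV injV Vb bg; have cl := src_lift_in_cts oV injV Vb bg.
apply: mul_cts_at; first exact: cts_at_id.
  by apply: (cts_at_comp cl); apply: continuous_cts_at; exact: Defs.inv_continuous.
apply: filterS (src_lift_in_near oV Vb bg) => g' [b' Vb' b'g].
by rewrite /= rng_inv (src_lift_inP Vb' b'g).2.
Qed.

Definition set_mul (U V : set G) : set G :=
  [set g | exists a b, [/\ U a, V b, src a = rng b & g = mul a b]].

(** Near [a b] the right factor in [V] varies continuously with the product, hence so does the left
    factor, which therefore stays in [U]. *)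
Lemma set_mul_open (U V : set G) : open U -> open V -> set_inj V (@src G) ->
  open (set_mul U V).
Proof.
move=> oU oV injV; rewrite openE => g [a [b [Ua Vb ab gE]]].
have bg : src b = src g by rewrite gE src_mul.
have aE : mul g (inv (src_lift_in V g)) = a.
  by rewrite (src_lift_in_eq injV Vb bg) gE mulK_inv.
have := factor_cts oV injV Vb bg; move/(_ U); rewrite aE.
move=> /(_ (open_nbhs_nbhs (conj oU Ua))) n1.
apply: filterS2 n1 (src_lift_in_near oV Vb bg) => g' /= Ug' [b' Vb' b'g].
have [Vl lg] := src_lift_inP Vb' b'g.
exists (mul g' (inv (src_lift_in V g'))), (src_lift_in V g'); split => //.
  by rewrite src_div.
by rewrite mul_invK.
Qed.

Lemma set_mul_src_inj (U V : set G) : set_inj U (@src G) -> set_inj V (@src G) ->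
  set_inj (set_mul U V) (@src G).
Proof.
move=> iU iV g g' /set_mem[a [b [Ua Vb ab ->]]] /set_mem[a' [b' [Ua' Vb' ab' ->]]].
rewrite !src_mul// => bb'; have E := iV _ _ (mem_set Vb) (mem_set Vb') bb'.
by rewrite -E (iU a a' (mem_set Ua) (mem_set Ua'))// ab ab' E.
Qed.

Hypothesis G0_hausdorff : hausdorff_subspace (units G).

Lemma units_separated (u v : G) : units G u -> units G v -> u <> v ->
  exists A B : set G, [/\ open A, open B, A u, B v & A `&` B `&` units G = set0].
Proof.
move=> uu uv /eqP uneqv; move: G0_hausdorff; rewrite /hausdorff_subspace open_hausdorff.
move=> /(_ u v uneqv)[[A B] /= [/set_mem Au /set_mem Bv] [oA oB /eqP AB]].
have /open_subspaceP[A' oA' A'E] := oA; have /open_subspaceP[B' oB' B'E] := oB.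
have A'u : (A' `&` units G) u by rewrite A'E.
have B'v : (B' `&` units G) v by rewrite B'E.
exists A', B'; split=> //; [exact: A'u.1|exact: B'v.1|].
apply/seteqP; split=> // z [[A'z B'z] uz].
have : (A' `&` units G) z by []. rewrite A'E => -[Az _].
have : (B' `&` units G) z by []. rewrite B'E => -[Bz _].
by rewrite -AB.
Qed.

(** Points outside [W] are isolated in [subspace W], so separation is an issue only for pairs inside
    [W]. *)
Lemma hausdorff_subspace_separated (W : set G) :
  (forall x y, W x -> W y -> x <> y -> exists A B : set G,
     [/\ open A, open B, A x, B y & A `&` B `&` W = set0]) ->
  hausdorff_subspace W.
Proof.
move=> sep; rewrite /hausdorff_subspace open_hausdorff => x y /eqP xy.
have opC (z : subspace W) : ~ W z -> open [set~ z].
  move=> Wz; rewrite -open_subspaceIT (_ : _ `&` _ = W); first exact: open_subspaceT.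
  by apply/seteqP; split=> [t []//|t Wt]; split=> // tz; apply: Wz; rewrite -tz.
have [Wx|Wx] := pselect (W x); last first.
  exists ([set x], [set~ x]); first by split; apply: mem_set => //=; exact/nesym.
  by split; [exact: open_subspace1out|exact: opC|rewrite setICr].
have [Wy|Wy] := pselect (W y); last first.
  exists ([set~ y], [set y]); first by split; apply: mem_set.
  by split; [exact: opC|exact: open_subspace1out|rewrite setICl].
have [A [B [oA oB Ax By AB]]] := sep x y Wx Wy xy.
exists (A `&` W, B `&` W); first by split; apply: mem_set.
split; rewrite /= ?open_subspaceIT; [exact: open_subspaceW|exact: open_subspaceW|].
by rewrite -setIIl AB.
Qed.

(** Sources are separated in the unit space and the separating sets pulled back. Bisections and
    their products are thus Hausdorff even when [G] is not. *)
Lemma src_inj_hausdorff (W : set G) : set_inj W (@src G) -> hausdorff_subspace W.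
Proof.
move=> injW; apply: hausdorff_subspace_separated => x y Wx Wy xy.
have [|||A [B [oA oB Ax By AB]]] := @units_separated (src x) (src y).
- exact: src_src.
- exact: src_src.
- by move=> sxy; apply: xy; apply: injW => //; exact: mem_set.
exists (@src G @^-1` A), (@src G @^-1` B); split=> //.
- by apply: open_comp => // z _; exact: src_continuous.
- by apply: open_comp => // z _; exact: src_continuous.
apply/seteqP; split=> // z [[Az Bz] _].
have : (A `&` B `&` units G) (src z) by split; [split|exact: src_src].
by rewrite AB.
Qed.

End Etale.

(** * Bump functions inside a Hausdorff open subset *)

Section Bump.
Variables (R : realType) (G : topologicalType).
Hypothesis G_locally_compact : locally_compact_subspace [set: G].

(** A compact neighbourhood need not be closed in [G], but it is so inside the Hausdorff [U]. *)
Lemma subspace_locally_compact (U : set G) : open U -> hausdorff_subspace U ->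
  locally_compact [set: subspace U].
Proof.
move=> oU hU x _; have [Ux|nUx] := pselect (U x); last first.
  exists [set x]; last by split; [exact: compact_set1|exact: compact_closed hU (@compact_set1 (subspace U) x)].
  by apply: filterS (@open_nbhs_nbhs (subspace U) x [set x]
    (conj (open_subspace1out nUx) erefl)) => y /= yx _.
have [K [KU cK nK]] := G_locally_compact I (open_nbhs_nbhs (conj oU Ux)).
have KI : K `&` U = K by apply/setIidl => y /KU[].
have cK' : compact (K : set (subspace U)).
  by rewrite -KI; apply/compact_subspaceIP; rewrite KI.
exists K; last by split=> //; exact: compact_closed hU cK'.
have h : nbhs_subspace (x : subspace U) K.
  rewrite -nbhs_subspace_in//.
  have nK' : @nbhs G G x [set y | [set: G] y -> K y] := nK.
  suff : @nbhs G G x [set y | U y -> K y] by [].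
  by apply: filterS nK' => y /= Ky _; apply: Ky.
have h' : nbhs (x : subspace U) K by exact: h.
by apply: filterS h' => y Ky _.
Qed.

(** The open set [E] records more than vanishing off [W]: the bump vanishes near each point of [U]
    outside [W], so that its support within [U] stays in [W]. *)
Lemma bump_function (U W : set G) (x : G) : open U -> hausdorff_subspace U ->
  open W -> W `<=` U -> W x ->
  exists (b : G -> R) (E : set G),
    [/\ forall y, U y -> cts_at b y, b x = 1, forall y, 0 <= b y,
        open E & (forall y, U y -> E y \/ W y) /\ forall y, E y -> b y = 0].
Proof.
move=> oU hU oW WU Wx.
have cr := @locally_compact_completely_regular (subspace U) R
  (subspace_locally_compact oU hU) hU.
have clW : closed (~` W : set (subspace U)).
  by apply: open_closedC; exact: open_subspaceW.
have /(_ (fun h => h Wx))/uniform_separatorP := cr x (~` W) clW.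
move=> /(_ R)[f [cf f01 fx fW]].
have cfU : {within U, continuous (f : G -> R)} by [].
have cfy y : U y -> cts_at (f : G -> R) y by move=> Uy; exact: within_cts_at cfU.
have fx0 : f x = 0 by apply: fx; exists x.
(* The separating function [f] is 0 at [x] and 1 off [W], so this truncation vanishes on the open
   set [f > 1/2], which contains the points of [U] outside [W]. *)
exists (fun y => Num.max 0 (1 - 2 * f y)), (U `&` [set y | 1 / 2 < f y]); split.
- move=> y Uy; apply: (@continuous_max R G (fun=> 0) (fun y => 1 - 2 * f y)).
    exact: cts_at_cst.
  apply: (@cvgB _ R^o _ _ _ (fun=> 1) (fun y => 2 * f y)); first exact: cvg_cst.
  apply: (@cvgM R _ _ _ (fun=> 2) f); first exact: cvg_cst.
  exact: cfy.
- by rewrite fx0 mulr0 subr0 max_r.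
- by move=> y; rewrite le_max lexx.
- rewrite openE => y [Uy fy]; apply: filterI; first exact: open_nbhs_nbhs.
  exact: cfy Uy [set t | 1 / 2 < t] (open_nbhs_nbhs (conj (@open_gt R _) fy)).
- split=> [y Uy|y [_ /= fy]]; last by rewrite max_l//; lra.
  have [Wy|nWy] := pselect (W y); [by right|left; split=> //=].
  have -> : f y = 1 by exact: fW (f y) (ex_intro2 _ _ y nWy erefl).
  by lra.
Qed.

End Bump.

(** * Continuity in the Fell line bundle *)

Section SectionTopology.
Variables (R : realType) (G : topGroupoid) (S : twist R G).
Local Notation pr := (@twist_proj R G S).
Local Notation L := (@fell_bundle R G S).
Local Notation cls := (@fell_class R G S).
Local Notation C := (R[i]^o).
Implicit Types f : G -> L.

Lemma cls_cts_at (X : topologicalType) (a : X -> S) (c : X -> C) x :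
  cts_at a x -> cts_at c x -> cts_at (fun y => cls (a y) (c y)) x.
Proof.
move=> ca cc; apply: (cts_at_comp (cts_at_pair ca cc)).
by apply: continuous_cts_at; exact: pi_continuous.
Qed.

Lemma mulC_cts_at (X : topologicalType) (c d : X -> C) x :
  cts_at c x -> cts_at d x -> cts_at (fun y => c y * d y : C) x.
Proof.
move=> cc cd; apply: (cts_at_comp (cts_at_pair cc cd)
  (g := fun z : C * C => z.1 * z.2 : C)).
by apply: continuous_cts_at; exact: (@mul_continuous R[i]).
Qed.

Lemma quotient_nbhs (l : L) (B : set L) : open ((fun p : S * C => cls p.1 p.2) @^-1` B) ->
  B l -> nbhs l B.
Proof.
move=> oB Bl; apply: open_nbhs_nbhs; split=> //.
rewrite /open/= /quotient_open; move: oB; congr open.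
by apply/seteqP; split=> -[].
Qed.

(** A local trivialisation of the twist supplies a continuous frame [sg] and a continuous fibre
    coordinate [th]; the arbitrarily chosen lifts provide neither. *)
Lemma local_frame (g0 : G) : exists (U : set G) (sg : G -> S) (th : L -> C),
  [/\ open U, U g0, forall x, U x -> pr (sg x) = x /\ cts_at sg x &
    forall l, U (fell_base l) -> l = cls (sg (fell_base l)) (th l) /\ cts_at th l].
Proof.
have [U [h [k [[oU Ug0] ch ck hk kh]]]] := twist_locally_trivial S g0.
have c1 := @circle1 R.
have hpr x : U x -> pr (h (x, 1)) = x by move=> Ux; have [] := hk x 1 Ux c1.
have oprU : open (pr @^-1` U).
  by apply: open_comp => // a _; exact: Defs.proj_continuous.
have hact x w : U x -> circle R w -> h (x, w) = act w (h (x, 1)).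
  move=> Ux w1; have [_ _ /(_ w w1)] := hk x 1 Ux c1.
  by rewrite mulr1 /act hpr.
have kact a z : U (pr a) -> circle R z -> k (act z a) = z * k a.
  move=> Ua z1; have [k1 kE] := kh a Ua.
  have -> : act z a = h (pr a, z * k a).
    rewrite hact//; last exact: circleM.
    by rewrite -actM// -hact// kE.
  by have [] := hk (pr a) (z * k a) Ua (circleM z1 k1).
(* Defined on the canonical representative; in [thE] the circle factors cancel. *)
pose th (l : L) : C := k (repr l).1 * (repr l).2.
have thE a c : U (pr a) -> th (cls a c) = k a * c.
  move=> Ua; rewrite /th; have [z z1 -> /=] := repr_fell_class a c.
  rewrite kact//; transitivity ((z * z^*) * (k a * c)); first by ring.
  by rewrite circle_mulJ// mul1r.
exists U, (fun x => h (x, 1)), th; split=> // [x Ux|l].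
  split; first exact: hpr.
  apply: (cts_at_within_comp (f := fun y => (y, 1 : C)) _ ch).
    by apply: cts_at_pair; [exact: cts_at_id|exact: cts_at_cst].
  by apply: filterS (open_nbhs_nbhs (conj oU Ux)) => y Uy; split.
have [a [c ->]] := fell_classE l; rewrite fell_base_class => Ua.
split.
  have [k1 kE] := kh a Ua.
  by rewrite thE//= -fell_class_act// -hact// kE.
move=> A; rewrite nbhsE => -[V [oV Vl] VA].
(* Openness in the quotient is tested upstairs, where [th] becomes the product of [k] and the
   scalar. *)
have : nbhs (cls a c) [set l' | U (fell_base l') /\ V (th l')].
  apply: quotient_nbhs; last by rewrite /= fell_base_class.
  rewrite openE => -[b d] /=; rewrite fell_base_class => -[Ub Vb].
  have cmul : cts_at (fun p : S * C => k p.1 * p.2 : C) (b, d).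
    apply: mulC_cts_at; last by apply: continuous_cts_at => p; exact: cvg_snd.
    apply: (cts_at_comp (f := fst)); first by apply: continuous_cts_at => p; exact: cvg_fst.
    exact: within_cts_at ck.
  rewrite thE// in Vb.
  have n1 := cmul _ (open_nbhs_nbhs (conj oV Vb)).
  have n2 : nbhs (b, d) [set p : S * C | U (pr p.1)].
    have cf : cts_at (fun p : S * C => p.1) (b, d).
      by apply: continuous_cts_at => p; exact: cvg_fst.
    exact: cf _ (open_nbhs_nbhs (conj oprU Ub)).
  apply: filterS2 n1 n2 => -[b' d'] /= Vb' Ub'.
  by rewrite fell_base_class thE.
by move=> n; apply: filterS n => l' [_ /VA].
Qed.

Lemma section_frame f x : is_section f -> cts_at f x ->
  exists (a : G -> S) (c : G -> C), [/\ cts_at a x, cts_at c x &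
    nbhs x [set y | pr (a y) = y /\ f y = cls (a y) (c y)]].
Proof.
move=> fs cf; have [U [sg [th [oU Ux sgP thP]]]] := local_frame x.
exists sg, (th \o f); split.
- exact: (sgP x Ux).2.
- by apply: (cts_at_comp cf); apply: (thP _ _).2; rewrite fs.
- apply: filterS (open_nbhs_nbhs (conj oU Ux)) => y Uy; split; first exact: (sgP y Uy).1.
  by have [] := thP (f y); rewrite fs.
Qed.

Lemma fell_norm_cts (l : L) : cts_at (@fell_norm R G S) l.
Proof.
move=> A; rewrite nbhsE => -[V [oV Vl] VA].
have : nbhs l [set l' | V (fell_norm l')].
  apply: quotient_nbhs => //.
  rewrite (_ : _ @^-1` _ = (fun p : S * C => rnorm (p.2 : R[i])) @^-1` V); last first.
    by apply/seteqP; split=> -[a c] /=; rewrite fell_norm_class.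
  apply: open_comp => // -[a c] _ B /= [e /= e0 eB].
  have : nbhs c [set d : C | rnorm (c - d) < e] by apply/nbhs_rnorm; exists e.
  have cs : cts_at (fun p : S * C => p.2) (a, c).
    by apply: continuous_cts_at => p; exact: cvg_snd.
  move=> /cs h; apply: filterS h => -[b d] /= cd; apply: eB.
  apply: le_lt_trans cd.
  have := rnorm_leD (c : R[i]) d; have := rnorm_leD (d : R[i]) c.
  by rewrite (rnormB (d : R[i])) ler_norml => h1 h2; apply/andP; split; lra.
by move=> h; apply: filterS h => l' /VA.
Qed.

Lemma fell_scale_class g c a d : pr a = g -> fell_scale g c (cls a d) = cls a (c * d).
Proof.
move=> ag; have [z z1 zE] : exists2 z, circle R z & a = act z (twist_lift S g).
  by apply: same_proj_act; rewrite proj_lift.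
rewrite /fell_scale zE !fell_class_act// fell_coord_class.
by rewrite mulrCA.
Qed.

Lemma fell_scale_cts f (c : G -> C) x : is_section f -> cts_at f x -> cts_at c x ->
  cts_at (fun y => fell_scale y (c y) (f y)) x.
Proof.
move=> fs cf cc; have [a [d [ca cd n]]] := section_frame fs cf.
apply: (@cts_at_near _ _ _ (fun y => cls (a y) (c y * d y))).
  by apply: filterS n => y [ay fy]; rewrite /= fy fell_scale_class.
exact: cls_cts_at ca (mulC_cts_at cc cd).
Qed.

Lemma fell_mul_cts f1 f2 (al be : G -> G) x : is_section f1 -> is_section f2 ->
  cts_at al x -> cts_at be x -> cts_at f1 (al x) -> cts_at f2 (be x) ->
  nbhs x [set y | src (al y) = rng (be y)] ->
  cts_at (fun y => fell_mul (f1 (al y)) (f2 (be y))) x.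
Proof.
move=> s1 s2 cal cbe c1 c2 n.
have [a1 [d1 [ca1 cd1 n1]]] := section_frame s1 c1.
have [a2 [d2 [ca2 cd2 n2]]] := section_frame s2 c2.
have N1 := cal _ n1; have N2 := cbe _ n2.
have comp : nbhs x [set y | src (a1 (al y)) = rng (a2 (be y))].
  apply: filterS (filterI n (filterI N1 N2)) => y [/= yn [[p1 _] [p2 _]]].
  by apply: composable_proj; rewrite p1 p2.
apply: (@cts_at_near _ _ _ (fun y =>
    cls (mul (a1 (al y)) (a2 (be y))) (d1 (al y) * d2 (be y)))).
  apply: filterS (filterI comp (filterI N1 N2)) => y [/= yn [[p1 e1] [p2 e2]]].
  by rewrite e1 e2 fell_mul_class.
apply: cls_cts_at; last by apply: mulC_cts_at; [exact: (cts_at_comp cal)|exact: (cts_at_comp cbe)].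
apply: mul_cts_at => //; [exact: (cts_at_comp cal)|exact: (cts_at_comp cbe)].
Qed.

End SectionTopology.

Lemma compact_finite_cover (X : topologicalType) (K : set X) (V : X -> set X) :
  compact K -> (forall x, K x -> open (V x) /\ V x x) ->
  exists D : {fset X}, (forall x, x \in D -> K x) /\
    forall y, K y -> exists2 x, x \in D & V x y.
Proof.
move=> /compact_near_coveringP cK VP.
(* Eventual truth along the finite subsets of [K] ordered by inclusion. *)
pose F : set_system {fset X} := [set P | exists2 D0 : {fset X}, forall x, x \in D0 -> K x &
  forall D : {fset X}, (D0 `<=` D)%fset -> (forall x, x \in D -> K x) -> P D].
have FF : Filter F.
  split=> [|P Q [D1 K1 h1] [D2 K2 h2]|P Q PQ [D1 K1 h1]].
  - by exists fset0.
  - exists (D1 `|` D2)%fset => [x|D]; first by rewrite inE => /orP[/K1|/K2].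
    by rewrite fsubUset => /andP[D1D D2D] DK; split; [exact: h1|exact: h2].
  - by exists D1 => // D D1D DK; apply: PQ; exact: h1.
have [|D0 D0K h] := cK _ F (fun D y => exists2 x, x \in D & V x y) FF.
  move=> x Kx; have [oV Vx] := VP x Kx.
  exists (V x, [set D : {fset X} | x \in D]) => [|[y D] /= [Vy xD]]; last by exists x.
  split; first exact: open_nbhs_nbhs.
  exists [fset x]%fset => [z|D]; first by rewrite inE => /eqP ->.
  by rewrite fsub1set.
exists D0; split=> // y; exact: h.
Qed.

(** * Partitions of unity and convolutions of bisection sections *)

Section BisectionSections.
Variables (R : realType) (G : topGroupoid) (S : twist R G).
Hypothesis G_locally_compact : locally_compact_subspace [set: G].
Hypothesis G_etale : etale G.
Hypothesis G0_hausdorff : hausdorff_subspace (units G).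
Local Notation L := (@fell_bundle R G S).
Local Notation C := (R[i]^o).
Implicit Types f : G -> L.

Definition support_in (U : set G) f : set G :=
  closure [set g | U g /\ f g <> fell_zero S g] `&` U.

Definition bisection_section f : Prop := is_section f /\ exists U,
  [/\ bisection U, {within U, continuous f}, compact (support_in U f) &
   forall g, ~ U g -> f g = fell_zero S g].

Inductive bisection_span : (G -> L) -> Prop :=
| bisection_span_zero : bisection_span (fell_zero S)
| bisection_span_elementary f : bisection_section f -> bisection_span f
| bisection_span_add f1 f2 : bisection_span f1 -> bisection_span f2 ->
    bisection_span (section_add f1 f2)
| bisection_span_scale c f : bisection_span f -> bisection_span (section_scale c f).

Lemma section_coord_neq0 f g : is_section f -> f g <> fell_zero S g ->
  section_coord f g <> 0.
Proof. by move=> fs fg f0; apply: fg; apply: fell_coord_eq0. Qed.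

Lemma section_coord_zero f g : f g = fell_zero S g -> section_coord f g = 0.
Proof. by rewrite /section_coord => ->; exact: fell_coord_zero. Qed.

(** A partition of unity: finitely many bumps, each confined to a bisection inside the Hausdorff
    [U], are such that at every point of the support one exceeds [1/2]; normalised, they cut [f]
    into bisection sections. *)
Lemma elementary_bisection_span f : elementary_section f -> bisection_span f.
Proof.
move=> [fs [U [oU hU cf cK f0]]]; pose K := support_in U f.
have cfU y : U y -> cts_at f y by move=> Uy; exact: within_cts_at cf.
(* Stated for every [x], with dummy values off [K], so that choice yields total functions. *)
have bex x : exists (W : set G) (bE : (G -> R) * set G), K x ->
    [/\ bisection W /\ W `<=` U, forall y, U y -> cts_at bE.1 y, bE.1 x = 1,
        forall y, 0 <= bE.1 y &
        open bE.2 /\ (forall y, U y -> bE.2 y \/ W y) /\ forall y, bE.2 y -> bE.1 y = 0].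
  have [[_ Ux]|nKx] := pselect (K x); last by exists set0, ((fun=> 0), set0).
  have [W0 [oW0 iW0 jW0] W0x] := bisection_exists G_etale x.
  have [b [E [cb bx b0 oE [EW Eb]]]] := @bump_function R G G_locally_compact
    U (W0 `&` U) x oU hU (openI oW0 oU) (@subIsetr _ _ _) (conj W0x Ux).
  exists (W0 `&` U), (b, E) => _; split=> //=; split=> //; split.
  - exact: openI.
  - by move=> y z /set_mem[Wy _] /set_mem[Wz _]; apply: iW0; exact: mem_set.
  - by move=> y z /set_mem[Wy _] /set_mem[Wz _]; apply: jW0; exact: mem_set.
have [W /choice[bE bP]] := choice bex.
pose b x := (bE x).1; pose E x := (bE x).2.
pose V x := U `&` [set y | 1 / 2 < b x y].
have oV x : K x -> open (V x).
  move=> /bP[_ cb _ _ _]; rewrite openE => y [Uy by_]; apply: filterI; first exact: open_nbhs_nbhs.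
  exact: cb Uy [set t | 1 / 2 < t] (open_nbhs_nbhs (conj (@open_gt R _) by_)).
have [D [DK KD]] : exists D : {fset G}, (forall x, x \in D -> K x) /\
    forall y, K y -> exists2 x, x \in D & V x y.
  apply: compact_finite_cover => // x Kx; split; first exact: oV.
  split; first by case: Kx.
  by have [_ _ bx _ _] := bP x Kx; rewrite /= /b bx; lra.
pose s y := \sum_(x <- D) b x y.
have bge0 x y : x \in D -> 0 <= b x y by move=> /DK/bP[_ _ _ h _]; exact: h.
have sK y : K y -> 1 / 2 <= s y.
  move=> /KD[x /= xD [_ /= /ltW bxy]]; apply: le_trans bxy _.
  rewrite /s (bigD1_seq x)//= lerDl big_seq_cond sumr_ge0// => z /andP[zD _].
  exact: bge0.
(* The maximum keeps the denominator positive everywhere and continuous on [U], and equals the sum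
   on [K], where the sum is at least [1/2]. *)
pose m y := Num.max (s y) (1 / 2).
have m0 y : 0 < m y by rewrite lt_max; apply/orP; right; lra.
pose chi x y : C := (b x y / m y)%:C%C.
pose F x := fun y => fell_scale y (chi x y) (f y).
have FE x y : section_coord (F x) y = chi x y * section_coord f y.
  exact: fell_coord_class.
have Fs x : is_section (F x) by exact: (is_section_class S (fun y => chi x y * fell_coord y (f y))).
have bF x : x \in D -> bisection_section (F x).
  move=> xD; have [[bW WU] cb _ _ [oE [EW Eb]]] := bP x (DK x xD).
  have [oW _ _] := bW.
  have F0 y : b x y = 0 -> F x y = fell_zero S y.
    by move=> b0; apply: fell_coord_eq0 (Fs x y) _; rewrite -/(section_coord _ _) FE /chi b0 mul0r mul0r.
  split=> //; exists (W x); split=> //.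
  - apply: cts_at_within => // y /WU Uy.
    apply: fell_scale_cts => //; first exact: cfU.
    have cs : cts_at (s : G -> R) y.
      rewrite /s; have : forall x, x \in (D : seq G) -> cts_at (b x) y.
        by move=> z /DK/bP[_ cz _ _ _]; exact: cz.
      elim: (D : seq G) => [|z r ih] cz.
        apply: (@cts_at_near _ _ _ (fun=> 0)); last exact: cts_at_cst.
        by apply: nearW => t; rewrite /= big_nil.
      apply: (@cts_at_near _ _ _ (fun t => b z t + \sum_(x <- r) b x t)).
        by apply: nearW => t; rewrite /= big_cons.
      apply: (@cvgD R R^o); first by apply: cz; rewrite inE eqxx.
      by apply: ih => t tr; apply: cz; rewrite inE tr orbT.
    have cm : cts_at (m : G -> R) y.
      by apply: (@continuous_max R G s (fun=> 1 / 2)) => //; exact: cts_at_cst.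
    have cbm : cts_at (fun t => b x t / m t : R) y.
      apply: (@cvgM R _ _ _ (b x) (fun t => (m t)^-1)); first exact: cb.
      by apply: (@cvgV R^o) => //; rewrite gt_eqF.
    move=> A /nbhs_rnorm[e e0 eA].
    have := cbm (ball (b x y / m y) e) (nbhsx_ballx _ _ e0).
    move=> n; apply: filterS n => t /= bt; apply: eA.
    by rewrite /chi -rmorphB rnorm_real; exact: bt.
  - rewrite /support_in; set Z := [set g | W x g /\ _].
    (* Compactness is inherited from [K]: removing the open [E x] and intersecting with a closed set
       leaves a closed part of it. *)
    rewrite (_ : closure Z `&` W x = (K `&` ~` E x) `&` closure Z).
      apply: compact_closedI (@closed_closure _ _).
      by apply: compact_closedI => //; exact: open_closedC.
    apply/seteqP; split=> [y [cZy Wy]|y [[[_ Uy] nEy] cZy]].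
      split=> //; split.
        split; last exact: WU.
        apply: closureS cZy => t [Wt Ft]; split; first exact: WU.
        move=> ft; apply: Ft; apply: fell_coord_eq0 (Fs x t) _.
        by rewrite -/(section_coord _ _) FE section_coord_zero// mulr0.
      move=> Ey; have [t [[Wt Ft] Et]] := cZy _ (open_nbhs_nbhs (conj oE Ey)).
      by apply: Ft; apply: F0; exact: Eb.
    by split=> //; have [] := EW y Uy.
  - move=> y nWy; have [Uy|nUy] := pselect (U y).
      by apply: F0; have [/Eb|] := EW y Uy.
    apply: fell_coord_eq0 (Fs x y) _.
    by rewrite -/(section_coord _ _) FE section_coord_zero ?mulr0// f0.
(* The multipliers add up to 1 wherever [f] is nonzero. *)
have -> : f = foldr (@section_add R G S) (fell_zero S) [seq F x | x <- D].
  apply: section_ext => // [|y].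
    by case: (enum_fset D) => [|x r] /=; [exact: is_section_zero|exact: is_section_add].
  have -> : section_coord (foldr (@section_add R G S) (fell_zero S) [seq F x | x <- D]) y =
      (\sum_(x <- D) chi x y) * section_coord f y.
    elim: (D : seq G) => [|x r ih] /=; first by rewrite big_nil mul0r section_coord_zero.
    by rewrite section_coord_add ih FE big_cons mulrDl.
  have [f0y|fy] := pselect (f y = fell_zero S y).
    by rewrite section_coord_zero// mulr0.
  have Uy : U y by apply: contrapT => /f0.
  have Ky : K y by split=> //; apply: subset_closure.
  rewrite /chi -rmorph_sum -mulr_suml -/(s y) /m max_l ?sK//.
  by rewrite divff ?rmorph1 ?mul1r// gt_eqF// (lt_le_trans _ (sK y Ky))//; lra.
have {}bF : forall x, x \in (D : seq G) -> bisection_section (F x) by exact: bF.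
elim: (D : seq G) bF => [|x r ih] bF /=; first exact: bisection_span_zero.
apply: bisection_span_add.
  by apply: bisection_span_elementary; apply: bF; rewrite inE eqxx.
by apply: ih => y yr; apply: bF; rewrite inE yr orbT.
Qed.

Lemma Cc_bisection_span f : Cc f -> bisection_span f.
Proof.
elim=> [|f' /elementary_bisection_span//|f1 f2 _ b1 _ b2|c f' _ b].
- exact: bisection_span_zero.
- exact: bisection_span_add.
- exact: bisection_span_scale.
Qed.

Lemma bisection_span_section f : bisection_span f -> is_section f.
Proof.
by case=> [|? []|? ? _ _|? ? _]//; [exact: is_section_zero|exact: is_section_add|exact: is_section_scale].
Qed.

Section ProductOfBisectionSections.
Variables (f1 f2 : G -> L) (U V : set G).
Hypotheses (f1s : is_section f1) (f2s : is_section f2).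
Hypotheses (bU : bisection U) (bV : bisection V).
Hypotheses (cf1 : {within U, continuous f1}) (cf2 : {within V, continuous f2}).
Hypotheses (cK1 : compact (support_in U f1)) (cK2 : compact (support_in V f2)).
Hypotheses (f10 : forall g, ~ U g -> f1 g = fell_zero S g)
  (f20 : forall g, ~ V g -> f2 g = fell_zero S g).

Let conv_term0 a b : src a = rng b -> ~ (U a /\ V b) ->
  fell_coord (mul a b) (fell_mul (f1 a) (f2 b)) = 0.
Proof.
move=> ab h; rewrite fell_coord_mul// -/(section_coord f1 a) -/(section_coord f2 b).
have [Ua|nUa] := pselect (U a); last by rewrite (section_coord_zero (f10 nUa)) mul0r mulr0.
rewrite [section_coord f2 b]section_coord_zero ?mulr0//.
by apply: f20 => Vb; apply: h.
Qed.

(** Injectivity of the source on [V], then on [U], leaves a single factorisation whose term can be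
    nonzero. *)
Lemma convolution_bisection a b : U a -> V b -> src a = rng b ->
  convolution f1 f2 (mul a b) = fell_mul (f1 a) (f2 b).
Proof.
move=> Ua Vb ab; have [_ iU _] := bU; have [_ iV _] := bV.
rewrite /convolution /fell_sum -(fsbig_widen [set (a, b)]).
- rewrite fsbig_set1 /= fell_coordK// fell_base_mul ?f1s ?f2s//.
- by move=> _ ->.
- move=> [a' b'] [/= [ab' E] ne]; rewrite /= -E; apply: conv_term0 => // -[Ua' Vb'].
  have bb' : b' = b.
    apply: iV; [exact: mem_set|exact: mem_set|].
    by rewrite -(src_mul ab') E src_mul.
  apply: ne; congr (_, _) => //; apply: iU; [exact: mem_set|exact: mem_set|].
  by rewrite ab' bb' ab.
Qed.

Lemma convolution_bisection0 g : ~ set_mul U V g ->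
  convolution f1 f2 g = fell_zero S g.
Proof.
move=> nW; rewrite /convolution /fell_sum fsbig1// => -[a b] /= [ab E].
rewrite -E; apply: conv_term0 => // -[Ua Vb]; apply: nW.
by exists a, b; split.
Qed.

Lemma convolution_elementary : elementary_section (convolution f1 f2).
Proof.
have [oU iU _] := bU; have [oV iV _] := bV.
pose W := set_mul U V.
have oW : open W by exact: set_mul_open.
have hW : hausdorff_subspace W.
  by apply: src_inj_hausdorff => //; exact: set_mul_src_inj.
split; first exact: is_section_convolution.
exists W; split=> //; last exact: convolution_bisection0.
- apply: cts_at_within => // g [a [b [Ua Vb ab gE]]].
  have bg : src b = src g by rewrite gE src_mul.
  have bE := src_lift_in_eq iV Vb bg.
  have aE : mul g (inv (src_lift_in V g)) = a by rewrite bE gE mulK_inv.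
  (* Near [g] the convolution is the product of the values at the two factors, which depend
     continuously on the arrow. *)
  apply: (@cts_at_near _ _ _ (fun g' => fell_mul
      (f1 (mul g' (inv (src_lift_in V g')))) (f2 (src_lift_in V g')))).
    have Wg : W g by exists a, b.
    apply: filterS (open_nbhs_nbhs (conj oW Wg)) => g' [a' [b' [Ua' Vb' ab' g'E]]] /=.
    have bg' : src b' = src g' by rewrite g'E src_mul.
    by rewrite (src_lift_in_eq iV Vb' bg') g'E mulK_inv// convolution_bisection.
  apply: fell_mul_cts => //.
  + exact: factor_cts Vb bg.
  + exact: src_lift_in_cts Vb bg.
  + by rewrite aE; exact: within_cts_at cf1.
  + by rewrite bE; exact: within_cts_at cf2.
  + apply: filterS (src_lift_in_near G_etale oV Vb bg) => g' /= [b' Vb' b'g'].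
    by rewrite src_div// (src_lift_inP Vb' b'g').2.
- pose P := (support_in U f1 `*` support_in V f2) `&`
    [set p : G * G | src p.1 = rng p.2].
  (* Composability is a closed condition because the unit space is Hausdorff. *)
  have clP : closed [set p : G * G | src p.1 = rng p.2].
    rewrite -openC openE => -[a b] /= ab.
    have [||A [B [oA oB Aa Bb AB]]] := @units_separated G G0_hausdorff (src a) (rng b) _ _ ab.
    - exact: src_src.
    - exact: src_rng.
    have nA : nbhs a (@src G @^-1` A).
      exact: (src_continuous G_etale (open_nbhs_nbhs (conj oA Aa))).
    have nB : nbhs b (@rng G @^-1` B).
      exact: (rng_continuous G_etale (open_nbhs_nbhs (conj oB Bb))).
    exists (@src G @^-1` A, @rng G @^-1` B) => // -[a' b'] /= [Aa' Bb'] ab'.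
    have : (A `&` B `&` units G) (src a').
      by split; [split=> //; rewrite ab'|exact: src_src].
    by rewrite AB.
  have cP : compact P by apply: compact_closedI => //; exact: compact_setX.
  pose Q := (fun p : G * G => mul p.1 p.2) @` P.
  have cQ : compact Q.
    apply: continuous_compact => //; apply: continuous_subspaceW (@Defs.mul_continuous G).
    by move=> p [].
  have QW : Q `<=` W.
    by move=> _ [[a b] [[[_ Ua] [_ Vb]] /= ab] <-]; exists a, b; split.
  have QI : Q `&` W = Q by exact/setIidl.
  have cQW : compact (Q : set (subspace W)).
    by rewrite -QI; apply/compact_subspaceIP; rewrite QI.
  (* The compact [Q] is relatively closed in the Hausdorff [W] and contains the nonvanishing set, so
     the support within [W] stays in [Q]. *)
  have /closed_subspaceP[D clD DQ] := compact_closed hW cQW.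
  set Z := [set g | W g /\ _].
  have ZQ : Z `<=` Q.
    move=> g [[a [b [Ua Vb ab gE]]]]; rewrite gE convolution_bisection// => ne.
    exists (a, b) => //; split=> //=.
    have n12 : section_coord f1 a <> 0 /\ section_coord f2 b <> 0.
      split=> z0; apply: ne; apply: fell_coord_eq0; rewrite ?fell_base_mul ?f1s ?f2s//;
        rewrite fell_coord_mul// -/(section_coord f1 a) -/(section_coord f2 b) z0;
        by rewrite ?mul0r ?mulr0.
    split; split=> //; apply: subset_closure; split=> // e0; [apply: n12.1|apply: n12.2];
      exact: section_coord_zero.
  rewrite (_ : closure Z `&` W = Q `&` closure Z).
    exact: compact_closedI (@closed_closure _ _).
  apply/seteqP; split=> [y [cZy Wy]|y [Qy cZy]]; last by split=> //; exact: QW.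
  split=> //; rewrite -QI -DQ; split=> //.
  move/closure_id : (clD) => ->; apply: closureS cZy => t /ZQ Qt.
  have : (Q `&` W) t by split=> //; exact: QW.
  by rewrite -DQ => -[].
Qed.

End ProductOfBisectionSections.

Lemma bisection_section_convolution f1 f2 :
  bisection_section f1 -> bisection_section f2 -> Cc (convolution f1 f2).
Proof.
move=> [s1 [U [bU cU kU zU]]] [s2 [V [bV cV kV zV]]].
by apply: Cc_elementary; exact: (convolution_elementary s1 s2 bU bV).
Qed.

End BisectionSections.

(** * Finite rows and columns, and bilinearity of the convolution *)

Section BisectionMatrices.
Variables (R : realType) (G : topGroupoid) (S : twist R G).
Hypothesis G_locally_compact : locally_compact_subspace [set: G].
Hypothesis G_etale : etale G.
Hypothesis G0_hausdorff : hausdorff_subspace (units G).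
Local Notation L := (@fell_bundle R G S).
Local Notation cls := (@fell_class R G S).
Local Notation C := (R[i]^o).
Implicit Types f : G -> L.

Lemma rep_matrix_neq0 f g h : is_section f -> rep_matrix f g h <> 0 ->
  src g = src h /\ f (mul g (inv h)) <> fell_zero S (mul g (inv h)).
Proof.
move=> fs M0; have gh : src g = src h.
  by apply: contrapT => gh; apply: M0; exact: rep_matrix_neq.
split=> // f0; apply: M0.
by rewrite rep_matrixE// section_coord_zero// mulr0.
Qed.

(** The arrows [g h^-1] share their source along a column and their range along a row; both maps are
    injective on [U], which leaves one entry. *)
Lemma bisection_section_matrix_inj f : bisection_section f ->
  (forall g g' h, rep_matrix f g h <> 0 -> rep_matrix f g' h <> 0 -> g = g') /\
  (forall g h h', rep_matrix f g h <> 0 -> rep_matrix f g h' <> 0 -> h = h').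
Proof.
move=> [fs [U [[oU iU jU] _ _ f0]]].
have inU g h : rep_matrix f g h <> 0 -> src g = src h /\ U (mul g (inv h)).
  move=> /(rep_matrix_neq0 fs)[gh fgh]; split=> //.
  by apply: contrapT => /f0.
split=> [g g' h /inU[gh Ugh] /inU[g'h Ug'h]|g h h' /inU[gh Ugh] /inU[gh' Ugh']].
- rewrite -(mul_invK gh) -(mul_invK g'h); congr (mul _ _).
  by apply: iU; [exact: mem_set|exact: mem_set|rewrite !src_div].
- have E : mul g (inv h) = mul g (inv h').
    by apply: jU; [exact: mem_set|exact: mem_set|rewrite !rng_div].
  have := congr1 (fun x => mul (inv g) x) E.
  rewrite !mulI_inv ?rng_inv// => /(congr1 (@Defs.inv G)).
  by rewrite !invK.
Qed.

Definition finite_columns (M : G -> G -> R[i]) (k : nat) : Prop :=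
  forall h, exists2 F : {fset G}, (#|` F| <= k)%N & forall g, g \notin F -> M g h = 0.

Definition finite_rows (M : G -> G -> R[i]) (k : nat) : Prop :=
  forall g, exists2 F : {fset G}, (#|` F| <= k)%N & forall h, h \notin F -> M g h = 0.

Lemma finite_columns_inj M : (forall g g' h, M g h <> 0 -> M g' h <> 0 -> g = g') ->
  finite_columns M 1.
Proof.
move=> Mi h; have [[g Mg]|/forallNP M0] := pselect (exists g, M g h <> 0).
  exists [fset g]%fset; first by rewrite cardfs1.
  move=> g' g'g; apply: contrapT => Mg'; move/negP: g'g; apply.
  by rewrite inE (Mi g' g h).
by exists fset0 => // g _; apply: contrapT => Mg; exact: (M0 g).
Qed.

Lemma finite_columns_add M N P k l : finite_columns M k -> finite_columns N l ->
  (forall g h, M g h = 0 -> N g h = 0 -> P g h = 0) -> finite_columns P (k + l).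
Proof.
move=> Mk Nl MNP h; have [F1 c1 h1] := Mk h; have [F2 c2 h2] := Nl h.
exists (F1 `|` F2)%fset => [|g].
  by rewrite (leq_trans (leq_card_fsetU _ _))// leq_add.
by rewrite inE negb_or => /andP[/h1 ? /h2 ?]; exact: MNP.
Qed.

Lemma finite_rows_columns M k : finite_rows M k <-> finite_columns (fun g h => M h g) k.
Proof. by []. Qed.

Lemma bisection_span_finite f : bisection_span f ->
  exists k, finite_columns (rep_matrix f) k /\ finite_rows (rep_matrix f) k.
Proof.
elim=> [|f' bf|f1 f2 b1 [k [ck rk]] b2 [l [cl rl]]|c f' bf [k [ck rk]]].
- exists 0%N; split=> h; exists fset0 => // g _.
    by apply: contrapT => /(rep_matrix_neq0 (is_section_zero S))[].
  by apply: contrapT => /(rep_matrix_neq0 (is_section_zero S))[].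
- have [ci ri] := bisection_section_matrix_inj bf.
  exists 1%N; split; first exact: finite_columns_inj.
  apply/finite_rows_columns; apply: finite_columns_inj => g g' h.
  exact: ri.
- have s1 := bisection_span_section b1; have s2 := bisection_span_section b2.
  exists (k + l)%N; split.
    by apply: finite_columns_add ck cl _ => g h; rewrite rep_matrix_add// => -> ->; rewrite addr0.
  apply/finite_rows_columns; apply: (finite_columns_add rk rl) => g h.
  by rewrite rep_matrix_add// => -> ->; rewrite addr0.
- have fs := bisection_span_section bf.
  exists k; split=> h; [have [F cF hF] := ck h|have [F cF hF] := rk h];
    by exists F => // g /hF; rewrite rep_matrix_scale// => ->; rewrite mulr0.
Qed.

Lemma fell_norm_zero g : fell_norm (fell_zero S g) = 0.
Proof. by rewrite fell_norm_class rnorm0. Qed.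

Lemma bisection_section_bounded f : bisection_section f ->
  exists B : R, forall g, fell_norm (f g) <= B.
Proof.
move=> [fs [U [[oU iU jU] cf cK f0]]].
have cn : {within support_in U f, continuous (fun g => fell_norm (f g) : R)}.
  apply: (@continuous_subspaceW _ _ _ U); first by move=> g [].
  apply: cts_at_within => // g Ug.
  by apply: (cts_at_comp (within_cts_at oU Ug cf)); exact: fell_norm_cts.
have := continuous_compact cn cK.
move=> /compact_bounded[M [_ HM]]; exists (`|M| + 1) => g.
have [fg0|fg] := pselect (f g = fell_zero S g).
  by rewrite fg0 fell_norm_zero addr_ge0.
have Ug : U g by apply: contrapT => /f0.
apply: le_trans (ler_norm _) _; apply: HM.
  by rewrite (le_lt_trans (ler_norm M))// ltrDl.
by exists g => //; split=> //; exact: subset_closure.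
Qed.

(** The entry at [(g, src g)] is the coordinate of [f g] up to a circle factor. Identities between
    sections thus reduce to identities between matrices. *)
Lemma section_matrix_ext f f' : is_section f -> is_section f' ->
  (forall g h, rep_matrix f g h = rep_matrix f' g h) -> f = f'.
Proof.
move=> s s' E; apply: section_ext => // g.
have gs : src g = src (src g) by rewrite src_src.
have gg : mul g (inv (src g)) = g.
  by have := mulK_inv (esym (rng_src g)); rewrite mul_src.
have := E g (src g); rewrite !rep_matrixE// gg.
have gr : src g = rng (src g) by rewrite rng_src.
have [k1 _] := lift_cocycle_act S gr.
exact: (mulfI (circle_neq0 k1)).
Qed.

Lemma rep_matrix_convolution_fset f1 f2 g h (F : {fset G}) :
  is_section f1 -> is_section f2 -> (forall k, k \notin F -> rep_matrix f2 k h = 0) ->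
  rep_matrix (convolution f1 f2) g h =
  \sum_(k <- F) rep_matrix f1 g k * rep_matrix f2 k h.
Proof.
move=> s1 s2 F0; rewrite rep_matrix_convolution//; apply: fsbigTE => k /F0 ->.
by rewrite mulr0.
Qed.

Lemma rep_matrix_zero g h : rep_matrix (fell_zero S) g h = 0.
Proof. by apply: contrapT => /(rep_matrix_neq0 (is_section_zero S))[]. Qed.

Lemma convolution0l f2 k : is_section f2 -> finite_columns (rep_matrix f2) k ->
  convolution (fell_zero S) f2 = fell_zero S.
Proof.
move=> s2 c2; have s0 := is_section_zero S.
apply: section_matrix_ext => // [|g h]; first exact: is_section_convolution.
have [F _ F0] := c2 h; rewrite (rep_matrix_convolution_fset g s0 s2 F0) rep_matrix_zero.
by rewrite big1// => x _; rewrite rep_matrix_zero mul0r.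
Qed.

(** A sum over a set takes a default value when infinitely many terms are nonzero; finite columns
    confine all the sums to a common finite set, where additivity holds. *)
Lemma convolutionDl f1 f1' f2 k : is_section f1 -> is_section f1' -> is_section f2 ->
  finite_columns (rep_matrix f2) k ->
  convolution (section_add f1 f1') f2 =
  section_add (convolution f1 f2) (convolution f1' f2).
Proof.
move=> s1 s1' s2 c2; have sc f := @is_section_convolution R G S f f2.
have sa f f' := @is_section_add R G S f f'.
apply: section_matrix_ext => // g h; have [F _ F0] := c2 h.
rewrite rep_matrix_add// !(rep_matrix_convolution_fset g _ s2 F0)// -big_split.
by apply: eq_bigr => x _; rewrite rep_matrix_add// mulrDl.
Qed.

Lemma convolutionZl c f1 f2 k : is_section f1 -> is_section f2 ->
  finite_columns (rep_matrix f2) k ->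
  convolution (section_scale c f1) f2 = section_scale c (convolution f1 f2).
Proof.
move=> s1 s2 c2; have sc f := @is_section_convolution R G S f f2.
have ss f := @is_section_scale R G S c f.
apply: section_matrix_ext => // g h; have [F _ F0] := c2 h.
rewrite rep_matrix_scale// !(rep_matrix_convolution_fset g _ s2 F0)// mulr_sumr.
by apply: eq_bigr => x _; rewrite rep_matrix_scale// mulrA.
Qed.

Lemma convolution0r f1 : is_section f1 -> convolution f1 (fell_zero S) = fell_zero S.
Proof.
move=> s1; have s0 := is_section_zero S.
apply: section_matrix_ext => // [|g h]; first exact: is_section_convolution.
rewrite (@rep_matrix_convolution_fset f1 (fell_zero S) g h fset0)// => [|x _].
  by rewrite big_seq_fset0 rep_matrix_zero.
exact: rep_matrix_zero.
Qed.

Lemma convolutionDr f1 f2 f2' k l : is_section f1 -> is_section f2 -> is_section f2' ->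
  finite_columns (rep_matrix f2) k -> finite_columns (rep_matrix f2') l ->
  convolution f1 (section_add f2 f2') =
  section_add (convolution f1 f2) (convolution f1 f2').
Proof.
move=> s1 s2 s2' c2 c2'; have sc f f' := @is_section_convolution R G S f f'.
have sa f f' := @is_section_add R G S f f'.
apply: section_matrix_ext => // g h; have [F _ F0] := c2 h; have [F' _ F0'] := c2' h.
have U0 x : x \notin (F `|` F')%fset -> rep_matrix f2 x h = 0.
  by rewrite inE negb_or => /andP[/F0].
have U0' x : x \notin (F `|` F')%fset -> rep_matrix f2' x h = 0.
  by rewrite inE negb_or => /andP[_ /F0'].
rewrite rep_matrix_add// (rep_matrix_convolution_fset g s1 s2 U0).
rewrite (rep_matrix_convolution_fset g s1 s2' U0').
rewrite (@rep_matrix_convolution_fset _ _ _ _ (F `|` F')%fset)// => [|x xF].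
  by rewrite -big_split; apply: eq_bigr => x _; rewrite rep_matrix_add// mulrDr.
by rewrite rep_matrix_add// U0// U0'// addr0.
Qed.

Lemma convolutionZr c f1 f2 k : is_section f1 -> is_section f2 ->
  finite_columns (rep_matrix f2) k ->
  convolution f1 (section_scale c f2) = section_scale c (convolution f1 f2).
Proof.
move=> s1 s2 c2; have sc f f' := @is_section_convolution R G S f f'.
have ss f := @is_section_scale R G S c f.
apply: section_matrix_ext => // g h; have [F _ F0] := c2 h.
rewrite rep_matrix_scale// (rep_matrix_convolution_fset g s1 s2 F0) mulr_sumr.
rewrite (@rep_matrix_convolution_fset _ _ _ _ F)// => [|x xF].
  by apply: eq_bigr => x _; rewrite rep_matrix_scale// mulrCA.
by rewrite rep_matrix_scale// F0// mulr0.
Qed.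

Lemma bisection_span_convolution f1 f2 : bisection_span f1 -> bisection_span f2 ->
  Cc (convolution f1 f2).
Proof.
move=> b1 b2; have [k2 [c2 _]] := bisection_span_finite b2.
have s2 := bisection_span_section b2.
elim: b1 => [|f bf|f f' bf cf bf' cf'|c f bf cf].
- by rewrite (convolution0l s2 c2); exact: Cc_zero.
- have s1 : is_section f by case: bf.
  elim: b2 {c2 s2} => [|f' bf'|f3 f4 b3 ih3 b4 ih4|c f3 b3 ih3].
  + by rewrite convolution0r//; exact: Cc_zero.
  + exact: bisection_section_convolution.
  + have [k [c3 _]] := bisection_span_finite b3.
    have [l [c4 _]] := bisection_span_finite b4.
    rewrite (convolutionDr s1 (bisection_span_section b3) (bisection_span_section b4) c3 c4).
    exact: Cc_add.
  + have [k [c3 _]] := bisection_span_finite b3.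
    rewrite (convolutionZr c s1 (bisection_span_section b3) c3).
    exact: Cc_scale.
- rewrite (convolutionDl (bisection_span_section bf) (bisection_span_section bf') s2 c2).
  exact: Cc_add.
- rewrite (convolutionZl c (bisection_span_section bf) s2 c2).
  exact: Cc_scale.
Qed.

Lemma Cc_convolution f1 f2 : Cc f1 -> Cc f2 -> Cc (convolution f1 f2).
Proof.
by move=> h1 h2; apply: bisection_span_convolution; exact: Cc_bisection_span.
Qed.

(** A bump at [g0] multiplies a local frame of the bundle; it is confined to the interior of a
    compact set, which makes the support compact. *)
Lemma Cc_nonzero (g0 : G) : exists f g, Cc f /\ f g <> fell_zero S g.
Proof.
have [U [sg [th [oU Ug0 sgP _]]]] := local_frame S g0.
have [V [oV iV _] Vg0] := bisection_exists G_etale g0.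
pose W := U `&` V; have oW : open W by exact: openI.
have iW : set_inj W (@src G).
  by move=> x y /set_mem[_ Vx] /set_mem[_ Vy]; apply: iV; exact: mem_set.
have hW := src_inj_hausdorff G_etale G0_hausdorff iW.
have Wg0 : W g0 by split.
have [K [KW cK nK]] := G_locally_compact I (open_nbhs_nbhs (conj oW Wg0)).
have nK' : nbhs g0 K.
  have n : nbhs g0 [set y | [set: G] y -> K y] := nK.
  by apply: filterS n => y /= h; apply: h.
have KiW : K° `<=` W by move=> y /interior_subset/KW[].
have [b [E [cb b1 _ oE [EW Eb]]]] := @bump_function R G G_locally_compact W K° g0
  oW hW (@open_interior _ K) KiW nK'.
pose f g := if `[< W g >] then cls (sg g) ((b g)%:C%C) else fell_zero S g.
have fW g : W g -> f g = cls (sg g) ((b g)%:C%C).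
  by move=> Wg; rewrite /f; case: asboolP.
have fs : is_section f.
  move=> g; rewrite /f; case: asboolP => [[Ug _]|_]; last exact: is_section_zero.
  by rewrite fell_base_class (sgP g Ug).1.
have f0 g : b g = 0 -> f g = fell_zero S g.
  move=> b0; rewrite /f; case: asboolP => // -[Ug _]; rewrite b0.
  have [z _ ->] := fell_class_lift 0 (sgP g Ug).1.
  by rewrite mulr0.
exists f, g0; split; last first.
  move=> /(congr1 (@fell_norm R G S)); rewrite fell_norm_zero fW// fell_norm_class b1.
  by rewrite rnorm1 => /eqP; rewrite oner_eq0.
apply: Cc_elementary; split=> //; exists W; split=> //.
- apply: cts_at_within => // g Wg.
  apply: (@cts_at_near _ _ _ (fun g => cls (sg g) ((b g)%:C%C : C))).
    by apply: filterS (open_nbhs_nbhs (conj oW Wg)) => y; exact: fW.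
  apply: cls_cts_at; first exact: (sgP g Wg.1).2.
  move=> A /nbhs_rnorm[e e0 eA].
  have n := cb g Wg (ball (b g) e) (nbhsx_ballx _ _ e0).
  apply: filterS n => t /= bt; apply: eA.
  by rewrite -rmorphB rnorm_real; exact: bt.
- set Z := [set g | W g /\ _].
  rewrite (_ : closure Z `&` W = (K `&` ~` E) `&` closure Z).
    apply: compact_closedI (@closed_closure _ _).
    by apply: compact_closedI => //; exact: open_closedC.
  apply/seteqP; split=> [y [cZy Wy]|y [[/KW[_ Wy] _] cZy]//].
  have nEy : ~ E y.
    move=> Ey; have [t [[Wt ft] Et]] := cZy _ (open_nbhs_nbhs (conj oE Ey)).
    by apply: ft; apply: f0; exact: Eb.
  split=> //; split=> //; apply: interior_subset.
  by have [] := EW y Wy.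
- by move=> g nWg; rewrite /f; case: asboolP.
Qed.

End BisectionMatrices.

(** * Operators given by matrices *)

Section MatrixOperators.
Variables (R : realType) (I : choiceType).
Local Notation K := (l2_hilbert R I).
Local Notation l2 := (@l2 R I).
Local Notation delta := (@delta R I).
Implicit Types (M N : I -> I -> R[i]) (T : bounded_op K).

Definition has_matrix T M : Prop := forall g h, (T (delta h) : l2) g = M g h.

Lemma inner_delta (x : K) i : inner x (delta i : K) = (x : l2) i.
Proof. exact: l2_inner_delta. Qed.

Lemma has_matrix_adjoint T M : has_matrix T M ->
  has_matrix (adjoint T) (fun g h => (M h g)^*).
Proof.
move=> TM g h; rewrite -inner_delta adjointP inner_conj inner_delta.
by rewrite TM.
Qed.

Lemma has_matrix_coord T M (x : K) g : has_matrix T M ->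
  (T x : l2) g = inner x (adjoint T (delta g)).
Proof. by move=> TM; rewrite -inner_delta adjointPr. Qed.

(** The coordinate of [T x] at [g] is the inner product of [x] with [adjoint T (delta g)], and the
    matrix determines the latter vector. *)
Lemma has_matrix_unique T T' M : has_matrix T M -> has_matrix T' M -> T = T'.
Proof.
move=> TM TM'; apply: bounded_op_inj => x; apply: l2_inj => g.
rewrite (has_matrix_coord x g TM) (has_matrix_coord x g TM'); congr (inner _ _).
apply: l2_inj => h.
by rewrite (has_matrix_adjoint TM) (has_matrix_adjoint TM').
Qed.

(** The row at [g] is the conjugate of [adjoint T (delta g)]; when it is finite the coordinate
    formula is exact for every vector, without a limit. *)
Lemma has_matrix_row T M (F : {fset I}) (x : K) g : has_matrix T M ->
  (forall h, h \notin F -> M g h = 0) ->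
  (T x : l2) g = \sum_(h <- F) M g h * (x : l2) h.
Proof.
move=> TM MF; rewrite (has_matrix_coord x g TM).
have -> : adjoint T (delta g) = truncate (adjoint T (delta g) : l2) F.
  apply/esym/truncate_supported => h hF.
  by rewrite (has_matrix_adjoint TM) MF// rmorph0.
rewrite inner_conj inner_suml rmorph_sum; apply: eq_bigr => h _.
transitivity (((M g h)^* * inner (delta h : K) x)^*).
  by rewrite -(has_matrix_adjoint TM); congr (_^*); exact: innerZl.
rewrite rmorphM/= conjCK; congr (_ * _).
by rewrite -(inner_delta x h) [RHS]inner_conj.
Qed.

Lemma has_matrix_column T M (F : {fset I}) (z : K) g : has_matrix T M ->
  supported (z : l2) F -> (T z : l2) g = \sum_(h <- F) M g h * (z : l2) h.
Proof.
move=> TM zF; rewrite -{1}(truncate_supported zF) linear_sum l2_sumE.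
by apply: eq_bigr => h _; rewrite linearZ l2ZE TM mulrC.
Qed.

Lemma has_matrix_add T T' M M' : has_matrix T M -> has_matrix T' M' ->
  has_matrix (T + T') (fun g h => M g h + M' g h).
Proof. by move=> TM TM' g h; rewrite bounded_opDE l2DE TM TM'. Qed.

Lemma has_matrix_scale c T M : has_matrix T M ->
  has_matrix (c *: T) (fun g h => c * M g h).
Proof. by move=> TM g h; rewrite bounded_opZE l2ZE TM. Qed.

Lemma has_matrix_comp T T' M M' (F : I -> {fset I}) :
  has_matrix T M -> has_matrix T' M' ->
  (forall h k, k \notin F h -> M' k h = 0) ->
  has_matrix (comp_op T T') (fun g h => \sum_(k <- F h) M g k * M' k h).
Proof.
move=> TM TM' F0 g h; rewrite /= (has_matrix_column (F := F h) _ TM).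
  by apply: eq_bigr => k _; rewrite TM'.
by move=> k /F0; rewrite TM'.
Qed.

Lemma has_matrix_sparse T M k : has_matrix T M ->
  (forall h, exists2 F : {fset I}, (#|` F| <= k)%N & forall g, g \notin F -> M g h = 0) ->
  column_sparse k T.
Proof.
move=> TM colM z F zF.
have [D [Dk D0]] : exists D : {fset I}, (#|` D| <= k * size (F : seq I))%N /\
    forall h g, h \in (F : seq I) -> g \notin D -> M g h = 0.
  elim: (F : seq I) => [|h r [D [Dk D0]]]; first by exists fset0; rewrite cardfs0.
  have [E Ek E0] := colM h; exists (E `|` D)%fset; split.
    by rewrite (leq_trans (leq_card_fsetU _ _))//= mulnS leq_add.
  move=> h' g; rewrite !inE negb_or => /orP[/eqP ->|h'r] /andP[gE gD]; first exact: E0.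
  exact: D0 gD.
exists D => // g gD; rewrite (has_matrix_column (F := F) _ TM)//.
by rewrite big_seq big1// => h hF; rewrite D0// mul0r.
Qed.

(** A weighted partial permutation: [r] gives the only column where a row can be nonzero and is
    injective on the nonzero rows, so the operator multiplies norms by at most [B]. *)
Lemma monomial_matrix_op M (B : R) : 0 <= B -> (forall g h, rnorm (M g h) <= B) ->
  (forall g g' h, M g h <> 0 -> M g' h <> 0 -> g = g') ->
  (forall g h h', M g h <> 0 -> M g h' <> 0 -> h = h') ->
  exists T, has_matrix T M.
Proof.
move=> B0 MB Mcol Mrow.
have rex g : exists h, forall h', M g h' <> 0 -> h' = h.
  have [[h Mh]|/forallNP M0] := pselect (exists h, M g h <> 0).
    by exists h => h' Mh'; exact: Mrow Mh' Mh.
  by exists g => h' Mh'; case: (M0 h').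
have [r rP] := choice rex.
pose f (x : l2) := fun g => M g (r g) * x (r g).
have fssq x F : ssq (f x) F <= B ^+ 2 * rnorm x ^+ 2.
  pose s := [seq g <- F | M g (r g) != 0].
  have -> : ssq (f x) F = \sum_(g <- s) rnorm (f x g) ^+ 2.
    rewrite /s big_filter /ssq [RHS]big_mkcond; apply: eq_bigr => g _.
    by case: eqP => //= M0; rewrite /f M0 mul0r rnorm0 expr0n.
  have us : uniq [seq r g | g <- s].
    rewrite map_inj_in_uniq ?filter_uniq// => g g'.
    rewrite !mem_filter => /andP[/eqP Mg _] /andP[/eqP Mg' _] rE.
    by apply: Mcol Mg _; rewrite rE.
  apply: (@le_trans _ _ (B ^+ 2 * \sum_(g <- s) rnorm (x (r g)) ^+ 2)).
    rewrite mulr_sumr; apply: ler_sum => g _; rewrite /f rnormM exprMn.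
    by rewrite ler_wpM2r ?sqr_ge0// ler_pXn2r ?nnegrE ?rnorm_ge0.
  rewrite ler_wpM2l ?sqr_ge0//.
  apply: le_trans (ssq_le_l2norm x [fset h in [seq r g | g <- s]]%fset).
  rewrite -(big_map r xpredT (fun h => rnorm (x h) ^+ 2)) /ssq le_eqVlt; apply/orP; left.
  apply/eqP; apply: perm_big; apply: uniq_perm => // h.
  by rewrite in_fset.
have fl2 x : is_l2 (f x) by apply/asboolP; exists (B ^+ 2 * rnorm x ^+ 2).
pose Tf (x : K) : K := L2 (fl2 x).
have lT : linear Tf.
  move=> a x y; apply: l2_inj => g.
  suff : M g (r g) * (a * (x : l2) (r g) + (y : l2) (r g)) =
    a * (M g (r g) * (x : l2) (r g)) + M g (r g) * (y : l2) (r g) by [].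
  by ring.
have CT x : rnorm (Tf x) <= B * rnorm x.
  by apply: l2norm_le => [|F]; [rewrite mulr_ge0 ?rnorm_ge0|rewrite exprMn; exact: fssq].
exists (mk_op lT CT) => g h; rewrite /= /f.
suff : M g (r g) * (r g == h)%:R = M g h by [].
have [->|rh] := eqVneq (r g) h; first by rewrite mulr1.
rewrite mulr0; apply: esym; apply: contrapT => Mh.
by move/eqP: rh; apply; rewrite (rP g h Mh).
Qed.

(** The bridge from the extended-real sums in the definition of [l2_norm] to the norm of [l2]. *)
Lemma esum_l2 (x : l2) :
  (\esum_(i in [set: I]) (rnorm (x i) ^+ 2)%:E = (rnorm x ^+ 2)%:E)%E.
Proof.
have sumE (F : {fset I}) : (\sum_(i \in [set` F]) (rnorm (x i) ^+ 2)%:E = (ssq x F)%:E)%E.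
  by rewrite fsbig_finite//= set_fsetK sumEFin.
apply/eqP; rewrite eq_le; apply/andP; split.
  apply: ge_ereal_sup => _ [A [Afin _] <-].
  rewrite -(fset_setK Afin) sumE lee_fin; exact: ssq_le_l2norm.
have h F : ((ssq x F)%:E <= \esum_(i in [set: I]) (rnorm (x i) ^+ 2)%:E)%E.
  by rewrite -sumE; apply: ereal_sup_ubound; exists [set` F].
have e0 : (0 <= \esum_(i in [set: I]) (rnorm (x i) ^+ 2)%:E)%E.
  by apply: esum_ge0 => i _; rewrite lee_fin sqr_ge0.
case: (\esum_(i in _) _)%E h e0 => [m| |]//= h m0; last by rewrite leey.
rewrite lee_fin in m0 *; apply: (@le_trans _ _ (Num.sqrt m ^+ 2)); last by rewrite sqr_sqrtr.
rewrite ler_pXn2r ?nnegrE ?rnorm_ge0 ?sqrtr_ge0//.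
by apply: l2norm_le; [exact: sqrtr_ge0|move=> F; rewrite sqr_sqrtr// -lee_fin h].
Qed.

Lemma esum_is_l2 (x : I -> R[i]) :
  (\esum_(i in [set: I]) (rnorm (x i) ^+ 2)%:E < +oo)%E -> is_l2 x.
Proof.
move=> xoo; apply/asboolP.
have e0 : (0 <= \esum_(i in [set: I]) (rnorm (x i) ^+ 2)%:E)%E.
  by apply: esum_ge0 => i _; rewrite lee_fin sqr_ge0.
exists (fine (\esum_(i in [set: I]) (rnorm (x i) ^+ 2)%:E)%E) => F.
rewrite -lee_fin fineK ?ge0_fin_numE//.
apply: ereal_sup_ubound; exists [set` F]; first by split.
by rewrite fsbig_finite//= set_fsetK sumEFin.
Qed.

Lemma esum_restrict (D : set I) (x : I -> R[i]) : (forall i, ~ D i -> x i = 0) ->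
  (\esum_(i in D) (rnorm (x i) ^+ 2)%:E = \esum_(i in [set: I]) (rnorm (x i) ^+ 2)%:E)%E.
Proof.
move=> x0; rewrite esum_mkcond; apply: eq_esum => i _.
by case: ifPn => //; rewrite notin_setE => /x0 ->; rewrite rnorm0 expr0n.
Qed.

End MatrixOperators.

(** * Extension to the completions *)

Section SequenceLimits.
Variable R : realType.

Lemma rcvg_squeeze (V W : normedZmodType R[i]) (w : nat -> W) m (u : nat -> V) l (C : R) :
  rcvg w m -> (forall n, rnorm (u n - l) <= C * rnorm (w n - m)) -> rcvg u l.
Proof.
move=> wm h e e0; have C1 : 0 < `|C| + 1 by rewrite ltr_pwDr.
have [N hN] := wm _ (divr_gt0 e0 C1); exists N => n /hN.
rewrite ler_pdivlMr// => wn; apply: le_trans (h n) _; apply: le_trans wn.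
by rewrite mulrC ler_wpM2l ?rnorm_ge0// (le_trans (ler_norm C))// lerDl.
Qed.

Lemma rcvg_linear (V : normedModType R[i]) c (u v : nat -> V) l m :
  rcvg u l -> rcvg v m -> rcvg (fun n => c *: u n + v n) (c *: l + m).
Proof.
move=> ul vm e e0; have e20 : 0 < e / 2 by rewrite divr_gt0.
have c1 : 0 < rnorm c + 1 by rewrite ltr_wpDl ?rnorm_ge0.
have [N1 h1] := ul _ (divr_gt0 e20 c1); have [N2 h2] := vm _ e20.
exists (maxn N1 N2) => n; rewrite geq_max => /andP[/h1 {}h1 /h2 {}h2].
have -> : c *: u n + v n - (c *: l + m) = c *: (u n - l) + (v n - m).
  by rewrite scalerBr opprD addrACA.
apply: le_trans (rnormD _ _) _; rewrite rnormZ (splitr e) lerD//.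
move: h1; rewrite ler_pdivlMr//; apply: le_trans.
by rewrite mulrC ler_wpM2l ?rnorm_ge0// lerDl.
Qed.

End SequenceLimits.

Section CstarNorm.
Variables (R : realType) (A : cstar_algebra R).
Implicit Types a b x : A.

Lemma cmul_rnorm a b : rnorm (cmul a b) <= rnorm a * rnorm b.
Proof. by have := cnorm_mul a b; rewrite -!rnormE -rmorphM lecR. Qed.

Lemma cstar_sqr a : rnorm (cmul (cstar a) a) = rnorm a ^+ 2.
Proof. by apply: complexI; rewrite rmorphXn/= !rnormE cnorm_cstar. Qed.

Lemma cmulBl a b x : cmul (a - b) x = cmul a x - cmul b x.
Proof.
by have := cmul_linearl (-1) b a x; rewrite !scaleN1r ![- _ + _]addrC.
Qed.

Lemma cmulBr a b x : cmul x (a - b) = cmul x a - cmul x b.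
Proof.
by have := cmul_linearr (-1) b a x; rewrite !scaleN1r ![- _ + _]addrC.
Qed.

Lemma cstar_rnorm_le a : rnorm (cstar a) <= rnorm a.
Proof.
have [->|a0] := eqVneq (cstar a) 0; first by rewrite rnorm0 rnorm_ge0.
have na : 0 < rnorm (cstar a).
  by rewrite lt_neqAle rnorm_ge0 andbT eq_sym; apply: contra a0 => /eqP/rnorm_eq0 ->.
rewrite -(ler_pM2r na) -expr2 -cstar_sqr cstarK.
exact: cmul_rnorm.
Qed.

Lemma rcvg_cmull (u : nat -> A) a b : rcvg u a -> rcvg (fun n => cmul (u n) b) (cmul a b).
Proof.
move=> ua; apply: (rcvg_squeeze (C := rnorm b) ua) => n.
by rewrite -cmulBl mulrC; exact: cmul_rnorm.
Qed.

Lemma rcvg_cmulr (u : nat -> A) a b : rcvg u a -> rcvg (fun n => cmul b (u n)) (cmul b a).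
Proof.
move=> ua; apply: (rcvg_squeeze (C := rnorm b) ua) => n.
by rewrite -cmulBr; exact: cmul_rnorm.
Qed.

End CstarNorm.

Section Extension.
Variables (R : realType) (G : topGroupoid) (S : twist R G).
Local Notation L := (@fell_bundle R G S).
Implicit Types f : G -> L.
Variables (A : cstar_algebra R) (j : (G -> L) -> A).
Hypothesis j_morphism : @Cc_star_morphism R G S A j.
Hypothesis j_dense : closure (j @` @Cc R G S) = setT.
Variables (K : hilbert R) (T : (G -> L) -> bounded_op K).
Hypothesis Cc_conv : forall f1 f2, Cc f1 -> Cc f2 -> Cc (convolution f1 f2).
Hypothesis T_linear : forall c f1 f2, Cc f1 -> Cc f2 ->
  T (section_add (section_scale c f1) f2) = c *: T f1 + T f2.
Hypothesis T_mul : forall f1 f2, Cc f1 -> Cc f2 ->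
  T (convolution f1 f2) = comp_op (T f1) (T f2).
Hypothesis T_le : forall f, Cc f -> rnorm (T f) <= rnorm (j f).

Let j_linear c f1 f2 : Cc f1 -> Cc f2 ->
  j (section_add (section_scale c f1) f2) = c *: j f1 + j f2.
Proof.
move=> C1 C2; have [jD jZ _ _] := j_morphism.
by rewrite jD ?jZ//; exact: Cc_scale.
Qed.

Let Cc_lin c f1 f2 : Cc f1 -> Cc f2 -> Cc (section_add (section_scale c f1) f2).
Proof. by move=> C1 C2; apply: Cc_add => //; exact: Cc_scale. Qed.

Lemma Cc_approx (a : A) : exists f : nat -> G -> L,
  (forall n, Cc (f n)) /\ rcvg (fun n => j (f n)) a.
Proof.
have ex n : exists f, Cc f /\ rnorm (j f - a) <= n.+1%:R^-1.
  have : closure (j @` @Cc R G S) a by rewrite j_dense.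
  move=> /closure_rnorm/(_ n.+1%:R^-1)[|_ [f Cf <-] /ltW h]; first by rewrite invr_gt0.
  by exists f; rewrite rnormB.
have [f fP] := choice ex; exists f; split=> [n|]; first exact: (fP n).1.
by apply: rcvg_invS => n; exact: (fP n).2.
Qed.

Let T_dist f1 f2 x : Cc f1 -> Cc f2 ->
  rnorm (T f1 x - T f2 x) <= rnorm (j f1 - j f2) * rnorm x.
Proof.
move=> C1 C2.
have E : T f1 x - T f2 x = T (section_add (section_scale (-1) f2) f1) x.
  by rewrite T_linear// bounded_opDE bounded_opZE scaleN1r addrC.
have E' : j f1 - j f2 = j (section_add (section_scale (-1) f2) f1).
  by rewrite j_linear// scaleN1r addrC.
rewrite E E'; apply: le_trans (le_op_norm _ _) _.
by rewrite ler_wpM2r ?rnorm_ge0// T_le//; exact: Cc_lin.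
Qed.

(** The limit is the same along every approximating sequence, so each property of the extension can
    be checked along the sequence that suits it. *)
Let ext_ex a x : exists v : K, forall f : nat -> G -> L, (forall n, Cc (f n)) ->
  rcvg (fun n => j (f n)) a -> rcvg (fun n => T (f n) x) v.
Proof.
have [f [Cf fa]] := Cc_approx a.
have [v fv] : exists v, rcvg (fun n => T (f n) x) v.
  apply: rcauchy_cvg => e e0; have x1 : 0 < rnorm x + 1 by rewrite ltr_wpDl ?rnorm_ge0.
  have [N h] := rcvg_cauchy fa (divr_gt0 e0 x1); exists N => m n Nm Nn.
  apply: le_trans (T_dist _ (Cf m) (Cf n)) _.
  have := h m n Nm Nn; rewrite ler_pdivlMr//; apply: le_trans.
  by rewrite ler_wpM2l ?rnorm_ge0// lerDl.
exists v => g Cg ga e e0; have e20 : 0 < e / 2 by rewrite divr_gt0.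
have x1 : 0 < rnorm x + 1 by rewrite ltr_wpDl ?rnorm_ge0.
have d0 : 0 < (e / 2) / 2 / (rnorm x + 1) by rewrite !divr_gt0.
have [N1 h1] := fa _ d0; have [N2 h2] := ga _ d0; have [N3 h3] := fv _ e20.
exists (maxn N1 (maxn N2 N3)) => n; rewrite !geq_max => /and3P[/h1 {}h1 /h2 {}h2 /h3 {}h3].
apply: le_trans (rnorm_dist (T (f n) x) _ _) _; rewrite (splitr e) lerD//.
apply: le_trans (T_dist _ (Cg n) (Cf n)) _.
have h12 : rnorm (j (g n) - j (f n)) <= (e / 2) / (rnorm x + 1).
  apply: le_trans (rnorm_dist a _ _) _; rewrite (rnormB a).
  by apply: le_trans (lerD h2 h1) _; rewrite -mulrDl -splitr.
move: h12; rewrite ler_pdivlMr//; apply: le_trans.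
by rewrite ler_wpM2l ?rnorm_ge0// lerDl.
Qed.

Lemma representation_extension : exists pi : A -> bounded_op K,
  [/\ forall c a b, pi (c *: a + b) = c *: pi a + pi b,
      forall a b, pi (cmul a b) = comp_op (pi a) (pi b),
      forall a, rnorm (pi a) <= rnorm a &
      forall f, Cc f -> pi (j f) = T f].
Proof.
have vex a : exists v : K -> K, forall x (f : nat -> G -> L), (forall n, Cc (f n)) ->
    rcvg (fun n => j (f n)) a -> rcvg (fun n => T (f n) x) (v x).
  by have [v vP] := choice (ext_ex a); exists v.
have [v vP] := choice vex.
have vlin a : linear (v a).
  move=> c x y; have [f [Cf fa]] := Cc_approx a.
  apply: (rcvg_unique (vP a (c *: x + y) f Cf fa)).
  rewrite (_ : (fun n => _) = (fun n => c *: T (f n) x + T (f n) y)); last first.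
    by apply/funext => n; rewrite linearP.
  by apply: rcvg_linear; exact: vP.
have vle a x : rnorm (v a x) <= rnorm a * rnorm x.
  apply/ler_addgt0Pl => e e0; have [f [Cf fa]] := Cc_approx a.
  have x1 : 0 < rnorm x + 1 by rewrite ltr_wpDl ?rnorm_ge0.
  have e20 : 0 < e / 2 by rewrite divr_gt0.
  have [N1 h1] := fa _ (divr_gt0 e20 x1).
  have [N2 h2] := vP a x f Cf fa _ e20.
  pose n := maxn N1 N2.
  have {}h1 := h1 n (leq_maxl _ _); have {}h2 := h2 n (leq_maxr _ _).
  apply: le_trans (rnorm_leD _ (T (f n) x)) _; rewrite rnormB.
  have h3 : rnorm (T (f n) x) <= rnorm (j (f n)) * rnorm x.
    by apply: le_trans (le_op_norm _ _) _; rewrite ler_wpM2r ?rnorm_ge0 ?T_le.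
  have h4 := rnorm_leD (j (f n)) a.
  have h5 : rnorm (j (f n) - a) * rnorm x <= e / 2.
    move: h1; rewrite ler_pdivlMr//; apply: le_trans.
    by rewrite ler_wpM2l ?rnorm_ge0// lerDl.
  have h6 := ler_wpM2r (rnorm_ge0 x) h4; rewrite mulrDl in h6.
  rewrite (splitr e) -addrA; apply: lerD => //.
  by apply: le_trans h3 _; apply: le_trans h6 _; rewrite lerD2r.
pose pi a : bounded_op K := mk_op (vlin a) (vle a).
have pij f : Cc f -> pi (j f) = T f.
  move=> Cf; apply: bounded_op_inj => x.
  have c0 : rcvg (fun _ : nat => j f) (j f).
    by move=> e e0; exists 0%N => n _; rewrite subrr rnorm0 ltW.
  apply: (rcvg_unique (vP (j f) x (fun=> f) (fun=> Cf) c0)).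
  by move=> e e0; exists 0%N => n _; rewrite subrr rnorm0 ltW.
have pilin c a b : pi (c *: a + b) = c *: pi a + pi b.
  apply: bounded_op_inj => x.
  have [f [Cf fa]] := Cc_approx a; have [g [Cg gb]] := Cc_approx b.
  have cfg : rcvg (fun n => j (section_add (section_scale c (f n)) (g n))) (c *: a + b).
    rewrite (_ : (fun n => _) = (fun n => c *: j (f n) + j (g n))); last first.
      by apply/funext => n; rewrite j_linear.
    exact: rcvg_linear.
  apply: (rcvg_unique (vP _ x _ (fun n => Cc_lin c (Cf n) (Cg n)) cfg)).
  rewrite (_ : (fun n => _) = (fun n => c *: T (f n) x + T (g n) x)); last first.
    by apply/funext => n; rewrite T_linear.
  by apply: rcvg_linear; exact: vP.
have pile a : rnorm (pi a) <= rnorm a.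
  by apply: op_norm_le => [|x]; [exact: rnorm_ge0|exact: vle].
exists pi; split=> // a b; apply: bounded_op_inj => x /=.
have jM f g : Cc f -> Cc g -> j (convolution f g) = cmul (j f) (j g).
  by move=> Cf Cg; have [_ _ h _] := j_morphism; exact: h.
(* Multiplicativity is proved in two stages: the second factor is first kept in the image of [Cc]
   while [a] is approximated, then [b] is approximated. *)
have half g : Cc g -> v (cmul a (j g)) x = v a (T g x).
  move=> Cg; have [f [Cf fa]] := Cc_approx a.
  have cfg : rcvg (fun n => j (convolution (f n) g)) (cmul a (j g)).
    rewrite (_ : (fun n => _) = (fun n => cmul (j (f n)) (j g))); last first.
      by apply/funext => n; rewrite jM.
    exact: rcvg_cmull.
  apply: (rcvg_unique (vP _ x _ (fun n => Cc_conv (Cf n) Cg) cfg)).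
  rewrite (_ : (fun n => _) = (fun n => T (f n) (T g x))); first exact: vP.
  by apply/funext => n; rewrite T_mul.
have [g [Cg gb]] := Cc_approx b.
have piB a' b' : pi a' - pi b' = pi (a' - b').
  by apply: esym; rewrite [X in pi X = _]addrC -scaleN1r pilin scaleN1r addrC.
have l1 : rcvg (fun n => v (cmul a (j (g n))) x) (v (cmul a b) x).
  apply: (rcvg_squeeze (C := rnorm x) (rcvg_cmulr a gb)) => n.
  have -> : v (cmul a (j (g n))) x - v (cmul a b) x =
    (pi (cmul a (j (g n))) - pi (cmul a b)) x by [].
  rewrite piB; apply: le_trans (le_op_norm _ _) _.
  by rewrite mulrC ler_wpM2l ?rnorm_ge0.
apply: (rcvg_unique l1).
apply: (rcvg_squeeze (C := rnorm a) (vP b x g Cg gb)) => n.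
rewrite half//; have -> : v a (T (g n) x) - v a (v b x) = pi a (T (g n) x - v b x).
  by rewrite linearB.
exact: vle.
Qed.

End Extension.

(** * Vanishing of sparse representations on the image of [B(H)] *)

Section Vanishing.
Variables (R : realType) (A : cstar_algebra R) (H : hilbert R) (I : choiceType).
Local Notation K := (l2_hilbert R I).
Variables (pi : A -> bounded_op K) (psi : BH H -> A).
Hypothesis pi_linear : forall c a b, pi (c *: a + b) = c *: pi a + pi b.
Hypothesis pi_mul : forall a b, pi (cmul a b) = comp_op (pi a) (pi b).
Hypothesis pi_le : forall a, rnorm (pi a) <= rnorm a.
Hypothesis pi_sparse : forall a e, 0 < e -> exists k U,
  column_sparse k U /\ rnorm (pi a - U) <= e.
Hypothesis psi_morphism : @star_morphism R (BH H) A psi.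

(** The C*-identity gives [|psi V|^2 = |psi (id_op H)| <= 1] for an isometry [V], so the sparse
    obstruction applies and kills the image of the identity; every [psi T] is a multiple of that
    image. *)
Theorem sparse_representation_kernel (H_infinite : infinite_dimensional H) (T : BH H) :
  pi (psi T) = 0.
Proof.
have [psi_linear psi_mul psi_star] := psi_morphism.
have psiM U V : psi (comp_op U V) = cmul (psi U) (psi V) by exact: psi_mul.
have psiS U : psi (adjoint U) = cstar (psi U) by exact: psi_star.
pose e := psi (id_op H).
have compid U : comp_op U (id_op H) = U by exact: bounded_op_inj.
have adjid : adjoint (id_op H) = id_op H by exact: adjoint_unique.
(* The element [e] is a projection, so its norm equals its own square. *)
have e1 : rnorm e <= 1.
  have : rnorm e = rnorm e ^+ 2.
    by rewrite -cstar_sqr -psiS adjid -psiM compid.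
  rewrite expr2; have := rnorm_ge0 e; move: (rnorm e) => t t0 tt.
  rewrite leNgt; apply/negP => t1; have : t * 1 < t * t.
    by rewrite ltr_pM2l// (lt_trans ltr01).
  by rewrite mulr1 -tt ltxx.
have iso V : isometry V -> rnorm (psi V) <= 1.
  move=> iV; rewrite -(@expr_le1 _ 2)// ?rnorm_ge0// -cstar_sqr -psiS -psiM.
  by rewrite isometry_adjoint.
have : pi e = 0.
  apply: (@sparse_representation_trivial R H I (pi \o psi)) => // [a U V|U V|V iV|U d d0].
  - by rewrite /= psi_linear pi_linear.
  - by rewrite /= psiM pi_mul.
  - split; first exact: le_trans (pi_le _) (iso V iV).
    rewrite /= psiS; apply: le_trans (pi_le _) _.
    exact: le_trans (cstar_rnorm_le _) (iso V iV).
  - exact: pi_sparse.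
move=> pe; rewrite -(compid T) psiM pi_mul -/e pe.
by apply: bounded_op_inj => x; rewrite /= linear0.
Qed.

End Vanishing.

(** * The regular representations as operators on one Hilbert space *)

Section FibreRepresentation.
Variables (R : realType) (G : topGroupoid) (S : twist R G).
Hypothesis G_locally_compact : locally_compact_subspace [set: G].
Hypothesis G_etale : etale G.
Local Notation L := (@fell_bundle R G S).
Local Notation cls := (@fell_class R G S).
Local Notation K := (l2_hilbert R G).
Local Notation l2 := (@l2 R G).
Implicit Types f : G -> L.

(* [regular_rep u] in coordinates, extended by zero from the fibre over [u] to
   all of [G], so that one Hilbert space serves for every [u]. *)
Definition fibre_matrix (u : G) f g h : R[i] :=
  if src h == u then rep_matrix f g h else 0.

Lemma fibre_matrix_le u f g h : is_section f ->
  rnorm (fibre_matrix u f g h) <= fell_norm (f (mul g (inv h))).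
Proof.
move=> fs; have n0 : 0 <= fell_norm (f (mul g (inv h))).
  by have := normr_ge0 (repr (f (mul g (inv h)))).2; rewrite lecE => /andP[].
rewrite /fibre_matrix; case: ifP => _; last by rewrite rnorm0.
have [gh|gh] := pselect (src g = src h); first by rewrite rep_matrix_norm.
by rewrite rep_matrix_neq// rnorm0.
Qed.

Lemma fibre_matrix_neq0 u f g h : fibre_matrix u f g h <> 0 -> rep_matrix f g h <> 0.
Proof. by rewrite /fibre_matrix; case: ifP. Qed.

Lemma fibre_matrix_eq0 u f g h : rep_matrix f g h = 0 -> fibre_matrix u f g h = 0.
Proof. by rewrite /fibre_matrix => ->; case: ifP. Qed.

(** Bisection sections act by bounded monomial matrices, and having a bounded operator passes to
    sums and multiples. *)
Lemma fibre_matrix_op u f : bisection_span f ->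
  exists T : bounded_op K, has_matrix T (fibre_matrix u f).
Proof.
elim=> [|f' bf|f1 f2 b1 [T1 h1] b2 [T2 h2]|c f' bf [T1 h1]].
- exists 0 => g h; rewrite bounded_op0E.
  by rewrite fibre_matrix_eq0// rep_matrix_zero.
- have fs : is_section f' by case: bf.
  have [B fB] := bisection_section_bounded bf.
  have [ci ri] := bisection_section_matrix_inj bf.
  apply: (@monomial_matrix_op R G _ `|B|) => //.
  + move=> g h; apply: le_trans (fibre_matrix_le u g h fs) _.
    exact: le_trans (fB _) (ler_norm _).
  + by move=> g g' h /fibre_matrix_neq0 M /fibre_matrix_neq0 M'; exact: ci M M'.
  + by move=> g h h' /fibre_matrix_neq0 M /fibre_matrix_neq0 M'; exact: ri M M'.
- exists (T1 + T2) => g h; rewrite (has_matrix_add h1 h2).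
  rewrite /fibre_matrix; case: ifP => _; last by rewrite addr0.
  by rewrite rep_matrix_add//; exact: bisection_span_section.
- exists (c *: T1) => g h; rewrite (has_matrix_scale c h1).
  rewrite /fibre_matrix; case: ifP => _; last by rewrite mulr0.
  by rewrite rep_matrix_scale//; exact: bisection_span_section.
Qed.

(** Selected by its matrix, which determines it; for [f] in [Cc] such an operator exists, so the
    default 0 does not intervene. *)
Definition fibre_op (u : G) f : bounded_op K :=
  xget 0 [set T : bounded_op K | has_matrix T (fibre_matrix u f)].

Lemma fibre_opE u f (T : bounded_op K) : has_matrix T (fibre_matrix u f) ->
  fibre_op u f = T.
Proof.
move=> TM; have h : has_matrix (fibre_op u f) (fibre_matrix u f).
  exact: (xgetI 0 (TM : [set T : bounded_op K | has_matrix T (fibre_matrix u f)] T)).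
exact: has_matrix_unique h TM.
Qed.

Lemma fibre_opP u f : Cc f -> has_matrix (fibre_op u f) (fibre_matrix u f).
Proof.
move=> /(Cc_bisection_span G_locally_compact G_etale)/(fibre_matrix_op u)[T TM].
by rewrite (fibre_opE TM).
Qed.

Lemma Cc_finite f : Cc f ->
  exists k, finite_columns (rep_matrix f) k /\ finite_rows (rep_matrix f) k.
Proof.
by move=> /(Cc_bisection_span G_locally_compact G_etale)/bisection_span_finite.
Qed.

Lemma fibre_op_add u f1 f2 : Cc f1 -> Cc f2 ->
  fibre_op u (section_add f1 f2) = fibre_op u f1 + fibre_op u f2.
Proof.
move=> C1 C2; apply: fibre_opE => g h.
rewrite (has_matrix_add (fibre_opP u C1) (fibre_opP u C2)) /fibre_matrix.
case: ifP => _; last by rewrite addr0.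
by rewrite rep_matrix_add//; exact: Cc_section.
Qed.

Lemma fibre_op_scale u c f : Cc f ->
  fibre_op u (section_scale c f) = c *: fibre_op u f.
Proof.
move=> Cf; apply: fibre_opE => g h.
rewrite (has_matrix_scale c (fibre_opP u Cf)) /fibre_matrix.
case: ifP => _; last by rewrite mulr0.
by rewrite rep_matrix_scale//; exact: Cc_section.
Qed.

Lemma fibre_op_mul u f1 f2 : Cc f1 -> Cc f2 ->
  fibre_op u (convolution f1 f2) = comp_op (fibre_op u f1) (fibre_op u f2).
Proof.
move=> C1 C2; have s1 := Cc_section C1; have s2 := Cc_section C2.
have [k [c2 _]] := Cc_finite C2.
have [F F0] : exists F : G -> {fset G}, forall h k, k \notin F h -> rep_matrix f2 k h = 0.
  have ex h : exists F : {fset G}, forall k, k \notin F -> rep_matrix f2 k h = 0.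
    by have [F _ F0] := c2 h; exists F.
  by have [F FP] := choice ex; exists F.
apply: fibre_opE => g h.
rewrite (has_matrix_comp (F := F) (fibre_opP u C1) (fibre_opP u C2)); last first.
  by move=> h' k' /F0; exact: fibre_matrix_eq0.
rewrite [RHS]/fibre_matrix; case: ifPn => hu; last first.
  by rewrite big1// => x _; rewrite /(fibre_matrix u f2) (negbTE hu) mulr0.
rewrite (rep_matrix_convolution_fset g s1 s2 (F0 h)); apply: eq_bigr => x _.
rewrite /fibre_matrix hu; case: ifPn => // xu.
rewrite [rep_matrix f2 x h]rep_matrix_neq ?mulr0//.
by move=> xh; rewrite xh hu in xu.
Qed.

Lemma fibre_op_star u f : Cc f ->
  fibre_op u (section_star f) = adjoint (fibre_op u f).
Proof.
move=> Cf; have fs := Cc_section Cf; apply: fibre_opE => g h.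
rewrite (has_matrix_adjoint (fibre_opP u Cf)) /fibre_matrix rep_matrix_star//.
have [gh|gh] := pselect (src g = src h).
  by rewrite gh; case: ifP => // _; rewrite rmorph0.
rewrite [rep_matrix f h g]rep_matrix_neq ?rmorph0; last by move=> hg; apply: gh.
by rewrite !if_same ?rmorph0.
Qed.

Lemma fibre_op_morphism u : @Cc_star_morphism R G S (BH K) (fibre_op u).
Proof.
split=> [f1 f2|c f|f1 f2|f].
- exact: fibre_op_add.
- exact: fibre_op_scale.
- exact: fibre_op_mul.
- exact: fibre_op_star.
Qed.

Lemma fibre_op_universal u f : ((rnorm (fibre_op u f))%:E <= universal_norm f)%E.
Proof.
apply: ereal_sup_ubound; exists K, (fibre_op u); split=> //.
exact: fibre_op_morphism.
Qed.

Lemma fibre_op_sparse u f : Cc f -> exists k, column_sparse k (fibre_op u f).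
Proof.
move=> Cf; have [k [ck _]] := Cc_finite Cf; exists k.
apply: has_matrix_sparse (fibre_opP u Cf) _ => h.
by have [F Fk F0] := ck h; exists F => // g /F0; exact: fibre_matrix_eq0.
Qed.

(** Rows of the matrix of [f] are finite, so the fibrewise sum in [regular_rep] is the row formula
    for [fibre_op]. *)
Lemma regular_rep_coord u f xi (x : K) g : Cc f ->
  (forall h, source_fibre u h -> fell_base (xi h) = h) ->
  (forall h, source_fibre u h -> (x : l2) h = fell_coord h (xi h)) ->
  source_fibre u g ->
  fell_coord g (regular_rep u f xi g) = (fibre_op u f x : l2) g.
Proof.
move=> Cf xis xE gu; have fs := Cc_section Cf.
have [k [_ rk]] := Cc_finite Cf; have [F _ F0] := rk g.
rewrite (has_matrix_row (F := F) _ (fibre_opP u Cf)); last first.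
  by move=> h /F0; exact: fibre_matrix_eq0.
rewrite /regular_rep /fell_sum fell_coord_class.
rewrite -(@fsbigTE _ _ _ _ F (fun h => fibre_matrix u f g h * (x : l2) h)); last first.
  by move=> h /F0 M0; rewrite fibre_matrix_eq0// mul0r.
rewrite -(fsbig_widen (source_fibre u) [set: G])//; last first.
  by move=> h [_ /= /eqP/negbTE hu]; rewrite /= /fibre_matrix hu mul0r.
apply: eq_fsbigr => h /set_mem/= hu; have gh : src g = src h by rewrite gu hu.
rewrite /fibre_matrix hu eqxx rep_matrixE// xE//.
rewrite -{1}(mul_invK gh) fell_coord_mul ?src_div ?xis//.
by rewrite mulrA.
Qed.

Lemma fibre_op_off u f (x : K) g : Cc f -> ~ source_fibre u g ->
  (fibre_op u f x : l2) g = 0.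
Proof.
move=> Cf gu; have [k [_ rk]] := Cc_finite Cf; have [F _ F0] := rk g.
rewrite (has_matrix_row (F := F) _ (fibre_opP u Cf)).
  rewrite big1// => h _; rewrite /fibre_matrix; case: eqP => [hu|_]; last by rewrite mul0r.
  by rewrite rep_matrix_neq ?mul0r// hu.
by move=> h /F0; exact: fibre_matrix_eq0.
Qed.

Lemma l2_norm_coord u xi (x : l2) :
  (forall h, source_fibre u h -> fell_base (xi h) = h) ->
  (forall h, source_fibre u h -> x h = fell_coord h (xi h)) ->
  (forall h, ~ source_fibre u h -> x h = 0) ->
  @l2_norm R G S u xi = (rnorm x)%:E.
Proof.
move=> xis xE x0; rewrite /l2_norm.
rewrite (eq_esum (b := fun g => (rnorm (x g) ^+ 2)%:E)); last first.
  by move=> g gu; rewrite xE// fell_coord_norm ?xis.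
rewrite esum_restrict// esum_l2 /= sqrtr_sqr ger0_norm//.
exact: rnorm_ge0.
Qed.

Lemma regular_rep_base u f xi g : fell_base (regular_rep u f xi g) = g.
Proof. by rewrite fell_base_class proj_lift. Qed.

Lemma l2_norm_regular_rep u f xi (x : K) : Cc f ->
  (forall h, source_fibre u h -> fell_base (xi h) = h) ->
  (forall h, source_fibre u h -> (x : l2) h = fell_coord h (xi h)) ->
  @l2_norm R G S u (regular_rep u f xi) = (rnorm (fibre_op u f x))%:E.
Proof.
move=> Cf xis xE; apply: (@l2_norm_coord _ _ (fibre_op u f x)).
- by move=> h _; exact: regular_rep_base.
- by move=> h hu; rewrite (regular_rep_coord Cf xis xE).
- by move=> h; exact: fibre_op_off.
Qed.

Lemma fibre_op_le_reduced u f (r : R) : Cc f -> units G u ->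
  (reduced_norm f <= r%:E)%E -> rnorm (fibre_op u f) <= r.
Proof.
move=> Cf uu fr.
have ball_le (x : K) : rnorm x <= 1 -> rnorm (fibre_op u f x) <= r.
  move=> x1; pose xi h := cls (twist_lift S h) ((x : l2) h).
  have xis h : source_fibre u h -> fell_base (xi h) = h.
    by rewrite /xi fell_base_class proj_lift.
  have xE h : source_fibre u h -> (x : l2) h = fell_coord h (xi h).
    by rewrite /xi fell_coord_class.
  rewrite -lee_fin -(l2_norm_regular_rep Cf xis xE); apply: le_trans fr.
  apply: (@le_trans _ _ (regular_rep_norm u f)); last first.
    by apply: ereal_sup_ubound; exists u.
  apply: ereal_sup_ubound; exists xi => //.
  (* The vector [x] lives on all of [G]; its restriction to the fibre has the norm of [xi] and is no
     longer than [x]. *)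
  have y2 : is_l2 (fun h => if src h == u then (x : l2) h else 0).
    have /asboolP[M xM] := l2P (x : l2); apply/asboolP; exists M => F.
    apply: le_trans (xM F); apply: ler_sum => h _; case: ifP => // _.
    by rewrite rnorm0 expr0n sqr_ge0.
  have yE : @l2_norm R G S u xi = (rnorm (L2 y2))%:E.
    apply: l2_norm_coord => // h hu; last by rewrite /=; case: eqP.
    by rewrite /= hu eqxx xE.
  have y1 : rnorm (L2 y2) <= 1.
    apply: le_trans x1; apply: l2norm_le => [|F]; first exact: rnorm_ge0.
    apply: le_trans (ssq_le_l2norm (x : l2) F); apply: ler_sum => h _ /=.
    by case: ifP => // _; rewrite rnorm0 expr0n sqr_ge0.
  split; last by rewrite /= yE lee_fin.
  by split=> //; rewrite yE ltry.
have r0 : 0 <= r.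
  by apply: le_trans (rnorm_ge0 _) (ball_le 0 _); rewrite rnorm0.
apply: op_norm_le => // x; have [->|x0] := eqVneq x 0; first by rewrite linear0 !rnorm0 mulr0.
have nx : 0 < rnorm x.
  by rewrite lt_neqAle rnorm_ge0 andbT eq_sym; apply: contra x0 => /eqP/rnorm_eq0 ->.
have := ball_le ((rnorm x)^-1%:C%C *: x); rewrite linearZ/= !rnormZ rnorm_real.
rewrite ger0_norm ?invr_ge0 ?rnorm_ge0// mulVf ?gt_eqF// => /(_ (lexx _)).
by rewrite mulrC ler_pdivrMr.
Qed.

Lemma reduced_le_fibre_op f (r : R) : Cc f ->
  (forall u, units G u -> rnorm (fibre_op u f) <= r) -> (reduced_norm f <= r%:E)%E.
Proof.
move=> Cf fr; apply: ge_ereal_sup => _ [u uu <-].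
apply: ge_ereal_sup => _ [xi [[xis xioo] xi1] <-].
pose y h := if src h == u then fell_coord h (xi h) else 0.
have y0 h : ~ source_fibre u h -> y h = 0 by rewrite /y; case: eqP.
have yE h : source_fibre u h -> y h = fell_coord h (xi h) by rewrite /y => ->; rewrite eqxx.
have y2 : is_l2 y.
  apply: esum_is_l2; rewrite -(esum_restrict y0).
  rewrite (eq_esum (b := fun g => (fell_norm (xi g) ^+ 2)%:E)); last first.
    by move=> g gu; rewrite yE// fell_coord_norm ?xis.
  move: xioo; rewrite /l2_norm; case: (\esum_(_ in _) _)%E => //= r' _.
  exact: ltry.
have xiE : @l2_norm R G S u xi = (rnorm (L2 y2))%:E by exact: l2_norm_coord.
rewrite (l2_norm_regular_rep (x := L2 y2) Cf)// lee_fin.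
apply: le_trans (le_op_norm _ _) _; rewrite -[leRHS]mulr1.
apply: ler_pM; rewrite ?rnorm_ge0 ?fr//.
by move: xi1; rewrite xiE lee_fin.
Qed.

End FibreRepresentation.

(** * Ideals of bounded operators *)

Section CompactOperators.
Variable R : realType.

(** Otherwise the ultrafilter would contain the complements of finitely many sets that cover one of
    its members. *)
Lemma ultra_finite_cover (X Y : choiceType) (F : set_system X) (D : {fset Y})
    (V : Y -> set X) : UltraFilter F ->
  F [set x | exists2 y, y \in D & V y x] -> exists y, F (V y).
Proof.
move=> FU; have FP : ProperFilter F by exact: ultra_proper.
move=> FD; apply: contrapT => nV.
have : F [set x | forall y, y \in enum_fset D -> ~ V y x].
  elim: (enum_fset D) => [|y s IH].
    by apply: filterS (@filterT _ F _) => x _ y; rewrite in_nil.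
  have [Vy|Vy] := in_ultra_setVsetC (V y) FU; first by case: nV; exists y.
  apply: filterS (filterI Vy IH) => x [nx hx] z.
  by rewrite inE => /orP[/eqP ->|/hx].
move=> nD; have [x [[y yD Vyx] h]] := filter_ex (filterI FD nD).
exact: h yD Vyx.
Qed.

(** An ultrafilter on the closure selects one ball from each finite cover, hence contains balls of
    every radius; it is Cauchy and converges by completeness. *)
Lemma totally_bounded_precompact (V : completeNormedModType R[i]) (A : set V) :
  (forall e : R, 0 < e -> exists D : {fset V},
    forall y, A y -> exists2 x, x \in D & rnorm (x - y) < e) ->
  precompact A.
Proof.
move=> tb; rewrite precompactE compact_ultra => F FU FA.
have FP : ProperFilter F by exact: ultra_proper.
have /cauchy_cvg Fp : cauchy F.
  apply: cauchy_exP => e; rewrite ltcE => /andP[/eqP /= ie e0].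
  have e20 : 0 < complex.Re e / 2 by rewrite divr_gt0.
  have [D AD] := tb _ e20.
  have : F [set y | exists2 x, x \in D & rnorm (x - y) < complex.Re e].
    apply: filterS FA => y /closure_rnorm/(_ _ e20)[z /AD[x xD xz] yz].
    exists x => //; apply: le_lt_trans (rnorm_dist z _ _) _.
    by rewrite (splitr (complex.Re e)) ltrD// rnormB.
  move=> /ultra_finite_cover[x Fx]; exists x; apply: filterS Fx => y /=.
  have -> : e = (complex.Re e)%:C%C by apply/eqP; rewrite eq_complex /= -ie !eqxx.
  by rewrite -ball_normE /= rnorm_lt.
exists (lim F); split=> //; apply: closed_closure => B /Fp FB.
exact: filter_ex (filterI FA FB).
Qed.

Variable H : hilbert R.
Implicit Types S T : bounded_op H.

Lemma compact_ops_two_sided : two_sided_ideal (compact_ops H).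
Proof.
move=> S T /asboolP[C TC [cC _]]; split; apply/asboolP.
  have cSC : compact (S @` C).
    apply: continuous_compact cC; apply: continuous_subspaceT.
    exact: bounded_op_continuous.
  exists (S @` C); last by split=> //; apply: compact_closed => //; exact: norm_hausdorff.
  by move=> _ [x x1 <-]; exists (T x) => //; apply: TC; exists x.
(* The unit ball is mapped by [S] into the ball of radius [c], hence by [comp_op T S] into [c] times
   the compact [C]; adding 1 keeps [c] invertible. *)
pose c := (rnorm S + 1)%:C%C : R[i].
have S1 : 0 < rnorm S + 1 by rewrite ltr_wpDl ?rnorm_ge0.
have c0 : c != 0 by rewrite fmorph_eq0 gt_eqF.
have ccC : compact ( *:%R c @` C).
  apply: continuous_compact cC; apply: continuous_subspaceT => x.
  by apply: cvgZr; exact: cvg_id.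
exists ( *:%R c @` C); last by split=> //; apply: compact_closed => //; exact: norm_hausdorff.
move=> _ [x x1 <-]; exists (T (c^-1 *: S x)); last first.
  by rewrite linearZ/= scalerA mulfV// scale1r.
apply: TC; exists (c^-1 *: S x) => //=.
rewrite -[1]/(1%:C%C) rnorm_le rnormZ.
have -> : rnorm c^-1 = (rnorm S + 1)^-1.
  by rewrite /c -fmorphV/= rnorm_real ger0_norm ?invr_ge0 ?ltW.
rewrite mulrC ler_pdivrMr// mul1r; apply: le_trans (le_op_norm _ _) _.
have rx : rnorm x <= 1 by rewrite -rnorm_le.
apply: (@le_trans _ _ (rnorm S * 1)); first by rewrite ler_wpM2l ?rnorm_ge0.
by rewrite mulr1 lerDl.
Qed.

(** A finite [e/4]-net for the image of the unit ball under a compact [S] with [|T - S| < e/4] is an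
    [e]-net for its image under [T]. *)
Lemma compact_ops_closed : closed [set T | compact_ops H T].
Proof.
move=> T clT; apply/asboolP; apply: totally_bounded_precompact => e e0.
have e40 : 0 < e / 4 by rewrite divr_gt0.
have [S /asboolP[C SC [cC _]] TS] := (closure_rnorm _ T).1 clT _ e40.
pose V (x : H) := interior [set y : H | rnorm (x - y) < e / 4].
have [D [DC CD]] : exists D : {fset H}, (forall x, x \in D -> C x) /\
    forall y, C y -> exists2 x, x \in D & V x y.
  apply: compact_finite_cover => // x _; split; first exact: open_interior.
  by apply/nbhs_rnorm; exists (e / 4).
exists D => _ [x x1 <-]; have [|z zD /interior_subset/= zx] := CD (S x).
  by apply: SC; exists x.
exists z => //; apply: le_lt_trans (rnorm_dist (S x) _ _) _.
have rx : rnorm x <= 1 by rewrite -rnorm_le.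
have : rnorm (S x - T x) <= e / 4.
  rewrite -bounded_opBE; apply: le_trans (le_op_norm _ _) _.
  rewrite rnormB; apply: (@le_trans _ _ (rnorm (T - S) * 1)).
    by rewrite ler_wpM2l ?rnorm_ge0.
  by rewrite mulr1 ltW.
by move: zx; lra.
Qed.

End CompactOperators.

(** * The quotient algebra [B(H)/J] *)

Section QuotientMorphism.
Variables (R : realType) (H : hilbert R) (J : lin_subspace (bounded_op H)).
Implicit Types S T : bounded_op H.

Lemma quot_classP S T : quot_class J S = quot_class J T <-> J (S - T).
Proof.
by split=> [/eqP|ST]; [|apply/eqP]; rewrite -Quotient.idealrBE.
Qed.

Lemma quot_class_repr (x : quot_space J) : quot_class J (repr x) = x.
Proof. exact: reprK. Qed.

Hypothesis J_ideal : two_sided_ideal J.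

Lemma quot_class_comp S T S' T' : quot_class J S = quot_class J S' ->
  quot_class J T = quot_class J T' ->
  quot_class J (comp_op S T) = quot_class J (comp_op S' T').
Proof.
move=> /quot_classP SS /quot_classP TT; apply/quot_classP.
have -> : comp_op S T - comp_op S' T' = comp_op (S - S') T + comp_op S' (T - T').
  apply: bounded_op_inj => x; suff : S (T x) - S' (T' x) = (S - S') (T x) + S' ((T - T') x) by [].
  by rewrite !bounded_opBE linearB addrA subrK.
have [_ JD] := lin_subspaceP J; rewrite -[X in J (X + _)]scale1r.
by apply: JD; [exact: (J_ideal T SS).2|exact: (J_ideal S' TT).1].
Qed.

Hypothesis J_closed : closed [set T | J T].

(** Here the norm-closedness of the ideal enters: it makes [J] self-adjoint. *)
Lemma quot_class_adjoint S T : quot_class J S = quot_class J T ->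
  quot_class J (adjoint S) = quot_class J (adjoint T).
Proof.
move=> /quot_classP ST; apply/quot_classP.
have -> : adjoint S - adjoint T = adjoint (S - T).
  have -> : S - T = (-1) *: T + S by rewrite scaleN1r addrC.
  by rewrite adjoint_linear rmorphN rmorph1 scaleN1r addrC.
exact: closed_ideal_adjoint.
Qed.

(** The quotient operations act on chosen representatives, so the multiplicative and adjoint laws
    rest on the independence of representatives. *)
Lemma star_morphism_quot_class (B : star_algebra R) (phi : BH_quotient J -> B) :
  star_morphism phi -> @star_morphism R (BH H) B (phi \o quot_class J).
Proof.
move=> [phiL phiM phiS]; split=> [a S T|S T|S] /=.
- rewrite -phiL; congr phi.
  by rewrite /quot_class -pi_quot_add -pi_quot_scale.
- rewrite -phiM; congr phi.
  by apply: quot_class_comp; rewrite quot_class_repr.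
- rewrite -phiS; congr phi.
  by apply: quot_class_adjoint; rewrite quot_class_repr.
Qed.

Lemma quot_class_identity : @is_identity R (BH_quotient J) (quot_class J (id_op H)).
Proof.
move=> x /=; split; rewrite -{2}(quot_class_repr x).
  rewrite -[repr x in RHS](_ : comp_op (id_op H) (repr x) = _); last exact: bounded_op_inj.
  by apply: quot_class_comp; rewrite quot_class_repr.
rewrite -[repr x in RHS](_ : comp_op (repr x) (id_op H) = _); last exact: bounded_op_inj.
by apply: quot_class_comp; rewrite quot_class_repr.
Qed.

End QuotientMorphism.

Lemma star_isomorphism_identity (R : realType) (A B : star_algebra R) (phi : A -> B) e :
  star_morphism phi -> bijective phi -> is_identity e -> is_identity (phi e).
Proof.
move=> [_ phiM _] [psi _ psiK] eP x; rewrite -(psiK x) -!phiM.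
by have [-> ->] := eP (psi x).
Qed.

(** * The obstruction in the full and reduced completions *)

Section CompletionRepresentations.
Variables (R : realType) (G : topGroupoid) (S : twist R G).
Hypothesis G_locally_compact : locally_compact_subspace [set: G].
Hypothesis G_etale : etale G.
Hypothesis G0_hausdorff : hausdorff_subspace (units G).
Variables (A : cstar_algebra R) (j : (G -> fell_bundle S) -> A).
Hypothesis j_morphism : @Cc_star_morphism R G S A j.
Hypothesis j_dense : closure (j @` @Cc R G S) = setT.
Variable u : G.
Hypothesis fibre_le : forall f, Cc f -> rnorm (fibre_op u f) <= rnorm (j f).

(** One statement for both completions, which differ only in how the bound [fibre_le] is
    obtained. *)
Lemma fibre_representation : exists pi : A -> bounded_op (l2_hilbert R G),
  [/\ forall c a b, pi (c *: a + b) = c *: pi a + pi b,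
      forall a b, pi (cmul a b) = comp_op (pi a) (pi b),
      forall a, rnorm (pi a) <= rnorm a,
      forall f, Cc f -> pi (j f) = fibre_op u f &
      forall (H : hilbert R) (psi : BH H -> A), @star_morphism R (BH H) A psi ->
        infinite_dimensional H -> forall T, pi (psi T) = 0].
Proof.
have [|c f1 f2 C1 C2|f1 f2 C1 C2||pi [piL piM pi_le pij]] :=
  @representation_extension _ _ _ A j j_morphism j_dense _ (fibre_op u).
- exact: Cc_convolution.
- by rewrite fibre_op_add ?fibre_op_scale//; exact: Cc_scale.
- exact: fibre_op_mul.
- exact: fibre_le.
exists pi; split=> // H psi psiP H_inf T.
apply: (sparse_representation_kernel piL piM pi_le _ psiP H_inf) => a e e0.
(* Elements of [Cc] act by sparse operators and approximate [a]; the contractivity of [pi] transfers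
   the approximation. *)
have [f [Cf fa]] := Cc_approx j_dense a.
have [N /(_ N (leqnn _)) h] := fa e e0.
have [k fk] := fibre_op_sparse G_locally_compact G_etale u (Cf N).
exists k, (fibre_op u (f N)); split=> //; rewrite -pij//.
have -> : pi a - pi (j (f N)) = pi (a - j (f N)).
  by rewrite [in RHS]addrC -scaleN1r piL scaleN1r addrC.
by apply: le_trans (pi_le _) _; rewrite rnormB.
Qed.

End CompletionRepresentations.

Section Obstruction.
Variables (R : realType) (G : topGroupoid) (S : twist R G).
Hypothesis G_nonempty : [set: G] !=set0.
Hypothesis G_locally_compact : locally_compact_subspace [set: G].
Hypothesis G_etale : etale G.
Hypothesis G0_hausdorff : hausdorff_subspace (units G).
Variable (H : hilbert R).
Hypothesis H_infinite : infinite_dimensional H.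

(** At an arrow [g] where [f] does not vanish, the matrix for the fibre over [src g] has at
    [(g, src g)] an entry of modulus [|f g|]. *)
Lemma fibre_op_neq0 : exists u f, Cc f /\ fibre_op (S := S) u f <> 0.
Proof.
have [g0 _] := G_nonempty.
have [f [g [Cf fg]]] := Cc_nonzero S G_locally_compact G_etale G0_hausdorff g0.
have fs := Cc_section Cf; exists (src g), f; split=> // f0.
have /(_ g (src g)) := fibre_opP G_locally_compact G_etale (src g) Cf.
rewrite f0 bounded_op0E /fibre_matrix src_src eqxx => /esym M0.
have gg : src g = src (src g) by rewrite src_src.
have := rep_matrix_norm fs gg.
have E : mul g (inv (src g)) = g.
  by rewrite -[inv _]mul_src src_inv rng_src inv_mul src_src mul_src.
rewrite {}M0 E -section_coord_norm// => /esym N0.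
have [] := section_coord_neq0 fs fg.
by apply: rnorm_eq0; rewrite N0; exact: rnorm0.
Qed.

(** If [psi (id_op H)] were an identity, [pi (j f)] would equal [pi (psi (id_op H)) pi (j f) = 0]
    for every [f], yet some [fibre_op u f] is nonzero. *)
Lemma no_unital_morphism (A : cstar_algebra R) (j : (G -> fell_bundle S) -> A)
    (psi : BH H -> A) : is_full_Cstar j -> @star_morphism R (BH H) A psi ->
  ~ @is_identity R A (psi (id_op H)).
Proof.
move=> [jP jn jd] psiP eP; have [u [f [Cf f0]]] := fibre_op_neq0.
have le g : Cc g -> rnorm (fibre_op u g) <= rnorm (j g).
  by move=> Cg; rewrite -lee_fin [leRHS]jn//; exact: fibre_op_universal.
have [pi [_ piM _ pij pi0]] :=
  fibre_representation G_locally_compact G_etale G0_hausdorff jP jd le.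
apply: f0; rewrite -pij//; have [<- _] := eP (j f).
rewrite [pi _]piM pi0//; apply: bounded_op_inj => x.
by [].
Qed.

(** If [j f] approximates [psi T], then [fibre_op u f] is the value of [pi] at [j f - psi T], hence
    small uniformly in [u]; so the reduced norm of [f] is small, and with it [psi T]. *)
Lemma reduced_kernel (A : cstar_algebra R) (j : (G -> fell_bundle S) -> A)
    (psi : BH H -> A) : is_reduced_Cstar j -> @star_morphism R (BH H) A psi ->
  forall T, psi T = 0.
Proof.
move=> [jP jn jd] psiP T; apply: rnorm_small => e e0.
have e20 : 0 < e / 2 by rewrite divr_gt0.
have [f [Cf fa]] := Cc_approx jd (psi T).
have [N /(_ N (leqnn _))] := fa _ e20; move: (f N) (Cf N) => {fa Cf}f Cf fa.
have : (rnorm (j f))%:E = reduced_norm f by exact: jn.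
have /reduced_le_fibre_op -/(_ G_locally_compact G_etale Cf) h :
    forall u, units G u -> rnorm (fibre_op u f) <= e / 2.
  move=> u uu.
  have le g : Cc g -> rnorm (fibre_op u g) <= rnorm (j g).
    move=> Cg; apply: (fibre_op_le_reduced G_locally_compact G_etale Cg uu).
    by rewrite -jn.
  have [pi [piL _ pi_le pij pi0]] :=
    fibre_representation G_locally_compact G_etale G0_hausdorff jP jd le.
  rewrite -pij//; have -> : pi (j f) = pi (j f - psi T).
    by rewrite [in RHS]addrC -scaleN1r piL pi0// scaler0 add0r.
  exact: le_trans (pi_le _) fa.
move=> jE; move: h; rewrite -jE lee_fin => h.
apply: le_trans (rnorm_leD _ (j f)) _; rewrite (splitr e) rnormB.
exact: lerD.
Qed.

End Obstruction.

Theorem corollary3p9 (R : realType) (G : topGroupoid) (S : twist R G)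
    (G_nonempty : [set: G] !=set0)
    (G_locally_compact : locally_compact_subspace [set: G])
    (G_etale : etale G)
    (G0_locally_compact : locally_compact_subspace (units G))
    (G0_hausdorff : hausdorff_subspace (units G))
    (A : cstar_algebra R) (j : (G -> fell_bundle S) -> A)
    (A_full : is_full_Cstar j)
    (H : hilbert R) (H_infinite : infinite_dimensional H) :
  [/\ forall J : lin_subspace (bounded_op H),
        two_sided_ideal J -> closed [set T | J T] -> (exists T, ~~ J T) ->
        [/\ ~ star_isomorphic (BH_quotient J) A,
            forall (Ar : cstar_algebra R) (jr : (G -> fell_bundle S) -> Ar)
                (lambda_red : A -> Ar),
              is_reduced_Cstar jr -> is_lambda_red j jr lambda_red ->
              forall phi : BH_quotient J -> A, @star_morphism R (BH_quotient J) A phi ->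
              range phi `<=` [set a | lambda_red a = 0] &
            forall e : A, @is_identity R A e ->
              ~ exists2 phi : BH_quotient J -> A,
                  @star_morphism R (BH_quotient J) A phi & phi (quot_class J (id_op H)) = e],
      ~ star_isomorphic (BH H) A &
      ~ star_isomorphic (calkin H) A].
Proof.
have unital psi : @star_morphism R (BH H) A psi -> ~ @is_identity R A (psi (id_op H)).
  move=> psiP; exact: (no_unital_morphism G_nonempty G_locally_compact G_etale
    G0_hausdorff H_infinite A_full psiP).
have quot (J : lin_subspace (bounded_op H)) : two_sided_ideal J ->
    closed [set T | J T] -> ~ star_isomorphic (BH_quotient J) A.
  move=> JI Jc [phi phiP phiB]; apply: (unital (phi \o quot_class J)).
    exact: star_morphism_quot_class.
  exact: (star_isomorphism_identity phiP phiB (quot_class_identity JI)).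
split.
- move=> J JI Jc _; split.
  + exact: quot.
  + move=> Ar jr lambda_red jrP [[lL lM lS] _] phi phiP _ [x _ <-] /=.
    have [pL pM pS] := star_morphism_quot_class JI Jc phiP.
    have P : @star_morphism R (BH H) Ar (lambda_red \o (phi \o quot_class J)).
      split=> [a U V|U V|U].
      * by rewrite -lL -pL.
      * by rewrite -lM -pM.
      * by rewrite -lS -pS.
    by rewrite -(quot_class_repr x); exact: (reduced_kernel
      G_locally_compact G_etale G0_hausdorff H_infinite jrP P).
  + move=> e eP [phi phiP phi1]; apply: (unital (phi \o quot_class J)).
      exact: star_morphism_quot_class.
    by rewrite /= phi1.
(* [BH H] is an algebra of its own rather than a quotient by the zero ideal, so its identity is used
   directly. *)
- move=> [phi phiP phiB]; apply: (unital _ phiP).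
  apply: (star_isomorphism_identity (e := id_op H : BH H) phiP phiB) => T.
  by split; exact: bounded_op_inj.
- by apply: quot; [exact: compact_ops_two_sided|exact: compact_ops_closed].
Qed.
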